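(* Let $\mathcal{M}$ be the triangular lattice with $L^2$ sites and periodic boundary conditions, and consider the Hubbard model described in the context on it. Fix an arbitrary $\nu$ with $0<\nu<1$. Suppose that the electron number $N_e$ satisfies $|\mathcal{M}|\ge N_e\ge|\mathcal{M}|-\frac{(1-\nu)^{1/4}}{5}|\mathcal{M}|^{3/4}$. Then, in the limits $U\uparrow\infty$ and $s\uparrow\infty$, every ground state of the model has total spin $S_{\mathrm{tot}}>\nu S_{\max}$, where $S_{\max}=N_e/2$.
   Context: Lattice: $\mathcal{M}$ is the triangular lattice with $L\times L$ sites and periodic boundary conditions in both directions. Its sites are $x=(n_1,n_2)\in(\mathbb{Z}/L\mathbb{Z})^2$, and each site is joined to its six neighbours $x\pm(1,0)$, $x\pm(0,1)$, $x\pm(1,-1)$. The bond set $\mathcal{B}$ contains each nearest-neighbour pair exactly once with an arbitrary orientation, and $\mathcal{E}=\mathcal{B}\cup\{(y,x):(x,y)\in\mathcal{B}\}$; thus $\zeta=6$. For each $(x,y)\in\mathcal{B}$ introduce two additional sites $u(x,y),\bar u(x,y)$; let $\mathcal{O}$ and $\bar{\mathcal{O}}$ be the sets of all $u(x,y)$ and all $\bar u(x,y)$ respectively, and let $\Lambda=\mathcal{M}\cup\mathcal{O}\cup\bar{\mathcal{O}}$. Operators: $c_{z,\sigma}$ ($z\in\Lambda$, $\sigma\in\{\uparrow,\downarrow\}$) are the fermion annihilation operators, $n_{z,\sigma}=c^\dagger_{z,\sigma}c_{z,\sigma}$. Fix $\mu>0$. For $x\in\mathcal{M}$, $a_{x,\sigma}=(1+2\zeta\mu^2)^{-1/2}\{c_{x,\sigma}+\mu\sum_{y:(x,y)\in\mathcal{B}}(c_{u(x,y),\sigma}-c_{\bar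 u(x,y),\sigma})+\mu\sum_{y:(y,x)\in\mathcal{B}}(c_{u(y,x),\sigma}+c_{\bar u(y,x),\sigma})\}$. For $u=u(x,y)$, $b_{u,\sigma}=c_{u,\sigma}-\mu(c_{x,\sigma}+c_{y,\sigma})$; for $\bar u=\bar u(x,y)$, $b_{\bar u,\sigma}=c_{\bar u,\sigma}+\mu(c_{x,\sigma}-c_{y,\sigma})$. Hamiltonian, with $s,t,U>0$: $H=t\sum_{(x,y)\in\mathcal{E},\sigma}a^\dagger_{x,\sigma}a_{y,\sigma}+s\sum_{v\in\mathcal{O}\cup\bar{\mathcal{O}},\sigma}b^\dagger_{v,\sigma}b_{v,\sigma}+U\sum_{z\in\Lambda}n_{z,\uparrow}n_{z,\downarrow}$. It acts on the $N_e$-electron space with $N_e\le|\mathcal{M}|$. Spin: $S^+_z=c^\dagger_{z,\uparrow}c_{z,\downarrow}$, $S^-_z=c^\dagger_{z,\downarrow}c_{z,\uparrow}$, $S^{(3)}_z=\tfrac12(n_{z,\uparrow}-n_{z,\downarrow})$, $S^{(1)}_z=(S^+_z+S^-_z)/2$, $S^{(2)}_z=(S^+_z-S^-_z)/(2i)$. The total spin is $\mathbf{S}_{\mathrm{tot}}=\sum_{z\in\Lambda}\mathbf{S}_z$, with eigenvalues of $(\mathbf{S}_{\mathrm{tot}})^2$ written $S_{\mathrm{tot}}(S_{\mathrm{tot}}+1)$. Ground states in the limits: a fixed state $|\Phi\rangle$ is a finite-energy state if $\lim_{s\uparrow\infty}\lim_{U\uparrow\infty}\langle\Phi|H|\Phi\rangle<\infty$.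 The ground states in the limits $U\uparrow\infty$, $s\uparrow\infty$ are the normalized $N_e$-electron states minimizing this limiting energy. *)

(* Defs.v *)
(* (+ MathComp-Analysis for limits, + real_closed for R[i]). *)
From HB Require Import structures.
From mathcomp Require Import all_boot all_order all_algebra.
From mathcomp Require Import all_classical all_reals all_analysis.
From mathcomp.real_closed Require Import complex.

Set Implicit Arguments.
Unset Strict Implicit.
Unset Printing Implicit Defensive.

Import Order.TTheory GRing.Theory Num.Theory.
Import numFieldNormedType.Exports.
Local Open Scope classical_set_scope.
Local Open Scope ring_scope.

(* The triangular lattice M with L x L sites and periodic b.c.              *)
(* Sites are (Z/LZ)^2; we use 'Z_L, which is Z/LZ as soon as 1 < L          *)
(* (the theorem assumes 2 < L, so that each site has six distinct           *)
(* neighbours and zeta = 6).                                                *)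

Definition site (L : nat) := ('Z_L * 'Z_L)%type.

(* nearest neighbours: y - x is one of +-(1,0), +-(0,1), +-(1,-1) *)
Definition nbr (L : nat) : rel (site L) := fun x y =>
  (y.1 - x.1, y.2 - x.2) \in
    [:: (1, 0); (-1, 0); (0, 1); (0, -1); (1, -1); (-1, 1)].

(* B is a bond set: each nearest-neighbour pair occurs exactly once, with an
   arbitrary orientation. *)
Definition is_bond_set (L : nat) (B : rel (site L)) : Prop :=
  (forall x y, B x y -> nbr x y) /\
  (forall x y, nbr x y -> B x y != B y x).

(* The bonds (x,y) in B *)
Definition bond (L : nat) (B : rel (site L)) := {p : site L * site L | B p.1 p.2}.

(* Lambda = M + O + Obar: inl x is the site x of M, inr (inl b) is u(b),
   inr (inr b) is ubar(b). *)
Definition lam (L : nat) (B : rel (site L)) :=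
  (site L + (bond B + bond B))%type.

Definition siteM L (B : rel (site L)) (x : site L) : lam B := inl x.
Definition uO L (B : rel (site L)) (b : bond B) : lam B := inr (inl b).
Definition ubarO L (B : rel (site L)) (b : bond B) : lam B := inr (inr b).

(* one-particle modes (z, sigma); sigma = true is spin up, false is spin down *)
Definition mode L (B : rel (site L)) := (lam B * bool)%type.
Definition up := true.
Definition down := false.

(* Fock space: the occupation-number basis is indexed by finite sets of
   modes; a state is a complex coefficient function on this basis. *)
Definition basis L (B : rel (site L)) := {set mode B}.
Definition state (R : realType) L (B : rel (site L)) := {ffun basis B -> R[i]}.

Section Fock.
Variables (R : realType) (L : nat) (B : rel (site L)).
Local Notation C := R[i].
Local Notation st := (state R B).
Local Notation md := (mode B).

(* Jordan-Wigner sign w.r.t. a fixed enumeration of the modes: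
   (-1)^(number of modes of T preceding m) *)
Definition jw_sign (T : basis B) (m : md) : C :=
  (-1) ^+ #|[set m' in T | (enum_rank m' < enum_rank m)%N]|.

(* annihilation operator c_m *)
Definition cop (m : md) (psi : st) : st :=
  [ffun T : basis B => if m \in T then 0 else jw_sign T m * psi (m |: T)].

(* creation operator c_m^dagger *)
Definition cdag (m : md) (psi : st) : st :=
  [ffun T : basis B => if m \in T then jw_sign T m * psi (T :\ m) else 0].

(* number operator n_m = c_m^dagger c_m *)
Definition nop (m : md) (psi : st) : st := cdag m (cop m psi).

(* inner product <phi|psi> (antilinear in phi) *)
Definition inner (phi psi : st) : C := \sum_T ((phi T)^*)%C * psi T.

Definition normalized (phi : st) : Prop := inner phi phi = 1.

(* phi lies in the N_e-electron space *)
Definition n_electron (Ne : nat) (phi : st) : Prop :=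
  forall T : basis B, #|T| != Ne -> phi T = 0.

(* ---------------- the Hamiltonian ---------------- *)
Variable mu : R.

Definition rC (r : R) : C := (r%:C)%C.

(* zeta = 6 for the triangular lattice *)
Definition kappa : R := Num.sqrt (1 + 2 * 6 * mu ^+ 2)^-1.

(* a_{x,sigma} *)
Definition aop (x : site L) (sg : bool) (psi : st) : st :=
  rC kappa *:
    (cop (siteM B x, sg) psi
     + rC mu *: (\sum_(b : bond B | (val b).1 == x)
                   (cop (uO b, sg) psi - cop (ubarO b, sg) psi))
     + rC mu *: (\sum_(b : bond B | (val b).2 == x)
                   (cop (uO b, sg) psi + cop (ubarO b, sg) psi))).

(* a_{x,sigma}^dagger (all coefficients are real) *)
Definition adag (x : site L) (sg : bool) (psi : st) : st :=
  rC kappa *: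
    (cdag (siteM B x, sg) psi
     + rC mu *: (\sum_(b : bond B | (val b).1 == x)
                   (cdag (uO b, sg) psi - cdag (ubarO b, sg) psi))
     + rC mu *: (\sum_(b : bond B | (val b).2 == x)
                   (cdag (uO b, sg) psi + cdag (ubarO b, sg) psi))).

(* b_{u,sigma} for u = u(x,y), and b_{ubar,sigma} for ubar = ubar(x,y) *)
Definition bop_u (b : bond B) (sg : bool) (psi : st) : st :=
  cop (uO b, sg) psi
  - rC mu *: (cop (siteM B (val b).1, sg) psi + cop (siteM B (val b).2, sg) psi).
Definition bdag_u (b : bond B) (sg : bool) (psi : st) : st :=
  cdag (uO b, sg) psi
  - rC mu *: (cdag (siteM B (val b).1, sg) psi + cdag (siteM B (val b).2, sg) psi).
Definition bop_ubar (b : bond B) (sg : bool) (psi : st) : st :=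
  cop (ubarO b, sg) psi
  + rC mu *: (cop (siteM B (val b).1, sg) psi - cop (siteM B (val b).2, sg) psi).
Definition bdag_ubar (b : bond B) (sg : bool) (psi : st) : st :=
  cdag (ubarO b, sg) psi
  + rC mu *: (cdag (siteM B (val b).1, sg) psi - cdag (siteM B (val b).2, sg) psi).

(* H = t sum_{(x,y) in E, sigma} a^dag_x a_y
       + s sum_{v in O u Obar, sigma} b^dag_v b_v + U sum_z n_up n_down.
   E = B u B^{-1} is exactly the set of ordered nearest-neighbour pairs. *)
Definition ham (t s U : R) (psi : st) : st :=
  rC t *: (\sum_(x : site L) \sum_(y : site L | nbr x y) \sum_(sg : bool)
             adag x sg (aop y sg psi))
  + rC s *: (\sum_(b : bond B) \sum_(sg : bool)
               (bdag_u b sg (bop_u b sg psi) + bdag_ubar b sg (bop_ubar b sg psi)))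
  + rC U *: (\sum_(z : lam B) nop (z, up) (nop (z, down) psi)).

(* expectation value <phi|H|phi> (a real number, H being hermitian) *)
Definition energy (t s U : R) (phi : st) : R := complex.Re (inner phi (ham t s U phi)).

(* phi is a finite-energy state whose limiting energy
   lim_{s -> oo} lim_{U -> oo} <phi|H|phi> equals the real number e *)
Definition limit_energy (t : R) (phi : st) (e : R) : Prop :=
  exists g : R -> R,
    (\forall s \near +oo, energy t s U phi @[U --> +oo] --> g s) /\
    g s @[s --> +oo] --> e.

(* ground states in the limits U -> oo, s -> oo, in the N_e-electron space *)
Definition ground_state (t : R) (Ne : nat) (phi : st) : Prop :=
  normalized phi /\ n_electron Ne phi /\
  exists e : R, limit_energy t phi e /\
    forall (psi : st) (e' : R),
      normalized psi -> n_electron Ne psi -> limit_energy t psi e' -> e <= e'.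

(* ---------------- spin ---------------- *)
Definition Splus (z : lam B) (psi : st) : st := cdag (z, up) (cop (z, down) psi).
Definition Sminus (z : lam B) (psi : st) : st := cdag (z, down) (cop (z, up) psi).
Definition S3 (z : lam B) (psi : st) : st :=
  rC (2^-1) *: (nop (z, up) psi - nop (z, down) psi).
Definition S1 (z : lam B) (psi : st) : st :=
  rC (2^-1) *: (Splus z psi + Sminus z psi).
Definition S2 (z : lam B) (psi : st) : st :=
  (2 * 'i)^-1 *: (Splus z psi - Sminus z psi).

Definition Stot1 (psi : st) : st := \sum_(z : lam B) S1 z psi.
Definition Stot2 (psi : st) : st := \sum_(z : lam B) S2 z psi.
Definition Stot3 (psi : st) : st := \sum_(z : lam B) S3 z psi.

(* (S_tot)^2 = (S_tot^(1))^2 + (S_tot^(2))^2 + (S_tot^(3))^2 *)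
Definition Stot_sq (psi : st) : st :=
  Stot1 (Stot1 psi) + Stot2 (Stot2 psi) + Stot3 (Stot3 psi).

(* phi has total spin S_tot > S0: phi is orthogonal to every eigenvector of
   (S_tot)^2 with eigenvalue S(S+1), S <= S0; i.e. phi lies in the span of
   the eigenspaces of (S_tot)^2 with S_tot > S0. *)
Definition total_spin_gt (S0 : R) (phi : st) : Prop :=
  forall (psi : st) (S : R), 0 <= S -> S <= S0 ->
    Stot_sq psi = rC (S * (S + 1)) *: psi -> inner psi phi = 0.

End Fock.

(* Main.v *)
(** The operators [a_x] are orthonormal fermion modes on the triangular
    lattice, orthogonal to every [b_v]. A state has finite energy in the double
    limit iff all [b_v] annihilate it and no site is doubly occupied. Written in
    the [a]-modes, this says that two electrons never share a lattice site
    (hard core) and that two electrons on neighbouring sites form a triplet.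

    Let [h = |M| - Ne] be the number of holes. In a configuration whose hole set
    has [A] ordered nearest-neighbour pairs, the hopping term moves electrons
    into holes along [6 h - A] bonds, so by AM-GM the energy is at least
    [t (min A - 6 h)]. A spin-polarized Slater determinant filling all plane
    waves except [h] low-momentum ones has energy at most
    [t (- 6 h + 25 h^2 / L^2)]. Hence the ground state charges a configuration
    with fewer than [sqrt (1 - nu) * L] adjacent hole pairs.

    With so few bonds between holes, an isoperimetric inequality on the torus
    shows that the occupied sites form one cluster up to a small fraction of
    [(1 - nu) Ne] sites. Exchanging spins inside the cluster does not change the
    wave function, and the Casimir operator
    [S^2 = 3 Ne / 4 + (1/2) sum_(i <> j) (P_ij - 1/2)], with [P_ij = 1] inside
    the cluster and [P_ij >= -1] elsewhere, forces [S > nu Ne / 2]. *)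
Require Import Defs.
From HB Require Import structures.
From mathcomp Require Import all_boot all_order all_algebra.
From mathcomp Require Import all_classical all_reals all_analysis.
From mathcomp.real_closed Require Import complex.
From mathcomp Require Import ring lra zify.
From mathcomp Require Import finset perm.
Require Import Defs.
Import Order.TTheory GRing.Theory Num.Theory.
Set Implicit Arguments.
Unset Strict Implicit.
Unset Printing Implicit Defensive.
Local Open Scope ring_scope.

(** * Anticommutation relations *)

(** A ground state may mix several values of the total spin, so low spin is refuted one eigenvalue
    at a time: an eigenvector of [S^2] overlapping [phi] yields a nonzero component of [phi] in its
    eigenspace, and this component is again an energy minimizer. For it a single configuration of
    nonzero amplitude suffices: [S^2] exchanges spins without moving electrons, so its eigenvalue
    can be read off from the spin amplitudes at those positions. The exponents come from two
    squarings. With [r = sqrt (1 - nu)], the squared hole condition reads [25 h^2 <= r L^3], so the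
    variational excess, whose constant [11/5 pi^2] is below 25, stays below [r L]. A hole set with
    [a < r L / 2] bonds cuts off at most [a^2 / 4 < (1 - nu) L^2 / 16] sites; as at most [L^2 / 8]
    sites are holes, fewer than [(1 - nu) Ne / 14] electrons lie outside the cluster. The Casimir
    estimate loses about [2 Ne] per such electron, which is affordable against the gap
    [(1 - nu^2) Ne^2 / 4]. *)

Section CAR.
Variables (R : realType) (L : nat) (B : rel (site L)).
Local Notation C := R[i].
Local Notation st := (state R B).
Local Notation md := (mode B).
Implicit Types (m u v : md) (psi chi : st) (T : basis B).

Lemma cop_is_linear m : linear (@cop R L B m).
Proof.
move=> k p q; apply/ffunP => T; rewrite !ffunE; rewrite /GRing.scale /=; case: ifP => _; first by rewrite mulr0 add0r.
by rewrite mulrDr mulrCA.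
Qed.
HB.instance Definition _ m := GRing.isLinear.Build C st st *:%R (@cop R L B m) (cop_is_linear m).

Lemma cdag_is_linear m : linear (@cdag R L B m).
Proof.
move=> k p q; apply/ffunP => T; rewrite !ffunE; rewrite /GRing.scale /=; case: ifP => _; last by rewrite mulr0 add0r.
by rewrite mulrDr mulrCA.
Qed.
HB.instance Definition _ m := GRing.isLinear.Build C st st *:%R (@cdag R L B m) (cdag_is_linear m).

Lemma copD m p q : cop m (p + q) = cop m p + cop m q :> st. Proof. exact: linearD. Qed.
Lemma copZ m k p : cop m (k *: p) = k *: cop m p :> st. Proof. exact: linearZ. Qed.
Lemma cop_0 m : cop m 0 = 0 :> st. Proof. exact: linear0. Qed.
Lemma cop_sum m (I : Type) (r : seq I) (P : pred I) (F : I -> st) :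
  cop m (\sum_(i <- r | P i) F i) = \sum_(i <- r | P i) cop m (F i).
Proof. exact: linear_sum. Qed.

Lemma cdagD m p q : cdag m (p + q) = cdag m p + cdag m q :> st. Proof. exact: linearD. Qed.
Lemma cdagZ m k p : cdag m (k *: p) = k *: cdag m p :> st. Proof. exact: linearZ. Qed.
Lemma cdagN m p : cdag m (- p) = - cdag m p :> st. Proof. exact: linearN. Qed.
Lemma cdagB m p q : cdag m (p - q) = cdag m p - cdag m q :> st. Proof. exact: linearB. Qed.
Lemma cdag_0 m : cdag m 0 = 0 :> st. Proof. exact: linear0. Qed.
Lemma cdag_sum m (I : Type) (r : seq I) (P : pred I) (F : I -> st) :
  cdag m (\sum_(i <- r | P i) F i) = \sum_(i <- r | P i) cdag m (F i).
Proof. exact: linear_sum. Qed.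

Lemma jw_sign_add T u v : u \notin T ->
  jw_sign R (u |: T) v = (-1) ^+ (enum_rank u < enum_rank v)%N * jw_sign R T v.
Proof.
move=> uT; rewrite /jw_sign; have [luv|luv] := ltnP.
  rewrite -exprD; congr (_ ^+ _).
  have -> : [set m' in u |: T | (enum_rank m' < enum_rank v)%N] =
      u |: [set m' in T | (enum_rank m' < enum_rank v)%N].
    by apply/setP => w; rewrite !inE; case: eqVneq => // ->; rewrite luv.
  by rewrite cardsU1 !inE (negbTE uT).
rewrite mul1r; congr (_ ^+ _); apply: eq_card => w; rewrite !inE.
by case: eqVneq => // ->; rewrite ltnNge luv (negbTE uT).
Qed.

Lemma jw_signK T v : jw_sign R T v * jw_sign R T v = 1.
Proof. by rewrite -expr2 sqrr_sign. Qed.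

Lemma jw_sign_self T v : v \notin T -> jw_sign R (v |: T) v = jw_sign R T v.
Proof. by move=> vT; rewrite jw_sign_add // ltnn mul1r. Qed.

(** Exactly one of two distinct modes precedes the other in the enumeration. This asymmetry turns
    the Jordan-Wigner signs into anticommutation. *)
Lemma rank_sign u v : u != v ->
  (-1) ^+ (enum_rank u < enum_rank v)%N = - (-1) ^+ (enum_rank v < enum_rank u)%N :> C.
Proof.
move=> uv; have : enum_rank u != enum_rank v by rewrite (inj_eq enum_rank_inj).
by rewrite -val_eqE /=; case: ltngtP => //; rewrite expr0 expr1 ?opprK.
Qed.

Lemma cop_anticomm u v psi : cop u (cop v psi) = - cop v (cop u psi).
Proof.
apply/ffunP => T; rewrite !ffunE !inE.
have [->|uv] := eqVneq u v.
  by case: ifP => _; rewrite /= ?mulr0 oppr0.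
rewrite /=; case: ifP => uT; case: ifP => vT; rewrite ?mulr0 ?oppr0 //.
rewrite [v |: (u |: T)]setUCA.
rewrite (jw_sign_add v) ?uT // (jw_sign_add u) ?vT // (rank_sign uv).
move: (jw_sign R T u) (jw_sign R T v) (psi _) ((-1) ^+ _) => a b c d; ring.
Qed.

Lemma cop_sqr0 u psi : cop u (cop u psi) = 0.
Proof. by apply/ffunP => T; rewrite !ffunE !inE eqxx /=; case: ifP; rewrite ?mulr0. Qed.

Lemma cdag_anticomm u v psi : cdag u (cdag v psi) = - cdag v (cdag u psi).
Proof.
apply/ffunP => T; rewrite !ffunE !inE.
have [->|uv] := eqVneq u v.
  by case: ifP => _; rewrite /= ?mulr0 oppr0.
rewrite /=; case: ifP => uT; case: ifP => vT; rewrite ?mulr0 ?oppr0 //.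
have Eu : T :\ u = v |: (T :\ v :\ u) 
  by apply/setP => w; rewrite !inE; case: (eqVneq w v) => [->|_] //=; rewrite vT eq_sym uv.
have Ev : T :\ v = u |: (T :\ v :\ u) by rewrite setD1K // !inE uT uv.
have nu : u \notin T :\ v :\ u by rewrite !inE eqxx.
have nv : v \notin T :\ v :\ u by rewrite !inE eqxx andbF.
have E1 : jw_sign R T u = (-1) ^+ (enum_rank v < enum_rank u)%N * jw_sign R (T :\ v :\ u) u.
  by rewrite -jw_sign_add // -Eu -{1}(setD1K uT) jw_sign_self // !inE eqxx.
have E2 : jw_sign R T v = (-1) ^+ (enum_rank u < enum_rank v)%N * jw_sign R (T :\ v :\ u) v.
  by rewrite -jw_sign_add // -Ev -{1}(setD1K vT) jw_sign_self // !inE eqxx.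
rewrite E1 E2 Eu Ev setU1K //.
rewrite [in LHS]jw_sign_self // setU1K // [in RHS]jw_sign_self //.
rewrite (rank_sign uv).
by move: (jw_sign R _ u) (jw_sign R _ v) (psi _) ((-1) ^+ _) => a b c d; ring.
Qed.

Lemma cop_cdag u v psi :
  cop u (cdag v psi) = (u == v)%:R *: psi - cdag v (cop u psi).
Proof.
apply/ffunP => T; rewrite !ffunE !inE.
have [<-|uv] := eqVneq u v.
  rewrite /= scale1r; case: ifP => uT.
    have E1 : jw_sign R (T :\ u) u = jw_sign R T u.
      by rewrite -{2}(setD1K uT) jw_sign_self // !inE eqxx.
    by rewrite setD1K // E1 mulrA jw_signK mul1r subrr.
  by rewrite jw_sign_self ?uT // mulrA jw_signK mul1r setU1K ?uT // subr0.
rewrite scale0r add0r /=; case: ifP => uT;  case: ifP => vT; rewrite ?mulr0 ?oppr0 //.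
have Ev : T = v |: (T :\ v) :> {set md} by rewrite setD1K.
have nv : v \notin T :\ v by rewrite !inE eqxx.
have nu : u \notin T :\ v by rewrite !inE uT andbF.
rewrite [jw_sign R T u](_ : _ = (-1) ^+ (enum_rank v < enum_rank u)%N * jw_sign R (T :\ v) u); last first.
  by rewrite -jw_sign_add // -Ev.
rewrite (jw_sign_add v) ?uT // (rank_sign uv).
rewrite (_ : (u |: T) :\ v = u |: T :\ v).
  by case: (_ < _)%N; move: (jw_sign R _ u) (jw_sign R _ v) (psi _) => a b c; ring.
by apply/setP => w; rewrite !inE; case: (eqVneq w u) => [->|//]; rewrite uv.
Qed.

Lemma inner_cdag m psi chi : inner psi (cdag m chi) = inner (cop m psi) chi.
Proof.
rewrite /inner (bigID (fun T : basis B => m \in T)) /= [X in _ + X]big1 ?addr0; last first.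
  by move=> T /negbTE mT; rewrite ffunE mT mulr0.
rewrite [RHS](bigID (fun T : basis B => m \notin T)) /= [X in _ = _ + X]big1 ?addr0; last first.
  by move=> T /negbNE mT; rewrite ffunE mT rmorph0 mul0r.
rewrite (reindex_onto (fun T : basis B => m |: T) (fun T : basis B => T :\ m)) /=; last first.
  by move=> T mT; rewrite setD1K.
apply: eq_big => T.
  rewrite setU11 /=; apply/eqP/idP => [<-|]; first by rewrite !inE eqxx.
  by move=> mT; rewrite setU1K.
rewrite setU11 /= => /eqP E.
have mT : m \notin T by rewrite -E !inE eqxx.
rewrite !ffunE (negbTE mT) setU11 E jw_sign_self // rmorphM /=.
have -> : ((jw_sign R T m)^*)%C = jw_sign R T m by rewrite /jw_sign rmorphXn rmorphN rmorph1.
by move: (jw_sign R _ m) (psi _)  => a b; ring.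
Qed.
End CAR.

Lemma scale_combine (K : comNzRingType) (V : lmodType K) (a b d : K) (p q : V) :
  a *: (b *: (d *: p - q)) = (d * (a * b)) *: p - b *: (a *: q).
Proof. by rewrite !scalerBr !scalerA [b * a]mulrC [d * _]mulrC. Qed.

(** Both sides equal [A + D + F s t]. In [flip_hop] these are the extra terms from moving a flip
    past the creator and past the annihilator, summed over the spin. *)
Lemma spin_sum_balance (K : nzRingType) (V : lmodType K) (s t : bool) (A D : V) (F : bool -> bool -> V) :
  A + (t == true)%:R *: F s true + (D + (t == false)%:R *: F s false) =
  A + (s == true)%:R *: F true t + (D + (s == false)%:R *: F false t).
Proof. by case: s; case: t; rewrite /= !(scale0r, scale1r, addr0) // addrA addrAC. Qed.

(** * Orbitals and spin-flip operators *)
Section Orbitals.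
Variables (R : realType) (L : nat) (B : rel (site L)).
Local Notation C := R[i].
Local Notation st := (state R B).
Implicit Types (f g : lam B -> C) (s t : bool) (psi chi : st).

(** The coefficients are not conjugated, so [ann f] and [cre f] are mutually adjoint only for real
    [f], and [ann_cre] produces the bilinear pairing of [f] and [g]. *)
Definition ann f s psi : st := \sum_z f z *: cop (z, s) psi.
Definition cre f s psi : st := \sum_z f z *: cdag (z, s) psi.

Lemma ann_is_linear f s : linear (ann f s).
Proof.
move=> k p q; rewrite /ann scaler_sumr -big_split; apply: eq_bigr => z _ /=.
by rewrite linearP scalerDr !scalerA mulrC.
Qed.
HB.instance Definition _ f s := GRing.isLinear.Build C st st *:%R (ann f s) (ann_is_linear f s).

Lemma cre_is_linear f s : linear (cre f s).
Proof.
move=> k p q; rewrite /cre scaler_sumr -big_split; apply: eq_bigr => z _ /=.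
by rewrite linearP scalerDr !scalerA mulrC.
Qed.
HB.instance Definition _ f s := GRing.isLinear.Build C st st *:%R (cre f s) (cre_is_linear f s).

Lemma annD f s p q : ann f s (p + q) = ann f s p + ann f s q :> st. Proof. exact: linearD. Qed.
Lemma annZ f s k p : ann f s (k *: p) = k *: ann f s p :> st. Proof. exact: linearZ. Qed.
Lemma ann_0 f s : ann f s 0 = 0 :> st. Proof. exact: linear0. Qed.
Lemma creD f s p q : cre f s (p + q) = cre f s p + cre f s q :> st. Proof. exact: linearD. Qed.
Lemma creZ f s k p : cre f s (k *: p) = k *: cre f s p :> st. Proof. exact: linearZ. Qed.
Lemma creB f s p q : cre f s (p - q) = cre f s p - cre f s q :> st. Proof. exact: linearB. Qed.
Lemma cre_0 f s : cre f s 0 = 0 :> st. Proof. exact: linear0. Qed.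
Lemma cre_sum f s (I : Type) (r : seq I) (P : pred I) (F : I -> st) :
  cre f s (\sum_(i <- r | P i) F i) = \sum_(i <- r | P i) cre f s (F i).
Proof. exact: linear_sum. Qed.

Lemma ann_anticomm f g s t psi : ann f s (ann g t psi) = - ann g t (ann f s psi).
Proof.
rewrite {1}/ann (eq_bigr (fun z => \sum_w f z *: (g w *: cop (z, s) (cop (w, t) psi)))); last first.
  by move=> z _; rewrite cop_sum scaler_sumr; apply: eq_bigr => w _; rewrite copZ.
rewrite exchange_big -sumrN; apply: eq_bigr => z _.
rewrite cop_sum scaler_sumr -sumrN; apply: eq_bigr => w _.
by rewrite copZ cop_anticomm !scalerN !scalerA mulrC.
Qed.

Lemma cop_cdag_at z w s t psi :
  cop (z, s) (cdag (w, t) psi) = ((z == w) && (s == t))%:R *: psi - cdag (w, t) (cop (z, s) psi).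
Proof. by rewrite cop_cdag. Qed.

Lemma ann_cre f g s t psi :
  ann f s (cre g t psi) = ((s == t)%:R * \sum_z f z * g z) *: psi - cre g t (ann f s psi).
Proof.
rewrite {1}/ann (eq_bigr (fun z => \sum_w f z *: (g w *: cop (z, s) (cdag (w, t) psi)))); last first.
  by move=> z _; rewrite cop_sum scaler_sumr; apply: eq_bigr => w _; rewrite copZ.
rewrite /cre [in RHS](eq_bigr (fun w => \sum_z g w *: (f z *: cdag (w, t) (cop (z, s) psi)))); last first.
  by move=> z _; rewrite cdag_sum scaler_sumr; apply: eq_bigr => w _; rewrite cdagZ.
rewrite [X in _ - X]exchange_big /= mulr_sumr scaler_suml -sumrB; apply: eq_bigr => z _.
transitivity (\sum_w ((((z == w) && (s == t))%:R * (f z * g w)) *: psi -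
    g w *: (f z *: cdag (w, t) (cop (z, s) psi)))).
  by apply: eq_bigr => w _; rewrite cop_cdag_at; exact: scale_combine.
rewrite sumrB -scaler_suml; congr (_ - _); congr (_ *: _).
rewrite (bigD1 z) //= eqxx big1 ?addr0 // => w wz.
by rewrite eq_sym (negbTE wz) mul0r.
Qed.

Lemma inner_conj psi chi : inner psi chi = ((inner chi psi)^*)%C.
Proof.
rewrite /inner rmorph_sum; apply: eq_bigr => T _.
by rewrite rmorphM /= conjcK mulrC.
Qed.

Lemma innerDr psi p q : inner psi (p + q) = inner psi p + inner psi q.
Proof. by rewrite /inner -big_split; apply: eq_bigr => T _ /=; rewrite ffunE mulrDr. Qed.

Lemma innerZr psi k p : inner psi (k *: p) = k * inner psi p.
Proof. by rewrite /inner mulr_sumr; apply: eq_bigr => T _ /=; rewrite ffunE mulrCA. Qed.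

Lemma innerNr psi p : inner psi (- p) = - inner psi p.
Proof. by rewrite -scaleN1r innerZr mulN1r. Qed.

Lemma innerBr psi p q : inner psi (p - q) = inner psi p - inner psi q.
Proof. by rewrite innerDr innerNr. Qed.

Lemma inner0r psi : inner psi 0 = 0.
Proof. by rewrite -(scale0r 0) innerZr mul0r. Qed.

Lemma inner_sumr psi (I : Type) (r : seq I) (P : pred I) (F : I -> st) :
  inner psi (\sum_(i <- r | P i) F i) = \sum_(i <- r | P i) inner psi (F i).
Proof. by elim/big_rec2: _ => [|i y1 y2 _ <-]; rewrite ?inner0r ?innerDr. Qed.

Lemma innerDl psi1 psi2 chi : inner (psi1 + psi2) chi = inner psi1 chi + inner psi2 chi.
Proof. by rewrite inner_conj innerDr rmorphD /= -!inner_conj. Qed.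

Lemma innerZl k psi chi : inner (k *: psi) chi = (k^*)%C * inner psi chi.
Proof. by rewrite inner_conj innerZr rmorphM /= -inner_conj. Qed.

Lemma innerNl psi chi : inner (- psi) chi = - inner psi chi.
Proof. by rewrite inner_conj innerNr rmorphN /= -inner_conj. Qed.

Lemma innerBl psi1 psi2 chi : inner (psi1 - psi2) chi = inner psi1 chi - inner psi2 chi.
Proof. by rewrite innerDl innerNl. Qed.

Lemma inner0l chi : inner 0 chi = 0.
Proof. by rewrite inner_conj inner0r rmorph0. Qed.

Lemma inner_suml (I : Type) (r : seq I) (P : pred I) (F : I -> st) chi :
  inner (\sum_(i <- r | P i) F i) chi = \sum_(i <- r | P i) inner (F i) chi.
Proof. by elim/big_rec2: _ => [|i y1 y2 _ <-]; rewrite ?inner0l ?innerDl. Qed.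

Lemma inner_ge0 psi : 0 <= inner psi psi.
Proof. by apply: sumr_ge0 => T _; rewrite mulrC mul_conjC_ge0. Qed.

Lemma inner_eq0 psi : inner psi psi = 0 -> psi = 0.
Proof.
move=> h; apply/ffunP => T; rewrite ffunE; apply/eqP.
have /allP /(_ T) : all (fun T : basis B => true ==> (((psi T)^*)%C * psi T == 0)) (index_enum _).
  rewrite -psumr_eq0; first by apply/eqP.
  by move=> U _; rewrite mulrC mul_conjC_ge0.
by rewrite mem_index_enum /= mulrC mul_conjC_eq0; apply.
Qed.

Definition real_orbital f := forall z, ((f z)^*)%C = f z.

Lemma inner_cre f s psi chi : real_orbital f ->
  inner psi (cre f s chi) = inner (ann f s psi) chi.
Proof.
move=> fR; rewrite inner_sumr inner_suml; apply: eq_bigr => z _.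
by rewrite innerZr inner_cdag innerZl fR.
Qed.

(** For [s != t] these are the total raising and lowering operators, for [s = t] the number
    operators of one spin. A linear operator that commutes with all four commutes with [Stot_sq]. *)
Definition flip s t psi : st := \sum_z cdag (z, s) (cop (z, t) psi).

Lemma flip_is_linear s t : linear (flip s t).
Proof.
move=> k p q; rewrite /flip scaler_sumr -big_split; apply: eq_bigr => z _ /=.
by rewrite !linearP.
Qed.
HB.instance Definition _ s t := GRing.isLinear.Build C st st *:%R (flip s t) (flip_is_linear s t).

Lemma flipD s t p q : flip s t (p + q) = flip s t p + flip s t q :> st. Proof. exact: linearD. Qed.
Lemma flipZ s t k p : flip s t (k *: p) = k *: flip s t p :> st. Proof. exact: linearZ. Qed.
Lemma flipN s t p : flip s t (- p) = - flip s t p :> st. Proof. exact: linearN. Qed.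
Lemma flip_sum s t (I : Type) (r : seq I) (P : pred I) (F : I -> st) :
  flip s t (\sum_(i <- r | P i) F i) = \sum_(i <- r | P i) flip s t (F i).
Proof. exact: linear_sum. Qed.

Lemma flip_cdag s t z r psi :
  flip s t (cdag (z, r) psi) = cdag (z, r) (flip s t psi) + (t == r)%:R *: cdag (z, s) psi.
Proof.
rewrite /flip cdag_sum (bigD1 z) //= [X in _ = X + _](bigD1 z) //=.
rewrite cop_cdag_at eqxx /= cdagB cdagZ cdag_anticomm opprK -addrA addrC; congr (_ + _ + _).
apply: eq_bigr => w wz.
by rewrite cop_cdag_at (negbTE wz) /= scale0r sub0r cdagN cdag_anticomm opprK.
Qed.

Lemma cop_flip s t z r psi :
  cop (z, r) (flip s t psi) = flip s t (cop (z, r) psi) + (s == r)%:R *: cop (z, t) psi.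
Proof.
rewrite /flip cop_sum (bigD1 z) //= [X in _ = X + _](bigD1 z) //=.
rewrite cop_cdag_at eqxx /= eq_sym cop_anticomm cdagN opprK -addrA addrC; congr (_ + _ + _).
apply: eq_bigr => w wz.
by rewrite cop_cdag_at eq_sym (negbTE wz) /= scale0r sub0r cop_anticomm cdagN opprK.
Qed.

Lemma flip_cre s t f r psi :
  flip s t (cre f r psi) = cre f r (flip s t psi) + (t == r)%:R *: cre f s psi.
Proof.
rewrite /cre flip_sum scaler_sumr -big_split; apply: eq_bigr => z _ /=.
by rewrite flipZ flip_cdag scalerDr !scalerA mulrC.
Qed.

Lemma ann_flip s t f r psi :
  ann f r (flip s t psi) = flip s t (ann f r psi) + (s == r)%:R *: ann f t psi.
Proof.
rewrite /ann flip_sum scaler_sumr -big_split; apply: eq_bigr => z _ /=.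
by rewrite flipZ cop_flip scalerDr !scalerA mulrC.
Qed.

Lemma inner_flip s t psi chi : inner psi (flip s t chi) = inner (flip t s psi) chi.
Proof.
rewrite inner_sumr inner_suml; apply: eq_bigr => z _ /=.
by rewrite inner_cdag [RHS]inner_conj inner_cdag -inner_conj.
Qed.

Lemma flip_hop s t f g psi :
  flip s t (\sum_(r : bool) cre f r (ann g r psi)) = \sum_(r : bool) cre f r (ann g r (flip s t psi)).
Proof.
have P r := flip_cre s t f r (ann g r psi).
have Q r : cre f r (ann g r (flip s t psi)) =
    cre f r (flip s t (ann g r psi)) + (s == r)%:R *: cre f r (ann g t psi).
  by rewrite ann_flip creD creZ.
rewrite flip_sum !big_bool (P true) (P false) (Q true) (Q false).
exact: (spin_sum_balance s t _ _ (fun r r' => cre f r (ann g r' psi))).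
Qed.

Lemma cdag_sqr0 m psi : cdag m (cdag m psi) = 0 :> st.
Proof. by apply/ffunP => T; rewrite !ffunE !inE eqxx /=; case: ifP; rewrite ?mulr0. Qed.

Lemma docc_swap z psi : nop (z, up) (nop (z, down) psi) =
  - cdag (z, true) (cdag (z, false) (cop (z, true) (cop (z, false) psi))) :> st.
Proof. by rewrite /nop /up /down cop_cdag_at andbF scale0r sub0r linearN. Qed.

(** Two electrons on one site form a singlet: the terms added by a flip contain a repeated ladder
    operator and vanish if [s != t], and they match on the two sides if [s = t]. *)
Lemma flip_docc s t z psi :
  flip s t (nop (z, up) (nop (z, down) psi)) = nop (z, up) (nop (z, down) (flip s t psi)).
Proof.
rewrite !docc_swap flipN; congr (- _).
rewrite !(flip_cdag, cop_flip, cdagD, cdagZ, copD, copZ).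
have h p : cdag (z, true) (cdag (z, false) (p : st)) = - cdag (z, false) (cdag (z, true) p).
  exact: cdag_anticomm.
have h' p : cop (z, true) (cop (z, false) (p : st)) = - cop (z, false) (cop (z, true) p).
  exact: cop_anticomm.
case: s; case: t; rewrite /= ?scale1r ?scale0r ?cdag_sqr0 ?cop_sqr0 ?cdag_0.
all: by rewrite !addr0.
Qed.

End Orbitals.

(** The hypothesis makes kernel and range meet only in 0, and rank-nullity then makes their sum
    everything. Applied to [S^2] minus one eigenvalue, this replaces a full spectral
    decomposition. *)
Lemma ker_im_sum (K : fieldType) (V : vectType K) (f : 'End(V)) :
  (forall v, f (f v) = 0 -> f v = 0) ->
  forall v, exists v1 w, f v1 = 0 /\ v = v1 + f w.
Proof.
move=> h v.
have dis : (lker f :&: limg f = 0)%VS.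
  apply/eqP; rewrite -subv0; apply/subvP => x /memv_capP [].
  by rewrite memv_ker => /eqP fx /memv_imgP [y _ xE]; rewrite memv0 xE (h y) // -xE fx.
have full : (lker f + limg f)%VS = fullv.
  apply/eqP; rewrite eqEdim subvf /= dimv_disjoint_sum //.
  by rewrite -(limg_ker_dim f fullv) capfv.
have /memv_addP [v1 v1k [v2 /memv_imgP [w _ ->] ->]] : v \in (lker f + limg f)%VS.
  by rewrite full memvf.
by exists v1, w; split=> //; apply/eqP; rewrite -memv_ker.
Qed.

(** The algebra of [S1^2 + S2^2], with [a = 1/2], [b = 1/(2i)], [c = 1/4]: the squares [PP] and [MM]
    of the raising and lowering operators cancel and the mixed products double. *)
Lemma vec_combine (K : fieldType) (V : lmodType K) (a b c : K) (PP PM MP MM : V) :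
  a * a = c -> b * b = - c ->
  a *: (a *: (PP + PM) + a *: (MP + MM)) + b *: (b *: (PP - PM) - b *: (MP - MM)) =
  (c *+ 2) *: (PM + MP).
Proof.
move=> ha hb.
rewrite -scalerDr -scalerBr !scalerA ha hb scaleNr -scalerBr -scalerMnl scalerMnr; congr (_ *: _).
have -> : PP + PM + (MP + MM) = (PP + MM) + (PM + MP) by rewrite [MP + _]addrC addrACA.
have -> : PP - PM - (MP - MM) = (PP + MM) - (PM + MP).
  by rewrite opprB opprD addrACA.
by rewrite opprB [_ + (PM + MP)]addrC addrACA subrr addr0 mulr2n.
Qed.

Lemma lin_combine (K : comNzRingType) (V : lmodType K) (a b k : K) (x y u v z w : V) :
  a *: (k *: x + y + (k *: u + v)) + b *: (k *: z + w) =
  k *: (a *: (x + u) + b *: z) + (a *: (y + v) + b *: w).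
Proof.
rewrite [_ + (k *: u + v)]addrACA -!scalerDr !scalerDr !scalerA ![_ * k]mulrC.
by rewrite [k * b]mulrC [b * k]mulrC addrACA.
Qed.

(** * Total spin *)
Section Spin.
Variables (R : realType) (L : nat) (B : rel (site L)).
Local Notation C := R[i].
Local Notation st := (state R B).
Implicit Types (s t : bool) (psi chi p q : st).

(** Self-adjointness gives [<f v, f v> = <v, f (f v)>], so [f (f v) = 0] forces [f v = 0], the
    hypothesis of [ker_im_sum]. *)
Lemma selfadjoint_decomp (f : st -> st) :
  (forall k p q, f (k *: p + q) = k *: f p + f q) ->
  (forall p q, inner p (f q) = inner (f p) q) ->
  forall psi, exists psi1 chi, f psi1 = 0 /\ psi = psi1 + f chi.
Proof.
move=> flin fadj psi.
pose V : vectType C := {ffun basis B -> C^o}.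
pose g : V -> V := f.
have glin : linear g by move=> k p q; exact: flin.
pose gl := GRing.isLinear.Build C V V *:%R g glin.
pose G : {linear V -> V} := HB.pack g gl.
have gE v : linfun G v = f v by rewrite lfunE.
have [v|v1 [w [h1 h2]]] := @ker_im_sum C V (linfun G) _ psi.
  rewrite !gE => h; apply: (@inner_eq0 R L B).
  by rewrite -fadj h inner0r.
by exists v1, w; move: h1 h2; rewrite !gE.
Qed.


Lemma Stot1E psi : Stot1 psi = 2^-1 *: (flip true false psi + flip false true psi) :> st.
Proof.
rewrite /Stot1 /S1 -scaler_sumr big_split /=; congr (_ *: _).
by rewrite /rC fmorphV rmorphMn rmorph1.
Qed.

Lemma Stot2E psi : Stot2 psi = (2 * 'i)^-1 *: (flip true false psi - flip false true psi) :> st.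
Proof. by rewrite /Stot2 /S2 -scaler_sumr sumrB. Qed.

Definition zflip psi : st := flip true true psi - flip false false psi.

Lemma Stot3E psi : Stot3 psi = 2^-1 *: zflip psi :> st.
Proof.
rewrite /Stot3 /S3 -scaler_sumr sumrB; congr (_ *: _).
by rewrite /rC fmorphV rmorphMn rmorph1.
Qed.

Lemma Stot_sqE psi : Stot_sq psi =
  2^-1 *: (flip true false (flip false true psi) + flip false true (flip true false psi))
  + 4^-1 *: zflip (zflip psi) :> st.
Proof.
rewrite /Stot_sq; congr (_ + _); last first.
  rewrite !Stot3E /zflip !flipZ -scalerBr scalerA; congr (_ *: _).
  by rewrite -invfM -natrM.
have ha : 2^-1 * 2^-1 = 4^-1 :> C by rewrite -invfM -natrM.
have hb : (2 * 'i)^-1 * (2 * 'i)^-1 = - 4^-1 :> C.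
  by rewrite -invfM mulrACA -['i * 'i]expr2 sqrCi mulrN1 invrN; congr (- _^-1); rewrite -natrM.
have hc : 2^-1 = 4^-1 *+ 2 :> C by rewrite -mulr_natr; field.
rewrite !Stot1E !Stot2E !flipZ !flipD !flipN [in RHS]hc.
exact: (vec_combine _ _ _ _ ha hb).
Qed.

Lemma zflip_comm (X : st -> st) :
  (forall p q, X (p - q) = X p - X q) ->
  (forall s t p, flip s t (X p) = X (flip s t p)) ->
  forall p, zflip (X p) = X (zflip p).
Proof. by move=> XB Xc p; rewrite /zflip XB !Xc. Qed.

Lemma Stot_sq_comm (X : st -> st) :
  (forall k p q, X (k *: p + q) = k *: X p + X q) ->
  (forall s t p, flip s t (X p) = X (flip s t p)) ->
  forall p, Stot_sq (X p) = X (Stot_sq p).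
Proof.
move=> XL Xc p.
have XD q r : X (q + r) = X q + X r by rewrite -[q in LHS]scale1r XL scale1r.
have X0 : X 0 = 0 by apply: (addrI (X 0)); rewrite -XD !addr0.
have XZ k q : X (k *: q) = k *: X q by rewrite -[k *: q]addr0 XL X0 addr0.
have XB q r : X (q - r) = X q - X r by rewrite XD -scaleN1r XZ scaleN1r.
by rewrite !Stot_sqE XD !XZ XD !(zflip_comm XB Xc) !Xc.
Qed.

Lemma zflip_linear k p q : zflip (k *: p + q) = k *: zflip p + zflip q.
Proof. by rewrite /zflip !flipD !flipZ scalerBr opprD addrACA. Qed.

Lemma Stot_sq_linear k p q : Stot_sq (k *: p + q) = k *: Stot_sq p + Stot_sq q :> st.
Proof.
rewrite !Stot_sqE !(zflip_linear, flipD, flipZ).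
exact: lin_combine.
Qed.

Lemma inner_zflip p q : inner p (zflip q) = inner (zflip p) q.
Proof. by rewrite innerBr innerBl !inner_flip. Qed.

Lemma inner_Stot_sq p q : inner p (Stot_sq q) = inner (Stot_sq p) q.
Proof.
have h1 : inner p (zflip (zflip q)) = inner (zflip (zflip p)) q by rewrite !inner_zflip.
have h2 : inner p (flip true false (flip false true q)) = inner (flip true false (flip false true p)) q.
  by rewrite !inner_flip.
have h3 : inner p (flip false true (flip true false q)) = inner (flip false true (flip true false p)) q.
  by rewrite !inner_flip.
have c2 : ((2^-1 : C)^*)%C = 2^-1 by rewrite conjc_inv; congr (_^-1); rewrite rmorph_nat.
have c4 : ((4^-1 : C)^*)%C = 4^-1 by rewrite conjc_inv; congr (_^-1); rewrite rmorph_nat.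
rewrite !Stot_sqE; move: h1 h2 h3.
move: (zflip (zflip q)) (zflip (zflip p)) (flip true false (flip false true q)) => a b c.
move: (flip true false (flip false true p)) (flip false true (flip true false q)) => d e.
move: (flip false true (flip true false p)) => f h1 h2 h3.
by rewrite innerDr innerDl !innerZr !innerZl innerDr innerDl h1 h2 h3 c2 c4.
Qed.

End Spin.

(** * The triangular lattice *)
Section Lattice.
Variable L : nat.
Implicit Types x y d : site L.

Definition dirs : seq (site L) := [:: (1, 0); (-1, 0); (0, 1); (0, -1); (1, -1); (-1, 1)].

Definition shift x d : site L := (x.1 + d.1, x.2 + d.2).

Lemma shift_inj x : injective (shift x).
Proof.
apply: (@can_inj _ _ _ (fun y => (y.1 - x.1, y.2 - x.2))) => -[a b].
by rewrite /shift /= [x.1 + a]addrC [x.2 + b]addrC !addrK.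
Qed.

Lemma nbr_shift x y : nbr x y = (y \in [seq shift x d | d <- dirs]).
Proof.
have -> : y = shift x (y.1 - x.1, y.2 - x.2).
  by case: y => a b; rewrite /shift /= ![_ + (_ - _)]addrC !subrK.
rewrite (mem_map (@shift_inj x)) /nbr /shift /=.
by rewrite ![_ + (_ - _)]addrC !subrK.
Qed.

Lemma nbr_sym x y : nbr x y = nbr y x.
Proof.
rewrite /nbr !inE !xpair_eqE -[y.1 - x.1]opprB -[y.2 - x.2]opprB !(eqr_oppLR, oppr0, opprK).
move: (_ == 1) (_ == -1) (_ == 0) (_ == 1) (_ == - 1) (_ == 0).
by do 6!case.
Qed.

Hypothesis hL : (2 < L)%N.

Lemma ZL_nat2 : (2 : 'Z_L) != 0.
Proof.
by move: hL; case: L => [|[|[|k]]] // _; rewrite -val_eqE /= !modn_small.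
Qed.

Lemma one_neqN1 : (1 : 'Z_L) != -1.
Proof. by rewrite -subr_eq0 opprK -[1 + 1]/2; exact: ZL_nat2. Qed.

(** Needs [2 != 0] modulo [L]: for [L = 2] opposite directions coincide. *)
Lemma uniq_dirs : uniq dirs.
Proof.
have h0 : (1 : 'Z_L) != 0 by exact: oner_neq0.
have h1 := one_neqN1.
have h2 : (-1 : 'Z_L) != 0 by rewrite oppr_eq0.
rewrite /= !inE !xpair_eqE ?(negbTE h0) ?(negbTE h1) ?(negbTE h2) ?eqxx.
rewrite ![0 == _]eq_sym ![-1 == 1]eq_sym ?(negbTE h0) ?(negbTE h1) ?(negbTE h2) ?eqxx //.
Qed.

Lemma uniq_shifts x : uniq [seq shift x d | d <- dirs].
Proof. by rewrite map_inj_uniq; [exact: uniq_dirs | exact: shift_inj]. Qed.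

Lemma sum_nbr (V : nmodType) x (F : site L -> V) :
  \sum_(y | nbr x y) F y = \sum_(d <- dirs) F (shift x d).
Proof.
rewrite (eq_bigl (fun y => y \in [seq shift x d | d <- dirs])); last by move=> y; exact: nbr_shift.
by rewrite -big_uniq ?uniq_shifts // big_map.
Qed.

Lemma card_nbr x : (\sum_(y | nbr x y) 1 = 6)%N.
Proof. by rewrite sum_nbr /dirs !big_cons big_nil. Qed.

Lemma card_ZL : #|'Z_L| = L.
Proof. by rewrite card_ord Zp_cast // ltnW. Qed.

Lemma card_site : #|{: site L}| = (L * L)%N.
Proof. by rewrite card_prod card_ZL. Qed.

Lemma nbr_irrefl x : nbr x x = false.
Proof.
rewrite /nbr !subrr !inE !xpair_eqE.
have h0 : (1 : 'Z_L) != 0 by exact: oner_neq0.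
have h2 : (-1 : 'Z_L) != 0 by rewrite oppr_eq0.
by rewrite ![0 == 1]eq_sym ![0 == -1]eq_sym ?(negbTE h0) ?(negbTE h2) ?andbF.
Qed.

Variable B : rel (site L).
Hypothesis hB : is_bond_set B.

Lemma sum_bond (V : nmodType) (F : site L * site L -> V) :
  \sum_(b : bond B) F (val b) = \sum_(p : site L * site L | B p.1 p.2) F p.
Proof.
rewrite [RHS](reindex_omap (val : bond B -> _) insub) /=; last first.
  by move=> p Bp; rewrite insubT.
by apply: eq_bigl => b; rewrite (valP b) valK eqxx.
Qed.

(** Every neighbour of [x] shares exactly one oriented bond with [x], whichever end [x] is, so the
    count is the number of neighbours. *)
Lemma bond_degree (K : nzRingType) x :
  \sum_(b : bond B) (((val b).1 == x)%:R + ((val b).2 == x)%:R) = 6 :> K.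
Proof.
rewrite (sum_bond (fun p => (p.1 == x)%:R + (p.2 == x)%:R)) big_mkcond /=.
rewrite (eq_bigr (fun p => (p.1 == x)%:R * (B p.1 p.2)%:R + (p.2 == x)%:R * (B p.1 p.2)%:R)); last first.
  by move=> p _; case: ifP => _; rewrite ?mulr1 ?mulr0 ?addr0.
rewrite big_split /= -(pair_bigA _ (fun a b => (a == x)%:R * (B a b)%:R)) /=.
rewrite -(pair_bigA _ (fun a b => (b == x)%:R * (B a b)%:R)) /= [X in _ + X]exchange_big /=.
rewrite (bigD1 x) //= [X in _ + X + _]big1 ?addr0; last first.
  by move=> y /negbTE yx; apply: big1 => z _; rewrite yx mul0r.
rewrite [X in _ + X](bigD1 x) //= [X in _ + (_ + X)]big1 ?addr0; last first.
  by move=> y /negbTE yx; apply: big1 => z _; rewrite yx mul0r.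
rewrite -big_split /= eqxx (eq_bigr (fun y => (nbr x y)%:R)); last first.
  move=> y _; rewrite !mul1r; case: hB => h1 h2.
  case E : (nbr x y); first by have := h2 _ _ E; case: (B x y); case: (B y x); rewrite //= ?addr0 ?add0r.
  have -> : B x y = false by apply/negP => /h1; rewrite E.
  have -> : B y x = false by apply/negP => /h1; rewrite nbr_sym E.
  by rewrite addr0.
by rewrite -natr_sum -(card_nbr x) [in RHS]big_mkcond.
Qed.
End Lattice.

Lemma bond_combine (K : comNzRingType) (V : lmodType K) (k m : K) (p q : bool) (U W : V) :
  k *: (m *: ((if p then U - W else 0) + (if q then U + W else 0))) =
  (k * (m * (p%:R + q%:R))) *: U + (k * (m * (q%:R - p%:R))) *: W.
Proof.
rewrite scalerA; case: p; case: q; rewrite ?(addr0, add0r, subr0, sub0r, subrr, mulr0, mulr1, mulrN1, mulrN, scaler0, scale0r, scaleNr) //.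
- by rewrite [U + W]addrC addrA subrK !mulrDr !mulr1 scalerDl scalerDr.
- by rewrite scalerBr.
- by rewrite scalerDr.
- by rewrite oppr0.
Qed.

(** * The orbitals of the model *)
Section Model.
Variables (R : realType) (L : nat) (B : rel (site L)) (mu : R).
Local Notation C := R[i].
Local Notation st := (state R B).
Implicit Types (s t : bool) (psi chi p q : st) (x y : site L) (b : bond B) (z : lam B).
Local Notation K := (rC (kappa mu)).
Local Notation M := (rC mu).

Lemma sum_lam (V : nmodType) (F : lam B -> V) :
  \sum_z F z = \sum_x F (inl x) + (\sum_b F (inr (inl b)) + \sum_b F (inr (inr b))).
Proof. by rewrite big_sumType /= big_sumType. Qed.

Definition orb_a x : lam B -> C := fun z => match z with
  | inl y => K * (y == x)%:R
  | inr (inl b) => K * (M * (((val b).1 == x)%:R + ((val b).2 == x)%:R))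
  | inr (inr b) => K * (M * (((val b).2 == x)%:R - ((val b).1 == x)%:R)) end.

Definition orb_u b : lam B -> C := fun z => match z with
  | inl y => - M * ((y == (val b).1)%:R + (y == (val b).2)%:R)
  | inr (inl b') => (b' == b)%:R
  | inr (inr b') => 0 end.

Definition orb_ubar b : lam B -> C := fun z => match z with
  | inl y => M * ((y == (val b).1)%:R - (y == (val b).2)%:R)
  | inr (inl b') => 0
  | inr (inr b') => (b' == b)%:R end.

Lemma sum_delta (V : lmodType C) (T : finType) (a : T) (k : C) (F : T -> V) :
  \sum_y (k * (y == a)%:R) *: F y = k *: F a.
Proof.
rewrite (bigD1 a) //= eqxx mulr1 big1 ?addr0 // => y /negbTE ->.
by rewrite mulr0 scale0r.
Qed.

Lemma sum_delta1 (V : lmodType C) (T : finType) (a : T) (F : T -> V) :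
  \sum_y ((y == a)%:R : C) *: F y = F a.
Proof.
rewrite (bigD1 a) //= eqxx scale1r big1 ?addr0 // => y /negbTE ->.
by rewrite scale0r.
Qed.

Lemma orb_a_sum (V : lmodType C) x (X : lam B -> V) :
  K *: (X (siteM B x) + M *: (\sum_(b : bond B | (val b).1 == x) (X (uO b) - X (ubarO b)))
     + M *: (\sum_(b : bond B | (val b).2 == x) (X (uO b) + X (ubarO b)))) =
  \sum_z orb_a x z *: X z.
Proof.
rewrite sum_lam /= sum_delta -addrA scalerDr; congr (_ + _).
rewrite -scalerDr big_mkcond [X in _ *: (_ *: (_ + X))]big_mkcond -!big_split /=.
rewrite !scaler_sumr; apply: eq_bigr => b _.
exact: bond_combine.
Qed.

Lemma orb_u_sum (V : lmodType C) b (X : lam B -> V) :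
  X (uO b) - M *: (X (siteM B (val b).1) + X (siteM B (val b).2)) = \sum_z orb_u b z *: X z.
Proof.
rewrite sum_lam /= sum_delta1 [X in _ = _ + (_ + X)]big1 ?addr0; last by move=> *; rewrite scale0r.
rewrite addrC; congr (_ + _).
rewrite (eq_bigr (fun y => (- M * (y == (val b).1)%:R) *: X (inl y) + (- M * (y == (val b).2)%:R) *: X (inl y))).
  by rewrite big_split /= !sum_delta -scalerDr scaleNr.
by move=> y _; rewrite mulrDr scalerDl.
Qed.

Lemma orb_ubar_sum (V : lmodType C) b (X : lam B -> V) :
  X (ubarO b) + M *: (X (siteM B (val b).1) - X (siteM B (val b).2)) = \sum_z orb_ubar b z *: X z.
Proof.
rewrite sum_lam /= sum_delta1 [X in _ = _ + (X + _)]big1 ?add0r; last by move=> *; rewrite scale0r.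
rewrite addrC; congr (_ + _).
rewrite (eq_bigr (fun y => (M * (y == (val b).1)%:R) *: X (inl y) + (- M * (y == (val b).2)%:R) *: X (inl y))).
  by rewrite big_split /= !sum_delta scaleNr -scalerBr.
by move=> y _; rewrite mulrBr scalerBl mulNr scaleNr.
Qed.

Lemma aopE x s psi : aop mu x s psi = ann (orb_a x) s psi.
Proof. exact: (orb_a_sum x (fun z => cop (z, s) psi)). Qed.

Lemma adagE x s psi : adag mu x s psi = cre (orb_a x) s psi.
Proof. exact: (orb_a_sum x (fun z => cdag (z, s) psi)). Qed.

Lemma bop_uE b s psi : bop_u mu b s psi = ann (orb_u b) s psi.
Proof. exact: (orb_u_sum b (fun z => cop (z, s) psi)). Qed.

Lemma bdag_uE b s psi : bdag_u mu b s psi = cre (orb_u b) s psi.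
Proof. exact: (orb_u_sum b (fun z => cdag (z, s) psi)). Qed.

Lemma bop_ubarE b s psi : bop_ubar mu b s psi = ann (orb_ubar b) s psi.
Proof. exact: (orb_ubar_sum b (fun z => cop (z, s) psi)). Qed.

Lemma bdag_ubarE b s psi : bdag_ubar mu b s psi = cre (orb_ubar b) s psi.
Proof. exact: (orb_ubar_sum b (fun z => cdag (z, s) psi)). Qed.

Lemma conj_rC (r : R) : ((rC r)^*)%C = rC r.
Proof. exact: conjc_real. Qed.

Lemma conj_nat n : ((n%:R : C)^*)%C = n%:R. Proof. exact: rmorph_nat. Qed.

Lemma conjCM (a c : C) : ((a * c)^*)%C = (a^*)%C * (c^*)%C. Proof. exact: rmorphM. Qed.
Lemma conjCD (a c : C) : ((a + c)^*)%C = (a^*)%C + (c^*)%C. Proof. exact: rmorphD. Qed.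
Lemma conjCN (a : C) : ((- a)^*)%C = - (a^*)%C. Proof. exact: rmorphN. Qed.

Lemma real_orb_a x : real_orbital (orb_a x).
Proof. by move=> [y|[b|b]]; rewrite /orb_a !(conjCM, conjCD, conjCN) !(conj_rC, conj_nat). Qed.

Lemma real_orb_u b : real_orbital (orb_u b).
Proof. by move=> [y|[c|c]]; rewrite /orb_u ?(conjCM, conjCD, conjCN) ?(conj_rC, conj_nat) ?(conj_nat 0). Qed.

Lemma real_orb_ubar b : real_orbital (orb_ubar b).
Proof. by move=> [y|[c|c]]; rewrite /orb_ubar ?(conjCM, conjCD, conjCN) ?(conj_rC, conj_nat) ?(conj_nat 0). Qed.

Lemma rCM (a c : R) : rC (a * c) = rC a * rC c. Proof. exact: (rmorphM (real_complex R)). Qed.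
Lemma rCD (a c : R) : rC (a + c) = rC a + rC c. Proof. exact: (rmorphD (real_complex R)). Qed.
Lemma rC1 : rC 1 = 1 :> C. Proof. by []. Qed.
Lemma rC_nat n : rC n%:R = n%:R :> C. Proof. exact: (rmorph_nat (real_complex R)). Qed.

Lemma kappa_sqr : K * K * (1 + 12 * (M * M)) = 1.
Proof.
have h : 0 < 1 + 2 * 6 * mu ^+ 2 by rewrite ltr_pwDl // mulr_ge0 ?sqr_ge0.
have -> : K * K * (1 + 12 * (M * M)) = rC (kappa mu ^+ 2 * (1 + 12 * mu ^+ 2)).
  by rewrite !expr2 (rCM (kappa mu * kappa mu)) (rCD 1) (rCM 12) (rC_nat 12) !rCM rC1.
rewrite /kappa sqr_sqrtr ?invr_ge0 ?ltW // -natrM mulVf ?rC1 //.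
by rewrite natrM lt0r_neq0.
Qed.

Lemma kappa_neq0 : K != 0.
Proof. by apply: contra_eq_neq kappa_sqr => ->; rewrite !mul0r eq_sym oner_neq0. Qed.

Hypotheses (hL : (2 < L)%N) (hB : is_bond_set B).

(** On one bond the products at [u] and [ubar] add up by [(p + q)(p' + q') + (q - p)(q' - p') =
    2(pp' + qq')]. So the cross terms of neighbouring sites cancel, and [kappa] normalizes
    [1 + 12 mu^2] to 1. *)
Lemma orb_aa x y : \sum_z orb_a x z * orb_a y z = (x == y)%:R.
Proof.
rewrite sum_lam /=.
rewrite (bigD1 x) //= eqxx mulr1 big1 ?addr0; last by move=> w /negbTE ->; rewrite mulr0 mul0r.
rewrite -big_split /=.
rewrite (eq_bigr (fun b => (K * K * (M * M) * 2 * (x == y)%:R) * (((val b).1 == x)%:R + ((val b).2 == x)%:R))).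
  rewrite -mulr_sumr bond_degree //.
  transitivity (K * K * (1 + 12 * (M * M)) * (x == y)%:R); first by ring.
  by rewrite kappa_sqr mul1r.
move=> b _.
have h (w : site L) : (w == x)%:R * (w == y)%:R = (x == y)%:R * (w == x)%:R :> C.
  have [->|_] := eqVneq w x; first by rewrite mul1r mulr1.
  by rewrite mul0r mulr0.
have h1 := h (val b).1; have h2 := h (val b).2.
move: h1 h2.
move: ((val b).1 == x)%:R ((val b).1 == y)%:R ((val b).2 == x)%:R ((val b).2 == y)%:R => u v w t h1 h2.
transitivity (K * K * (M * M) * 2 * (u * v + w * t)); first by ring.
rewrite h1 h2; ring.
Qed.

Lemma orb_ua b x : \sum_z orb_u b z * orb_a x z = 0.
Proof.
rewrite sum_lam /= [X in _ + (_ + X)]big1 ?addr0; last by move=> *; rewrite mul0r.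
rewrite [X in X + _](eq_bigr (fun y => (y == x)%:R * (- M * K * ((x == (val b).1)%:R + (x == (val b).2)%:R)))); last first.
  move=> y _; have [->|_] := eqVneq y x; [by rewrite mul1r mulr1; ring | by rewrite !(mulr0, mul0r)].
rewrite -mulr_suml (bigD1 x) //= eqxx big1 ?addr0; last by move=> y /negbTE ->.
rewrite (bigD1 b) //= eqxx [X in _ + (_ + X)]big1 ?addr0; last by move=> y /negbTE ->; rewrite mul0r.
rewrite ![x == _]eq_sym /=; ring.
Qed.

Lemma orb_ubara b x : \sum_z orb_ubar b z * orb_a x z = 0.
Proof.
rewrite sum_lam /= [X in _ + (X + _)]big1 ?add0r; last by move=> *; rewrite mul0r.
rewrite [X in X + _](eq_bigr (fun y => (y == x)%:R * (M * K * ((x == (val b).1)%:R - (x == (val b).2)%:R)))); last first.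
  move=> y _; have [->|_] := eqVneq y x; [by rewrite mul1r mulr1; ring | by rewrite !(mulr0, mul0r)].
rewrite -mulr_suml (bigD1 x) //= eqxx big1 ?addr0; last by move=> y /negbTE ->.
rewrite (bigD1 b) //= eqxx [X in _ + (_ + X)]big1 ?addr0; last by move=> y /negbTE ->; rewrite mul0r.
rewrite ![x == _]eq_sym /=; ring.
Qed.

End Model.

(** * Finite-energy states *)
Section FiniteEnergy.
Import numFieldNormedType.Exports.
Local Open Scope classical_set_scope.

Lemma affine_cvg (R : realType) (a d l : R) :
  (a + x * d) @[x --> +oo] --> l -> d = 0.
Proof.
move=> h; apply/eqP; apply/negPn/negP => d0.
have dp : 0 < `|d| by rewrite normr_gt0.
move/cvgrPdist_lt : h => /(_ _ dp) [M [Mr hM]].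
(* The values at [M + 1] and [M + 3] differ by [2 |d|], yet both lie strictly within [|d|] of the
   limit. *)
have := hM (M + 1) ltac:(lra); have := hM (M + 3) ltac:(lra).
rewrite /=; move: d0 dp; rewrite !ltr_norml.
case: (lerP 0 d) => dd d0; [rewrite (ger0_norm dd) | rewrite (ltr0_norm dd)]; nra.
Qed.

Lemma add0_ge0 (R : numDomainType) (u v : R) : 0 <= u -> 0 <= v -> u + v = 0 -> u = 0 /\ v = 0.
Proof. by move=> u0 v0 /eqP; rewrite paddr_eq0 // => /andP[/eqP-> /eqP->]. Qed.

Lemma sum0_ge0 (R : numDomainType) (T : finType) (F : T -> R) :
  (forall i, 0 <= F i) -> \sum_i F i = 0 -> forall i, F i = 0.
Proof.
move=> F0 /eqP; rewrite psumr_eq0 // => /allP h i; apply/eqP.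
by have := h i (mem_index_enum _).
Qed.

Section Energy.
Variables (R : realType) (L : nat) (B : rel (site L)) (mu : R).
Local Notation C := R[i].
Local Notation st := (state R B).
Implicit Types (s : bool) (psi chi p q : st) (x y : site L) (b : bond B) (z : lam B).

Definition hop x y psi : st := \sum_(s : bool) cre (orb_a mu x) s (ann (orb_a mu y) s psi).
Definition kin psi : st := \sum_x \sum_(y | nbr x y) hop x y psi.
Definition bnd psi : st := \sum_b ((\sum_s cre (orb_u mu b) s (ann (orb_u mu b) s psi))
   + \sum_s cre (orb_ubar mu b) s (ann (orb_ubar mu b) s psi)).
Definition docc psi : st := \sum_z nop (z, up) (nop (z, down) psi).

Lemma hamE (t s U : R) psi :
  ham mu t s U psi = rC t *: kin psi + rC s *: bnd psi + rC U *: docc psi.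
Proof.
have e1 : \sum_(x : site L) \sum_(y : site L | nbr x y) \sum_(r : bool) adag mu x r (aop mu y r psi) = kin psi.
  apply: eq_bigr => x _; apply: eq_bigr => y _; apply: eq_bigr => r _.
  by rewrite adagE aopE.
have e2 : \sum_(b : bond B) \sum_(r : bool)
    (bdag_u mu b r (bop_u mu b r psi) + bdag_ubar mu b r (bop_ubar mu b r psi)) = bnd psi.
  apply: eq_bigr => b _; rewrite -big_split; apply: eq_bigr => r _ /=.
  by rewrite bop_uE bdag_uE bop_ubarE bdag_ubarE.
by rewrite /ham e1 e2.
Qed.

Definition ev (X : st -> st) psi : R := complex.Re (inner psi (X psi)).
Definition sqn psi : R := complex.Re (inner psi psi).

Lemma inner_sqn psi : inner psi psi = rC (sqn psi).
Proof. by apply/esym/RRe_real/ger0_real/inner_ge0. Qed.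

Lemma sqn_ge0 psi : 0 <= sqn psi.
Proof. by have := inner_ge0 psi; rewrite inner_sqn /rC lecR. Qed.

Lemma sqn_eq0 psi : sqn psi = 0 -> psi = 0.
Proof. by move=> h; apply: inner_eq0; rewrite inner_sqn h. Qed.

Lemma ReD (a c : C) : complex.Re (a + c) = complex.Re a + complex.Re c.
Proof. by case: a; case: c. Qed.

Lemma Re_sum (I : Type) (r : seq I) (P : pred I) (F : I -> C) :
  complex.Re (\sum_(i <- r | P i) F i) = \sum_(i <- r | P i) complex.Re (F i).
Proof. by elim/big_rec2: _ => [|i y1 y2 _ <-] //; rewrite ReD. Qed.

Lemma ReZ (k : R) (c : C) : complex.Re (rC k * c) = k * complex.Re c.
Proof. by case: c => a d; rewrite /= mul0r subr0. Qed.

Lemma energyE (t s U : R) psi :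
  energy mu t s U psi = t * ev kin psi + s * ev bnd psi + U * ev docc psi.
Proof. by rewrite /energy hamE !innerDr !innerZr !ReD !ReZ. Qed.

Lemma ev_number (f : lam B -> C) psi : real_orbital f ->
  complex.Re (inner psi (\sum_s cre f s (ann f s psi))) = \sum_s sqn (ann f s psi).
Proof.
move=> fR; rewrite inner_sumr Re_sum; apply: eq_bigr => s _.
by rewrite inner_cre.
Qed.

Lemma ev_bnd psi : ev bnd psi = \sum_b ((\sum_s sqn (ann (orb_u mu b) s psi)) +
  \sum_s sqn (ann (orb_ubar mu b) s psi)).
Proof.
rewrite /ev /bnd inner_sumr Re_sum.
have h (b : bond B) : complex.Re (inner psi ((\sum_s cre (orb_u mu b) s (ann (orb_u mu b) s psi))
   + \sum_s cre (orb_ubar mu b) s (ann (orb_ubar mu b) s psi))) =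
   (\sum_s sqn (ann (orb_u mu b) s psi)) + \sum_s sqn (ann (orb_ubar mu b) s psi).
  rewrite -(ev_number _ (real_orb_u mu b)) -(ev_number _ (real_orb_ubar mu b)) -ReD.
  by congr complex.Re; exact: innerDr.
by apply: eq_bigr => b _; exact: h.
Qed.

Lemma ev_docc psi : ev docc psi = \sum_z sqn (cop (z, true) (cop (z, false) psi)).
Proof.
rewrite /ev /docc inner_sumr Re_sum; apply: eq_bigr => z _.
rewrite docc_swap innerNr !inner_cdag cop_anticomm innerNl opprK //.
Qed.

Definition fin psi :=
  [/\ forall b s, ann (orb_u mu b) s psi = 0, forall b s, ann (orb_ubar mu b) s psi = 0
    & forall z, cop (z, true) (cop (z, false) psi) = 0].

Lemma finP psi : fin psi <-> ev bnd psi = 0 /\ ev docc psi = 0.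
Proof.
rewrite ev_bnd ev_docc; split=> [[h1 h2 h3]|[h1 h2]].
  have z0 : sqn 0 = 0 :> R by rewrite /sqn inner0r.
  split; last by apply: big1 => z _; rewrite h3 z0.
  apply: big1 => b _; rewrite big1; first by rewrite add0r; apply: big1 => s _; rewrite h2 z0.
  by move=> s _; rewrite h1 z0.
have q0 (F : bool -> st) : 0 <= \sum_s sqn (F s) by apply: sumr_ge0 => s _; exact: sqn_ge0.
have h b : (\sum_s sqn (ann (orb_u mu b) s psi)) + \sum_s sqn (ann (orb_ubar mu b) s psi) = 0.
  by apply: (sum0_ge0 (fun b : bond B => addr_ge0 (q0 _) (q0 _)) h1).
have h' b : \sum_s sqn (ann (orb_u mu b) s psi) = 0 /\ \sum_s sqn (ann (orb_ubar mu b) s psi) = 0.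
  exact: (add0_ge0 (q0 _) (q0 _) (h b)).
split=> [b s|b s|z]; apply: sqn_eq0.
- exact: (sum0_ge0 (fun s => sqn_ge0 (ann (orb_u mu b) s psi)) (h' b).1).
- exact: (sum0_ge0 (fun s => sqn_ge0 (ann (orb_ubar mu b) s psi)) (h' b).2).
- exact: (sum0_ge0 (fun z => sqn_ge0 (cop (z, true) (cop (z, false) psi))) h2).
Qed.

(** The energy is affine in [U] and in [s], with slopes that are sums of squared norms. A finite
    limit forces the slopes, hence every summand, to vanish. *)
Lemma limit_energyP (t e : R) psi :
  limit_energy mu t psi e <-> fin psi /\ e = t * ev kin psi.
Proof.
rewrite finP; split=> [[g [hg ge]]|[[h1 h2] ->]]; last first.
  exists (fun _ => t * ev kin psi); split; last exact: cvg_cst.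
  apply: nearW => s; rewrite [X in X @ _](_ : _ = cst (t * ev kin psi)); first exact: cvg_cst.
  by apply/funext => U; rewrite energyE h1 h2 !mulr0 !addr0.
have hd : ev docc psi = 0.
  have [s hs] := @filter_ex _ _ _ _ hg.
  apply: (@affine_cvg _ (t * ev kin psi + s * ev bnd psi) _ (g s)).
  rewrite [X in X @ _](_ : _ = (fun U => energy mu t s U psi)) //.
  by apply/funext => U; rewrite energyE.
have gE : \forall s \near +oo, t * ev kin psi + s * ev bnd psi = g s.
  apply: filterS hg => s; rewrite [X in X @ _](_ : _ = cst (t * ev kin psi + s * ev bnd psi)).
    by move=> h; apply: (@cvg_unique _ _ (cst (t * ev kin psi + s * ev bnd psi) @ +oo) _ _ _ (@cvg_cst _ _ _ _ _) h).
  by apply/funext => U; rewrite energyE hd mulr0 addr0.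
have ge' : (t * ev kin psi + s * ev bnd psi) @[s --> +oo] --> e.
  apply: cvg_trans ge; apply: near_eq_cvg; exact: filterS gE.
have hb := affine_cvg ge'.
split=> //; move: ge'; rewrite [X in X @ _](_ : _ = cst (t * ev kin psi)).
  by move=> h; apply/esym; apply: (@cvg_unique _ _ (cst (t * ev kin psi) @ +oo) _ _ _ (@cvg_cst _ _ _ _ _) h).
by apply/funext => s; rewrite hb mulr0 addr0.
Qed.

End Energy.
End FiniteEnergy.

Lemma sub_lin_combine (K : comNzRingType) (V : lmodType K) (k c : K) (a d p q : V) :
  k *: a + d - c *: (k *: p + q) = k *: (a - c *: p) + (d - c *: q).
Proof. by rewrite scalerBr scalerDr !scalerA [k * c]mulrC opprD addrACA. Qed.

(** [T1], [T2] and [s1], [s2] are energies and squared norms of two orthogonal parts of a normalized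
    minimizer, [X] and [c] those of a competitor. The second part cannot have an energy per squared
    norm below the minimum, so the first cannot have one above it. *)
Lemma sector_arith (R : realFieldType) (t T1 T2 s1 s2 c X : R) : s1 + s2 = 1 -> 0 <= c -> 0 <= s1 ->
  t * (T1 + T2) * c <= t * X -> t * (T1 + T2) * s2 <= t * T2 ->
  t * (T1 * c) <= t * (X * s1).
Proof.
move=> hs c0 s0 k1 k2.
have h : t * T1 <= t * (T1 + T2) * s1 by have -> : s1 = 1 - s2 by [lra]; lra.
have h1 := ler_wpM2r c0 h; have h2 := ler_wpM2r s0 k1.
lra.
Qed.

(** * Spin sectors of the ground space *)
Section Sector.
Variables (R : realType) (L : nat) (B : rel (site L)) (mu : R).
Local Notation C := R[i].
Local Notation st := (state R B).
Implicit Types (s : bool) (psi chi p q phi : st) (x y : site L) (b : bond B) (z : lam B).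

Definition lin (X : st -> st) := forall k p q, X (k *: p + q) = k *: X p + X q.

Lemma lin0 (X : st -> st) : lin X -> X 0 = 0.
Proof.
move=> lX; have := lX 1 0 0; rewrite !scale1r addr0 => /eqP.
by rewrite -[X in X == _]addr0 => /eqP /addrI.
Qed.

Lemma lin_sum (T : finType) (P : pred T) (X : T -> st -> st) :
  (forall i, P i -> lin (X i)) -> lin (fun p => \sum_(i | P i) X i p).
Proof.
move=> h k p q; rewrite scaler_sumr -big_split; apply: eq_bigr => i Pi /=.
exact: (h i Pi k p q).
Qed.

Lemma lin_add (X Y : st -> st) : lin X -> lin Y -> lin (fun p => X p + Y p).
Proof. by move=> hX hY k p q; rewrite hX hY scalerDr; apply: addrACA. Qed.

Lemma lin_cre_ann f g s : lin (fun p => cre f s (ann g s p)).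
Proof. by move=> k p q; rewrite annD annZ creD creZ. Qed.

Lemma lin_nop2 z : lin (fun p => nop (z, up) (nop (z, down) p)).
Proof. by move=> k p q; rewrite /nop !(copD, copZ, cdagD, cdagZ). Qed.

Lemma lin_hop x y : lin (hop mu x y).
Proof. by apply: lin_sum => s _; exact: lin_cre_ann. Qed.

Lemma lin_kin : lin (kin mu).
Proof. by apply: lin_sum => x _; apply: lin_sum => y _; exact: lin_hop. Qed.

Lemma lin_bnd : lin (bnd mu).
Proof.
by apply: lin_sum => b _; apply: lin_add; apply: lin_sum => s _; exact: lin_cre_ann.
Qed.

Lemma lin_docc : lin (@docc R L B).
Proof. by apply: lin_sum => z _; exact: lin_nop2. Qed.

Lemma flip_kin s r psi : flip s r (kin mu psi) = kin mu (flip s r psi).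
Proof.
rewrite /kin flip_sum; apply: eq_bigr => x _; rewrite flip_sum; apply: eq_bigr => y _.
exact: flip_hop.
Qed.

Lemma flip_bnd s r psi : flip s r (bnd mu psi) = bnd mu (flip s r psi).
Proof.
rewrite /bnd flip_sum; apply: eq_bigr => b _; rewrite flipD.
by apply: f_equal2; exact: flip_hop.
Qed.

Lemma flip_doccs s r psi : flip s r (docc psi) = docc (flip s r psi).
Proof.
by rewrite /docc flip_sum; apply: eq_bigr => z _; exact: flip_docc.
Qed.

(** [selfadjoint_decomp] works in the whole Fock space, so its parts need not have [n] electrons.
    Since [S^2] conserves the electron number, projecting both parts preserves the splitting. *)
Definition numproj n psi : st := [ffun T : basis B => if #|T| == n then psi T else 0].

Lemma lin_numproj n : lin (numproj n).
Proof.
move=> k p q; apply/ffunP => T; rewrite !ffunE; case: ifP => _ //.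
by rewrite /GRing.scale /= mulr0 addr0.
Qed.

Lemma numproj_electron n psi : n_electron n (numproj n psi).
Proof. by move=> T /negbTE; rewrite ffunE => ->. Qed.

Lemma numproj_id n psi : n_electron n psi -> numproj n psi = psi.
Proof.
move=> h; apply/ffunP => T; rewrite ffunE; case: eqVneq => // Tn.
by rewrite h.
Qed.

Lemma flip_numproj s r n psi : flip s r (numproj n psi) = numproj n (flip s r psi).
Proof.
apply/ffunP => T; rewrite [RHS]ffunE !sum_ffunE.
have h z : (cdag (z, s) (cop (z, r) (numproj n psi))) T =
    if #|T| == n then (cdag (z, s) (cop (z, r) psi)) T else 0.
  rewrite !ffunE; case: ifP => zT; last by case: ifP.
  case: ifP => zr; first by rewrite !mulr0; case: ifP.
  have -> : #|(z, r) |: T :\ (z, s)| = #|T|.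
    by rewrite cardsU1 zr (cardsD1 (z, s) T) zT.
  by case: ifP; rewrite ?mulr0.
rewrite (eq_bigr _ (fun z _ => h z)); case: ifP => // _.
by rewrite big1.
Qed.

Lemma ev_scale (X : st -> st) (k : R) psi : lin X -> ev X (rC k *: psi) = k ^+ 2 * ev X psi.
Proof.
move=> hX; have X0 := lin0 hX.
rewrite {1}/ev; have -> : X (rC k *: psi) = rC k *: X psi by have := hX (rC k) psi 0; rewrite X0 !addr0.
by rewrite /ev innerZr innerZl !conj_rC !ReZ mulrA expr2.
Qed.

Lemma sqn_scale (k : R) psi : sqn (rC k *: psi) = k ^+ 2 * sqn psi.
Proof. by rewrite /sqn innerZr innerZl !conj_rC !ReZ mulrA expr2. Qed.

Lemma fin_scale (k : C) psi : fin mu psi -> fin mu (k *: psi).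
Proof.
move=> [h1 h2 h3]; split=> [b s|b s|z]; rewrite ?annZ ?copZ ?h1 ?h2 ?h3; exact: scaler0.
Qed.

Lemma n_electron_scale (k : C) n psi : n_electron n psi -> n_electron n (k *: psi).
Proof. by move=> h T /h hT; rewrite ffunE hT; exact: mulr0. Qed.

(** Minimality in homogeneous form, valid without normalization: a nonzero competitor is rescaled,
    the zero state is treated apart. *)
Lemma ground_facts (t : R) n phi : ground_state mu t n phi ->
  [/\ sqn phi = 1, n_electron n phi, fin mu phi &
   forall psi, n_electron n psi -> fin mu psi -> t * ev (kin mu) phi * sqn psi <= t * ev (kin mu) psi].
Proof.
move=> [h1 [h2 [e [/limit_energyP [h3 he] hmin]]]]; split=> //.
  by rewrite /sqn h1.
move=> psi h4 h5.
have [/eqP s0|s0] := boolP (sqn psi == 0).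
  by rewrite (sqn_eq0 s0) /sqn /ev !inner0l /= !mulr0.
have sp : 0 < sqn psi by rewrite lt_def s0 sqn_ge0.
pose k := (Num.sqrt (sqn psi))^-1.
have kk : k ^+ 2 = (sqn psi)^-1 by rewrite exprVn sqr_sqrtr // ltW.
have := hmin (rC k *: psi) (t * ev (kin mu) (rC k *: psi)).
rewrite he ev_scale; last exact: lin_kin.
rewrite kk => h.
rewrite -ler_pdivlMr // -mulrA [_ / _]mulrC; apply: h.
- by rewrite /normalized inner_sqn sqn_scale kk mulVf.
- exact: n_electron_scale.
- apply/limit_energyP; split; first exact: fin_scale.
  by rewrite ev_scale ?kk //; exact: lin_kin.
Qed.

(* S^2 is self-adjoint and commutes with the Hamiltonian: splitting phi along the
   kernel and the range of S^2 - lam0, the kernel part is again a minimizer. *)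
Lemma sector (t lam0 : R) n phi psi : 0 < t ->
  ground_state mu t n phi -> Stot_sq psi = rC lam0 *: psi -> inner psi phi != 0 ->
  exists phi1, [/\ 0 < sqn phi1, n_electron n phi1, fin mu phi1, Stot_sq phi1 = rC lam0 *: phi1 &
    forall chi, n_electron n chi -> fin mu chi -> ev (kin mu) phi1 * sqn chi <= ev (kin mu) chi * sqn phi1].
Proof.
move=> t0 /ground_facts [h1 h2 h3 hmin] hpsi hne.
pose N p : st := Stot_sq p - rC lam0 *: p.
have Nlin : lin N.
  move=> k p q; rewrite /N Stot_sq_linear.
  exact: sub_lin_combine.
have Nadj p q : inner p (N q) = inner (N p) q.
  by rewrite /N innerBr innerBl inner_Stot_sq innerZr innerZl conj_rC.
have [phi0 [chi0 [hk hd]]] := selfadjoint_decomp Nlin Nadj phi.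
have Ncomm (X : st -> st) : lin X -> (forall s r p, flip s r (X p) = X (flip s r p)) ->
    forall p, N (X p) = X (N p).
  move=> lX cX p; rewrite /N (Stot_sq_comm lX cX).
  rewrite -[RHS](_ : X (rC (- lam0) *: p + Stot_sq p) = _).
    rewrite lX addrC; congr (_ + _).
    by rewrite /rC rmorphN scaleNr.
  by rewrite addrC /rC rmorphN scaleNr.
have NP := Ncomm _ (lin_numproj n) (fun s r p => flip_numproj s r n p).
pose phi1 := numproj n phi0; pose chi1 := numproj n chi0; pose phi2 := N chi1.
have hd1 : phi = phi1 + phi2.
  rewrite /phi2 /chi1 NP -(numproj_id h2) hd.
  by have := lin_numproj n 1 phi0 (N chi0); rewrite !scale1r.
have N0 : N 0 = 0 := lin0 Nlin.
have hk1 : N phi1 = 0.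
  rewrite /phi1 NP hk.
  by apply/ffunP => T; rewrite !ffunE; case: ifP.
(* [phi1] is in the kernel of [N] and [phi2] in its range; as [N] is self-adjoint and commutes with
   [X], the cross terms vanish. *)
have cross (X : st -> st) : lin X -> (forall s r p, flip s r (X p) = X (flip s r p)) ->
    ev X phi = ev X phi1 + ev X phi2.
  move=> lX cX; have NX := Ncomm X lX cX.
  have -> : ev X phi = complex.Re (inner (phi1 + phi2) (X phi1 + X phi2)).
    by rewrite /ev hd1; have := lX 1 phi1 phi2; rewrite !scale1r => ->.
  have X0 := lin0 lX.
  rewrite innerDl !innerDr.
  have -> : inner phi1 (X phi2) = 0 by rewrite /phi2 -NX Nadj hk1 inner0l.
  have -> : inner phi2 (X phi1) = 0 by rewrite /phi2 -Nadj NX hk1 X0 inner0r.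
  by rewrite addr0 add0r ReD.
have lid : lin id by [].
have hs : sqn phi = sqn phi1 + sqn phi2 by apply: (cross id lid).
have e1 := cross _ lin_kin flip_kin.
have e2 := cross _ lin_bnd flip_bnd.
have e3 := cross _ lin_docc flip_doccs.
have /finP [b0 d0] := h3.
(* Bond and double-occupancy energies are nonnegative and additive over the two parts, so both parts
   inherit finite energy from [phi]. *)
have bge p : 0 <= ev (bnd mu) p.
  by rewrite ev_bnd; apply: sumr_ge0 => b _; apply: addr_ge0; apply: sumr_ge0 => s _; exact: sqn_ge0.
have dge p : 0 <= ev (@docc R L B) p.
  by rewrite ev_docc; apply: sumr_ge0 => z _; exact: sqn_ge0.
have [b1 b2] : ev (bnd mu) phi1 = 0 /\ ev (bnd mu) phi2 = 0.
  by apply: add0_ge0; rewrite // -e2.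
have [d1 d2] : ev (@docc R L B) phi1 = 0 /\ ev (@docc R L B) phi2 = 0.
  by apply: add0_ge0; rewrite // -e3.
have f1 : fin mu phi1 by apply/finP.
have f2 : fin mu phi2 by apply/finP.
have n2 : n_electron n phi2 by rewrite /phi2 /chi1 NP; exact: numproj_electron.
exists phi1; split=> //.
- rewrite lt_def sqn_ge0 andbT; apply: contra_neq hne => /sqn_eq0 z1.
  have Npsi : N psi = 0 by rewrite /N hpsi subrr.
  by rewrite hd1 z1 add0r /phi2 Nadj Npsi inner0l.
- exact: numproj_electron.
- by apply/eqP; rewrite -subr_eq0; apply/eqP.
move=> chi hc1 hc2.
have k1 := hmin _ hc1 hc2; have k2 := hmin _ n2 f2.
have hs1 := sqn_ge0 chi; have hs2 := sqn_ge0 phi1.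
rewrite -(ler_pM2l t0); rewrite e1 in k1 k2.
by apply: (sector_arith _ hs1 hs2 k1 k2); rewrite -hs h1.
Qed.

End Sector.

(** * Isoperimetry on the torus *)
Section CyclicCounting.
Local Open Scope nat_scope.

(** Here [p1], [p2] ([q1], [q2]) count the rows (columns) missing [G] and [H], and [k1], [k2] those
    meeting both. Fewer than [L/4] rows are mixed, so [p2] exceeds [3L/8]. The product bound makes
    [q1] of order [sqrt L], hence [q2 > L/2], hence [p1] of order [sqrt L] and [p2 > L/2]. The
    margin 2 needs a separate check for small [L]. *)
Lemma small_sqr_bounds (L h a k1 k2 p1 p2 q1 q2 : nat) :
  2 < L -> 25 * h ^ 2 <= L ^ 3 -> 2 * a < L -> 2 * k1 <= a -> 2 * k2 <= a ->
  L <= p1 + p2 + k1 -> L <= q1 + q2 + k2 -> p2 * q1 <= h -> p1 * q2 <= h -> p1 <= p2 ->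
  L + 2 <= 2 * q2 /\ L + 2 <= 2 * p2.
Proof.
move=> hL hh ha hk1 hk2 hP hQ h21 h12 hp.
have h1 : 3 * L + 1 <= 8 * p2 by lia.
have h2 : 3 * L + 1 <= 4 * q2 + 4 * q1 by lia.
have h3 : 3 * L + 1 <= 4 * p2 + 4 * p1 by lia.
have e1 : 25 * (p2 * q1) ^ 2 <= L ^ 3.
  by apply: leq_trans hh; rewrite leq_mul2l leq_exp2r.
have e2 : 25 * (p1 * q2) ^ 2 <= L ^ 3.
  by apply: leq_trans hh; rewrite leq_mul2l leq_exp2r.
have f1 : 225 * q1 ^ 2 * L ^ 2 <= 64 * L ^ 3.
  have : (3 * L) ^ 2 <= (8 * p2) ^ 2 by rewrite leq_exp2r //; lia.
  move=> u; have : 25 * q1 ^ 2 * (3 * L) ^ 2 <= 25 * q1 ^ 2 * (8 * p2) ^ 2 by rewrite leq_mul2l u orbT.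
  by move: e1; rewrite !expnMn; lia.
have f2 : 225 * q1 ^ 2 <= 64 * L.
  have L2 : 0 < L ^ 2 by rewrite expn_gt0; lia.
  by rewrite -(leq_pmul2r L2) -[64 * L * _]mulnA -expnS.
have g1 : L + 2 <= 2 * q2.
  have [//|lt] := leqP (L + 2) (2 * q2).
  (* Now [q1] is at least [(L - 1)/4], against [225 q1^2 <= 64 L]. Only [q1 <= 2] and [L <= 9]
     survive, and these are excluded one by one. *)
  have g : L <= 4 * q1 + 1 by lia.
  have q1b : q1 <= 2.
    have [//|ge] := leqP q1 2; exfalso.
    have : 3 * q1 <= q1 ^ 2 by rewrite expnS expn1 leq_mul2r ge orbT.
    lia.
  have L9 : L <= 9 by lia.
  have [E|[E|E]] : q1 = 0 \/ q1 = 1 \/ q1 = 2 by lia.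
  - by move: h2 lt; rewrite E; lia.
  - rewrite E in f2 g e1 h2; rewrite muln1 in e1.
    have [LE|LE] : L = 4 \/ L = 5 by lia.
      have p21 : p2 <= 1.
        have [//|ge] := leqP p2 1; have : 2 ^ 2 <= p2 ^ 2 by rewrite leq_exp2r.
        by move: e1; rewrite LE; lia.
      by move: h1; rewrite LE; lia.
    have p22 : p2 <= 2.
      have [//|ge] := leqP p2 2; have : 3 ^ 2 <= p2 ^ 2 by rewrite leq_exp2r.
      by move: e1; rewrite LE; lia.
    have p1E : p1 = 2 by lia.
    have q2E : 3 <= q2 by lia.
    have : 6 ^ 2 <= (p1 * q2) ^ 2 by rewrite leq_exp2r //; lia.
    by move: e2; rewrite LE; lia.
  - by move: f2; rewrite E; lia.
split=> //.
have [//|lt] := leqP (L + 2) (2 * p2); exfalso.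
have g : L <= 4 * p1 + 1 by lia.
have u : 25 * p1 ^ 2 * L ^ 2 <= 4 * L ^ 3.
  have : L ^ 2 <= (2 * q2) ^ 2 by rewrite leq_exp2r //; lia.
  move=> u; have : 25 * p1 ^ 2 * L ^ 2 <= 25 * p1 ^ 2 * (2 * q2) ^ 2 by rewrite leq_mul2l u orbT.
  by move: e2; rewrite !expnMn; lia.
have u2 : 25 * p1 ^ 2 <= 4 * L.
  have L2 : 0 < L ^ 2 by rewrite expn_gt0; lia.
  by rewrite -(leq_pmul2r L2) -[4 * L * _]mulnA -expnS.
have [E|[E|E]] : p1 = 0 \/ p1 = 1 \/ 2 <= p1 by lia.
- by move: g; rewrite E; lia.
- by move: u2 g; rewrite E; lia.
- have : 2 * p1 <= p1 ^ 2 by rewrite expnS expn1 leq_mul2r E orbT.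
  lia.
Qed.

(** Take the last [k < n] with [P k]. Since [P] and [Q] never hold at distance 0, 1 or 2, the next
    two steps come before [n] and satisfy neither. *)
Lemma walk_gap (P Q : pred nat) n : P 0 -> Q n ->
  (forall k, ~~ (P k && Q k)) -> (forall k, ~~ (P k && Q k.+1)) -> (forall k, ~~ (P k && Q k.+2)) ->
  exists k, [/\ 0 < k, k.+1 < n, ~~ P k && ~~ Q k & ~~ P k.+1 && ~~ Q k.+1].
Proof.
move=> P0 Qn h0 h1 h2.
have ex : exists k, P k && (k < n).
  by exists 0; rewrite P0 lt0n; apply: contraTneq Qn => ->; have := h0 0; rewrite P0.
have ub k : P k && (k < n) -> k <= n by case/andP => _ /ltnW.
case: (ex_maxnP ex ub) => k /andP[Pk kn] kmax.
have k1 : k.+1 < n.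
  rewrite ltn_neqAle kn andbT; apply: contraTneq Qn => <-.
  by have := h1 k; rewrite Pk.
have k2 : k.+2 < n.
  rewrite ltn_neqAle k1 andbT; apply: contraTneq Qn => <-.
  by have := h2 k; rewrite Pk.
have nP j : k < j -> j < n -> ~~ P j.
  by move=> kj jn; apply/negP => Pj; have := kmax j; rewrite Pj jn leqNgt kj => /(_ isT).
exists k.+1; rewrite !nP //; split=> //.
  by have := h1 k; rewrite Pk.
by have := h2 k; rewrite Pk.
Qed.
End CyclicCounting.

Section Isoperimetry.
Local Open Scope nat_scope.

Lemma arc_bounds d k1 k2 n : k1.+1 < d.*2 -> k2.+1 < (n - d).*2 -> d < n ->
  [/\ k1 < n.*2, d.*2 + k2 < n.*2 & k1 <> d.*2 + k2].
Proof. by move=> h1 h2 h3; split; lia. Qed.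

(** [h], [v], [d] are the bond numbers in the three directions. A row that meets [H] is either mixed
    or misses [G]; a mixed row costs two bonds of [v + d], and one missing [G] costs two of [h]. The
    same holds for columns, so [H] fits into a box whose sides are at most half the number of
    bonds. *)
Lemma side_arith n h v d k1 k2 p1 p2 q1 q2 m :
  n + 2 <= 2 * q2 -> n + 2 <= 2 * p2 -> 2 * k1 <= v + d -> 2 * k2 <= h + d ->
  p1 * (2 * q2 - n) <= h -> q1 * (2 * p2 - n) <= v ->
  n - p2 <= k1 + p1 -> n - q2 <= k2 + q1 -> m <= (n - q2) * (n - p2) ->
  4 * m <= (h + v + d) ^ 2.
Proof.
move=> g1 g2 m1 m2 r1 r2 h1 h2 hm.
have t1 : p1 * 2 <= h by apply: leq_trans r1; rewrite leq_mul2l; apply/orP; right; lia.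
have t2 : q1 * 2 <= v by apply: leq_trans r2; rewrite leq_mul2l; apply/orP; right; lia.
have e1 : 2 * (n - p2) <= h + v + d by lia.
have e2 : 2 * (n - q2) <= h + v + d by lia.
have := leq_mul e2 e1; rewrite expnS expn1 mulnACA.
by apply: leq_trans; rewrite leq_mul2l.
Qed.

Section Strips.
Variable L : nat.
Hypothesis hL : 2 < L.
Implicit Types (D G H : {set site L}) (x y : site L) (i j : 'Z_L).

Definition bonds (d : site L) D := \sum_x ((x \in D) && (shift x d \in D)).
Definition ah := bonds (1, 0)%R.
Definition av := bonds (0, 1)%R.
Definition ad := bonds (1, -1)%R.
Definition separated G H := forall x y, x \in G -> y \in H -> ~~ nbr x y && (x != y).
Definition hits G j := [exists i, (i, j) \in G].
(* The lattice is invariant under exchanging the two coordinates. *)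
Definition tr G : {set site L} := [set x | (x.2, x.1) \in G].
Definition free_rows G := [set j | ~~ hits G j].

Lemma sepC G H : separated G H -> separated H G.
Proof. by move=> h x y xH yG; rewrite nbr_sym eq_sym; exact: h. Qed.

Lemma nbr_swap x y : nbr (x.2, x.1) (y.2, y.1) = nbr x y.
Proof.
rewrite /nbr !inE !xpair_eqE /=.
move: (y.1 - x.1)%R (y.2 - x.2)%R => a b.
by do 6![case: (_ == _)%R].
Qed.

Lemma sep_tr G H : separated G H -> separated (tr G) (tr H).
Proof.
move=> h [a b] [c d]; rewrite !inE /= => h1 h2.
have := h _ _ h1 h2; rewrite -nbr_swap /= => /andP[-> /=].
by rewrite !xpair_eqE andbC.
Qed.

Lemma sum_tr (F : site L -> nat) : \sum_x F (x.2, x.1) = \sum_x F x.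
Proof.
rewrite [RHS](reindex_inj (h := fun x : site L => (x.2, x.1))) //.
by move=> [a b] [c d] [-> ->].
Qed.

Lemma av_tr D : av (tr D) = ah D.
Proof.
rewrite /av /ah /bonds -[RHS]sum_tr; apply: eq_bigr => -[a b] _.
by rewrite !inE /shift /=.
Qed.

Lemma ah_tr D : ah (tr D) = av D.
Proof.
rewrite /av /ah /bonds -[RHS]sum_tr; apply: eq_bigr => -[a b] _.
by rewrite !inE /shift /=.
Qed.

Lemma bondsN (d : site L) D : bonds (- d.1, - d.2)%R D = bonds d D.
Proof.
rewrite /bonds [RHS](reindex_inj (h := fun x => shift x (- d.1, - d.2)%R)) /=; last first.
  by apply: (@can_inj _ _ _ (fun y => shift y d)) => -[a b]; rewrite /shift /= !subrK.
apply: eq_bigr => x _; rewrite andbC; congr (nat_of_bool (_ && (_ \in D))).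
by case: x => a b; rewrite /shift /= !subrK.
Qed.

Lemma ad_tr D : ad (tr D) = ad D.
Proof.
rewrite /ad -[RHS](bondsN (1, -1)%R) /bonds -[RHS]sum_tr; apply: eq_bigr => -[a b] _.
by rewrite !inE /shift /= opprK.
Qed.

Lemma card_adjacent D :
  \sum_(x in D) #|[set y in D | nbr x y]| = 2 * (ah D + av D + ad D).
Proof.
transitivity (\sum_(d <- dirs L) bonds d D).
  rewrite /bonds exchange_big /= big_mkcond; apply: eq_bigr => x _.
  have -> : #|[set y in D | nbr x y]| = \sum_(y | nbr x y) (y \in D).
    by rewrite -sum1_card big_mkcond [RHS]big_mkcond; apply: eq_bigr => y _; rewrite inE; case: (y \in D); case: (nbr x y).
  rewrite (sum_nbr hL); case: (x \in D) => //=.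
  by rewrite big1.
rewrite /dirs !big_cons big_nil.
have e1 := bondsN (1, 0)%R D; have e2 := bondsN (0, 1)%R D; have e3 := bondsN (1, -1)%R D.
move: e1 e2 e3; rewrite /= oppr0 opprK /ah /av /ad => -> -> ->.
move: (bonds _ D) (bonds _ D) (bonds _ D) => u v w; lia.
Qed.

Lemma ZL_natr_inj a c : a < L -> c < L -> (a%:R = c%:R :> 'Z_L)%R -> a = c.
Proof.
move=> al cl /(congr1 (fun u : 'Z_L => val u)) /=.
by rewrite !val_Zp_nat ?modn_small //; lia.
Qed.

(* The closed path (i0,j), (i0,j+1), (i0+1,j), (i0+1,j+1), ... visits two
   adjacent rows, and any two of its sites at distance one or two along the path
   are neighbours. If it meets two separated sets, each of the two arcs between
   them must therefore contain a bond inside the complement. *)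
Section Zigzag.
Variables (i0 j : 'Z_L).
Definition zig k : site L := (i0 + (k./2)%:R, if odd k then j + 1 else j)%R.
(** Names the [k]-th bond of the path by its type and column, [inl] for vertical and [inr] for
    diagonal, so that distinct steps of one turn give distinct elements of [zset]. *)
Definition zbond k : 'Z_L + 'Z_L := if odd k then inr (i0 + (k./2)%:R)%R else inl (i0 + (k./2)%:R)%R.

Lemma nbr_dir x d : d \in dirs L -> nbr x (shift x d).
Proof. by move=> h; rewrite nbr_shift map_f. Qed.

Lemma zigS k : zig k.+1 = shift (zig k) (if odd k then (1, -1) else (0, 1))%R.
Proof.
rewrite /zig /shift /= uphalf_half; case: (odd k) => /=.
  by rewrite natrD [(1%:R + _)%R]addrC addrA addrK.
by rewrite add0n addr0.
Qed.

Lemma zigSS k : zig k.+2 = shift (zig k) (1, 0)%R.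
Proof. by rewrite /zig /shift /= negbK mulrS [(1 + _)%R]addrC addrA addr0. Qed.

Lemma zig1 k : nbr (zig k) (zig k.+1).
Proof. by rewrite zigS; apply: nbr_dir; case: (odd k); rewrite !inE eqxx ?orbT. Qed.

Lemma zig2 k : nbr (zig k) (zig k.+2).
Proof. by rewrite zigSS; apply: nbr_dir; rewrite !inE eqxx ?orbT. Qed.

Definition zset D : {set 'Z_L + 'Z_L} := [set u | match u with
  | inl i => ((i, j) \in D) && ((i, j + 1)%R \in D)
  | inr i => ((i, j + 1)%R \in D) && ((i + 1, j)%R \in D) end].

Lemma zbond_in D k : (zbond k \in zset D) = (zig k \in D) && (zig k.+1 \in D).
Proof.
rewrite zigS /zbond /zig /shift; case: (odd k); rewrite inE /= ?addrK ?addr0 //.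
Qed.

Lemma zbond_inj k m : k < L.*2 -> m < L.*2 -> zbond k = zbond m -> k = m.
Proof.
move=> kL mL; rewrite /zbond.
have hk : k./2 < L by rewrite ltn_half_double.
have hm : m./2 < L by rewrite ltn_half_double.
move=> h; have [od e] : odd k = odd m /\ ((k./2)%:R = (m./2)%:R :> 'Z_L)%R.
  by move: h; case: (odd k); case: (odd m) => //;
    move/(congr1 (fun u : 'Z_L + 'Z_L => match u with inl w => w | inr w => w end)) => /= h;
    split=> //; apply: (@addrI _ i0); exact: h.
by rewrite -[k]odd_double_half -[m]odd_double_half od (ZL_natr_inj hk hm e).
Qed.

Lemma zig_even q : zig q.*2 = (i0 + q%:R, j)%R.
Proof. by rewrite /zig odd_double doubleK. Qed.

End Zigzag.

Lemma strip_two_bonds G H (D := ~: (G :|: H)) i i' j :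
  separated G H -> (i, j) \in G -> (i', j) \in H -> 2 <= #|zset j D|.
Proof.
move=> sep iG iH.
have inD x : (x \in D) = (x \notin G) && (x \notin H) by rewrite !inE negb_or.
(* [d] is the number of columns from [i] forward to [i']; the two arcs of the closed path have
   lengths [2d] and [2(L - d)]. *)
pose d := val (i' - i)%R.
have dE : (i + d%:R = i')%R.
  by rewrite /d natr_Zp addrC subrK.
have dL : d < L by apply: leq_trans (ltn_ord _) _; rewrite Zp_cast // ltnW.
have LL : (L%:R = 0 :> 'Z_L)%R by rewrite pchar_Zp // ltnW.
have z0 : zig i j 0 = (i, j) by rewrite (zig_even i j 0) addr0.
have zd : zig i j d.*2 = (i', j) by rewrite zig_even dE.
have zL : zig i j (d.*2 + (L - d).*2) = (i, j).
  by rewrite -doubleD subnKC ?(ltnW dL) // zig_even LL addr0.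
have no x : ~~ ((x \in G) && (x \in H)).
  by apply/negP => /andP[a b]; have := sep _ _ a b; rewrite eqxx andbF.
have no1 x y : nbr x y -> ~~ ((x \in G) && (y \in H)).
  by move=> xy; apply/negP => /andP[a b]; have := sep _ _ a b; rewrite xy.
have no2 x y : nbr x y -> ~~ ((x \in H) && (y \in G)).
  by rewrite andbC nbr_sym; exact: no1.
have [k1 [_ b1 c1 e1]] : exists k, [/\ 0 < k, k.+1 < d.*2,
    ~~ (zig i j k \in G) && ~~ (zig i j k \in H) & ~~ (zig i j k.+1 \in G) && ~~ (zig i j k.+1 \in H)].
  apply: (@walk_gap (fun k => zig i j k \in G) (fun k => zig i j k \in H)).
  - by rewrite z0.
  - by rewrite zd.
  - by move=> k; exact: no.
  - by move=> k; apply: no1; exact: zig1.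
  - by move=> k; apply: no1; exact: zig2.
have [k2 [_ b2 c2 e2]] : exists k, [/\ 0 < k, k.+1 < (L - d).*2,
    ~~ (zig i j (d.*2 + k) \in H) && ~~ (zig i j (d.*2 + k) \in G) & ~~ (zig i j (d.*2 + k.+1) \in H) && ~~ (zig i j (d.*2 + k.+1) \in G)].
  apply: (@walk_gap (fun k => zig i j (d.*2 + k) \in H) (fun k => zig i j (d.*2 + k) \in G)).
  - by rewrite addn0 zd.
  - by rewrite zL.
  - by move=> k; rewrite andbC; exact: no.
  - by move=> k; apply: no2; rewrite addnS; exact: zig1.
  - by move=> k; apply: no2; rewrite !addnS; exact: zig2.
have u1 : zbond i k1 \in zset j D by rewrite zbond_in !inD c1 e1.
have u2 : zbond i (d.*2 + k2) \in zset j D.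
  by rewrite zbond_in -addnS !inD andbC [X in X && _]andbC [X in _ && X]andbC e2 c2.
have ne : zbond i k1 != zbond i (d.*2 + k2).
  have [l1 l2 l3] := arc_bounds b1 b2 dL.
  by apply/negP => /eqP /(zbond_inj l1 l2) /l3.
have -> : 2 = #|[set zbond i k1; zbond i (d.*2 + k2)]| by rewrite cards2 ne.
by apply: subset_leq_card; apply/fintype.subsetP => u; rewrite in_set2 => /orP[] /eqP ->.
Qed.

(** Each vertical or diagonal bond joins two consecutive rows and so lies in exactly one strip. *)
Lemma sum_zset D : \sum_j #|zset j D| = av D + ad D.
Proof.
have e j : #|zset j D| = \sum_i (((i, j) \in D) && ((i, j + 1)%R \in D)) +
   \sum_i (((i, j + 1)%R \in D) && ((i + 1, j)%R \in D)).
  rewrite -sum1_card big_mkcond big_sumType /=; congr (_ + _);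
  by apply: eq_bigr => i _; rewrite inE; case: (_ && _).
rewrite (eq_bigr _ (fun j _ => e j)) big_split /=; congr (_ + _).
  rewrite exchange_big /= /av /bonds pair_bigA /=; apply: eq_bigr => -[a b] _.
  by rewrite /shift /= addr0.
rewrite exchange_big /= /ad /bonds pair_bigA /=.
rewrite [RHS](reindex_inj (h := fun x => shift x (0, 1)%R)) /=; last first.
  by apply: (@can_inj _ _ _ (fun y => shift y (0, -1)%R)) => -[a b]; rewrite /shift /= !addr0 addrK.
by apply: eq_bigr => -[a b] _; rewrite /shift /= !addr0 addrK.
Qed.

Definition mixed G H := [set j | hits G j && hits H j].

Lemma mixed_strips G H : separated G H ->
  2 * #|mixed G H| <= av (~: (G :|: H)) + ad (~: (G :|: H)).
Proof.
move=> sep; rewrite -sum_zset mulnC -sum_nat_const.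
rewrite [X in _ <= X](bigID (mem (mixed G H))) /= (leq_trans _ (leq_addr _ _)) //.
apply: leq_sum => j; rewrite inE => /andP[/existsP[i h1] /existsP[i' h2]].
exact: (strip_two_bonds sep h1 h2).
Qed.

(** Inclusion-exclusion for [W] and its translate [V], whose union has at most [L] elements. *)
Lemma ring_pairs (W : {set 'Z_L}) :
  2 * #|W| <= L + #|[set i | (i \in W) && ((i + 1)%R \in W)]|.
Proof.
pose V := [set i | (i + 1)%R \in W].
have cV : #|V| = #|W|.
  have -> : V = (fun i => i + 1)%R @^-1: W by apply/setP => i; rewrite !inE.
  rewrite card_preimset //; exact: addIr.
have := cardsUI W V; rewrite cV => h.
have h2 : #|W :|: V| <= L by rewrite -[X in _ <= X](card_ZL hL); exact: max_card.
have -> : [set i | (i \in W) && ((i + 1)%R \in W)] = W :&: V by apply/setP => i; rewrite !inE.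
lia.
Qed.

Section Rows.
Variables G H : {set site L}.
Hypothesis sep : separated G H.
Let D := ~: (G :|: H).
Let p1 := #|free_rows G|.
Let p2 := #|free_rows H|.
Let q1 := #|free_rows (tr G)|.
Let q2 := #|free_rows (tr H)|.

Lemma free_row_col i j : j \in free_rows G -> i \in free_rows (tr H) -> (i, j) \in D.
Proof.
rewrite !inE => h1 h2; rewrite negb_or; apply/andP; split.
  by apply: contra h1 => h; apply/existsP; exists i.
by apply: contra h2 => h; apply/existsP; exists j; rewrite inE.
Qed.

Lemma free_product : p1 * q2 <= #|D|.
Proof.
rewrite mulnC -cardsX; apply: subset_leq_card; apply/fintype.subsetP => -[i j].
by rewrite inE /= => /andP[h1 h2]; exact: free_row_col.
Qed.

(** A row missing [G] meets each of the [q2] columns missing [H] in the complement, and [q2] points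
    on a cycle of length [L] have at least [2 q2 - L] adjacent pairs. *)
Lemma free_rows_ah : p1 * (2 * q2 - L) <= ah D.
Proof.
have -> : ah D = \sum_j #|[set i | ((i, j) \in D) && ((i + 1, j)%R \in D)]|.
  rewrite [RHS](eq_bigr (fun j => \sum_i (((i, j) \in D) && ((i + 1, j)%R \in D) : nat))); last first.
    by move=> j _; rewrite -sum1_card big_mkcond; apply: eq_bigr => i _; rewrite inE; case: (_ && _).
  rewrite exchange_big pair_bigA /=; apply: eq_bigr => -[i j] _.
  by rewrite /shift /= addr0.
rewrite -sum_nat_const [X in _ <= X](bigID (mem (free_rows G))) /= (leq_trans _ (leq_addr _ _)) //.
apply: leq_sum => j jG; rewrite leq_subLR.
have := ring_pairs [set i | (i, j) \in D].
have hq : q2 <= #|[set i | (i, j) \in D]|.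
  by apply: subset_leq_card; apply/fintype.subsetP => i iq; rewrite inE; exact: free_row_col.
have -> : [set i | (i \in [set i | (i, j) \in D]) && ((i + 1)%R \in [set i | (i, j) \in D])] =
   [set i | ((i, j) \in D) && ((i + 1, j)%R \in D)] by apply/setP => i; rewrite !inE.
by move=> h; apply: leq_trans h; rewrite leq_mul2l hq.
Qed.

Lemma rows_cover : L <= p1 + p2 + #|mixed G H|.
Proof.
rewrite -{1}(card_ZL hL) -cardsT.
have -> : [set: 'Z_L] = free_rows G :|: free_rows H :|: mixed G H.
  by apply/setP => j; rewrite !inE; case: (hits G j); case: (hits H j).
apply: leq_trans (leq_card_setU _ _) _; rewrite leq_add2r; exact: leq_card_setU.
Qed.

Lemma rows_hit : L - p2 <= #|mixed G H| + p1.
Proof. by have := rows_cover; lia. Qed.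

Lemma card_hit : #|H| <= (L - q2) * (L - p2).
Proof.
have c (A : {set 'Z_L}) : L - #|A| = #|~: A| by rewrite [RHS]cardsCs setCK (card_ZL hL).
rewrite !c -cardsX; apply: subset_leq_card; apply/fintype.subsetP => -[i j] h.
rewrite !inE /= !negbK; apply/andP; split; apply/existsP; last by exists i.
by exists j; rewrite inE.
Qed.
End Rows.

Lemma side_small G H (D := ~: (G :|: H)) (a := ah D + av D + ad D) :
  separated G H -> 25 * #|D| ^ 2 <= L ^ 3 -> 2 * a < L ->
  #|free_rows G| <= #|free_rows H| -> 4 * #|H| <= a ^ 2.
Proof.
move=> sep hD ha hp.
have sepT := sep_tr sep.
have sepH := sepC sep.
have DT : ~: (tr G :|: tr H) = tr D by apply/setP => x; rewrite !inE.
have DC : ~: (H :|: G) = D by rewrite setUC.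
have m1 := mixed_strips sep.
have m2 := mixed_strips sepT; rewrite DT av_tr ad_tr in m2.
have c1 := rows_cover G H; have c2 := rows_cover (tr G) (tr H).
have f1 := @free_product G H; have f2 := @free_product H G; rewrite DC in f2.
have m1a : 2 * #|mixed G H| <= a by apply: leq_trans m1 _; rewrite /a -addnA; exact: leq_addl.
have m2a : 2 * #|mixed (tr G) (tr H)| <= a.
  by apply: leq_trans m2 _; rewrite /a leq_add2r leq_addr.
have [g1 g2] := small_sqr_bounds hL hD ha m1a m2a c1 c2 f2 f1 hp.
have r1 := @free_rows_ah G H; have r2 := @free_rows_ah (tr G) (tr H).
have trK S : tr (tr S) = S by apply/setP => -[x y]; rewrite !inE.
rewrite DT ah_tr !trK in r2.
exact: (side_arith g1 g2 m1 m2 r1 r2 (rows_hit G H) (rows_hit (tr G) (tr H)) (card_hit H)).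
Qed.

(* A row or column meeting both sets costs two bonds of its zigzag strip; rows
   missing G times columns missing H consist of elements of the complement, which
   is too small unless such rows and columns are few. *)
Lemma isoperimetric G H (D := ~: (G :|: H)) (a := ah D + av D + ad D) :
  separated G H -> 25 * #|D| ^ 2 <= L ^ 3 -> 2 * a < L ->
  4 * #|G| <= a ^ 2 \/ 4 * #|H| <= a ^ 2.
Proof.
move=> sep hD ha; case: (leqP #|free_rows G| #|free_rows H|) => [h|/ltnW h].
  by right; apply: side_small.
left; have DC : ~: (H :|: G) = D by rewrite setUC.
by have := side_small (sepC sep); rewrite DC; apply.
Qed.

End Strips.
End Isoperimetry.

Lemma opp_eq0 (K : numFieldType) (V : lmodType K) (v : V) : v = - v -> v = 0.
Proof.
move=> /eqP; rewrite -addr_eq0 -mulr2n -scaler_nat scaler_eq0 pnatr_eq0 /=.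
by move/eqP.
Qed.

Lemma middle_terms (V : zmodType) (a u v d : V) : a = 0 -> d = 0 -> a + u + (v + d) = 0 -> v + u = 0.
Proof. by move=> -> ->; rewrite add0r addr0 addrC. Qed.

Lemma sum_reorder (V : zmodType) (a u c u' : V) : u = u' -> a + u + c = a + (c + u').
Proof. by move=> ->; rewrite -addrA [u' + c]addrC. Qed.

(** * Wave functions in the a-modes *)
Section Amplitude.
Variables (R : realType) (L : nat) (B : rel (site L)) (mu : R).
Local Notation C := R[i].
Local Notation st := (state R B).
Local Notation K := (rC (kappa mu)).
Local Notation M := (rC mu).
Local Notation omode := (site L * bool)%type.
Implicit Types (s t r : bool) (psi chi p q phi : st) (x y : site L) (b : bond B) (z : lam B).

Definition aann (m : omode) psi : st := ann (orb_a mu m.1) m.2 psi.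

Lemma aannD m p q : aann m (p + q) = aann m p + aann m q. Proof. exact: annD. Qed.
Lemma aannZ m k p : aann m (k *: p) = k *: aann m p. Proof. exact: annZ. Qed.
Lemma aann0 m : aann m 0 = 0. Proof. exact: ann_0. Qed.
Lemma aann_anticomm m m' p : aann m (aann m' p) = - aann m' (aann m p).
Proof. exact: ann_anticomm. Qed.
Lemma aann_sqr m p : aann m (aann m p) = 0.
Proof. by apply: opp_eq0; exact: aann_anticomm. Qed.

Definition kerb psi := (forall b s, ann (orb_u mu b) s psi = 0) /\
  (forall b s, ann (orb_ubar mu b) s psi = 0).

Lemma kerb_aann m psi : kerb psi -> kerb (aann m psi).
Proof.
by move=> [h1 h2]; split=> b s; rewrite /aann ann_anticomm ?h1 ?h2 ann_0; exact: oppr0.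
Qed.

Lemma cop_uE b s psi : kerb psi ->
  cop (uO b, s) psi = M *: (cop (siteM B (val b).1, s) psi + cop (siteM B (val b).2, s) psi).
Proof. by move=> [h _]; apply/eqP; rewrite -subr_eq0; apply/eqP; rewrite -(h b s) -bop_uE. Qed.

Lemma cop_ubarE b s psi : kerb psi ->
  cop (ubarO b, s) psi = - (M *: (cop (siteM B (val b).1, s) psi - cop (siteM B (val b).2, s) psi)).
Proof. by move=> [_ h]; apply/eqP; rewrite -addr_eq0; apply/eqP; rewrite -(h b s) -bop_ubarE. Qed.

Hypotheses (hL : (2 < L)%N) (hB : is_bond_set B) (hmu : 0 < mu).

Lemma sub_opp_twice (V : lmodType C) (u v : V) : M *: (u + v) - - (M *: (u - v)) = (2 * M) *: u.
Proof. by rewrite opprK -scalerDr addrACA subrr addr0 -mulr2n -scaler_nat scalerA mulrC. Qed.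

Lemma add_opp_twice (V : lmodType C) (u v : V) : M *: (u + v) + - (M *: (u - v)) = (2 * M) *: v.
Proof.
by rewrite -scalerBr opprB [v - u]addrC addrACA subrr add0r -mulr2n -scaler_nat scalerA mulrC.
Qed.

Lemma site_scale (V : lmodType C) (v : V) (N : C) : K * K * (1 + 12 * (M * M)) = 1 -> N = 12 * (M * M) ->
  v = K *: (K *: (v + N *: v)).
Proof.
move=> h ->; have -> : v + (12 * (M * M)) *: v = (1 + 12 * (M * M)) *: v by rewrite scalerDl scale1r.
by rewrite !scalerA h scale1r.
Qed.

Lemma sum_ind_scale (V : lmodType C) (T : finType) (P Q : pred T) (k : C) (v : V) (F G : T -> V) :
  (forall c, P c -> F c = k *: v) -> (forall c, Q c -> G c = k *: v) ->
  \sum_c ((P c)%:R + (Q c)%:R) = 6 :> C ->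
  \sum_(c | P c) F c + \sum_(c | Q c) G c = (6 * k) *: v.
Proof.
move=> hF hG <-; rewrite mulr_suml scaler_suml [X in X + _]big_mkcond [X in _ + X]big_mkcond -big_split.
apply: eq_bigr => c _ /=; rewrite mulrDl scalerDl; congr (_ + _).
  by case: ifP => [/hF ->|_]; rewrite ?mul1r ?mul0r ?scale0r.
by case: ifP => [/hG ->|_]; rewrite ?mul1r ?mul0r ?scale0r.
Qed.

(** On the kernel of the b-operators, [c_u] and [c_ubar] are combinations of the site operators.
    Inserted into [a_x], each of the six bonds at [x] contributes [2 mu^2 c_x] and no neighbour
    survives, so [a_x = kappa (1 + 12 mu^2) c_x]. *)
Lemma cop_siteE x s psi : kerb psi -> cop (siteM B x, s) psi = K *: aann (x, s) psi.
Proof.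
move=> hk; rewrite /aann -aopE /aop /=.
rewrite -addrA -scalerDr (sum_ind_scale (k := 2 * M) (v := cop (siteM B x, s) psi)).
- rewrite [M *: _]scalerA; apply: site_scale; first exact: kappa_sqr.
  by ring.
- move=> b /eqP bx; rewrite cop_uE // cop_ubarE // bx; exact: sub_opp_twice.
- move=> b /eqP bx; rewrite cop_uE // cop_ubarE // bx; exact: add_opp_twice.
- exact: bond_degree.
Qed.

Lemma inner_parallelogram (u v u' v' : st) :
  inner (M *: (u + v)) (M *: (u' + v')) + inner (- (M *: (u - v))) (- (M *: (u' - v'))) =
  2 * (M * M) * (inner u u' + inner v v').
Proof.
rewrite innerNl innerNr opprK !innerZl !innerZr conj_rC !innerDl !innerDr !innerNl !innerNr.
move: (inner u u') (inner u v') (inner v u') (inner v v') => a c d e; ring.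
Qed.

(** On the kernel of the b-operators the electron number is the number of a-electrons. The
    parallelogram law removes the cross terms of each bond, and what remains at a site is multiplied
    by [1 + 12 mu^2]. *)
Lemma sum_copE chi psi s : kerb chi -> kerb psi ->
  \sum_z inner (cop (z, s) chi) (cop (z, s) psi) =
  \sum_x inner (aann (x, s) chi) (aann (x, s) psi).
Proof.
move=> hc hp; rewrite sum_lam /= -big_split /=.
pose W x := inner (cop (siteM B x, s) chi) (cop (siteM B x, s) psi).
rewrite [X in _ + X](eq_bigr (fun b : bond B => 2 * (M * M) * (W (val b).1 + W (val b).2))); last first.
  move=> b _.
  have -> : inr (inl b) = uO b by [].
  have -> : inr (inr b) = ubarO b by [].
  rewrite !cop_uE // !cop_ubarE //; exact: inner_parallelogram.
have hW : \sum_(b : bond B) (W (val b).1 + W (val b).2) = 6 * \sum_x W x.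
  rewrite mulr_sumr.
  rewrite (eq_bigr (fun b : bond B => \sum_x (((val b).1 == x)%:R + ((val b).2 == x)%:R) * W x)).
    rewrite exchange_big; apply: eq_bigr => x _ /=.
    by rewrite -mulr_suml bond_degree.
  move=> b _; rewrite (eq_bigr (fun x => ((val b).1 == x)%:R * W x + ((val b).2 == x)%:R * W x)).
    rewrite big_split /= (bigD1 (val b).1) //= eqxx mul1r big1 ?addr0.
      rewrite (bigD1 (val b).2) //= eqxx mul1r big1 ?addr0 // => x /negbTE.
      by rewrite eq_sym => ->; rewrite mul0r.
    by move=> x /negbTE; rewrite eq_sym => ->; rewrite mul0r.
  by move=> x _; rewrite mulrDl.
rewrite -mulr_sumr hW mulr_sumr mulr_sumr -big_split; apply: eq_bigr => x _ /=.
have -> : inner (cop (inl x, s) chi) (cop (inl x, s) psi) = W x by [].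
rewrite /W !cop_siteE // innerZl innerZr conj_rC.
rewrite -[RHS]mul1r -[X in _ = X * _](kappa_sqr mu); ring.
Qed.

Lemma cdag_cop (m : mode B) psi (T : basis B) : (cdag m (cop m psi)) T = (m \in T)%:R * psi T.
Proof.
rewrite !ffunE; case: ifP => mT; last by rewrite mul0r.
have E : jw_sign R (T :\ m) m = jw_sign R T m.
  by rewrite -{2}(setD1K mT) jw_sign_self // !inE eqxx.
by rewrite !inE eqxx /= setD1K // E mulrA jw_signK.
Qed.

Lemma number_sum n chi psi : n_electron n psi ->
  \sum_s \sum_z inner (cop (z, s) chi) (cop (z, s) psi) = n%:R * inner chi psi.
Proof.
move=> hn; rewrite exchange_big pair_bigA /=.
rewrite (eq_bigr (fun m : mode B => \sum_(T : basis B) (((chi T)^*)%C * ((m \in T)%:R * psi T)))); last first.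
  move=> [z s] _; rewrite -inner_cdag; apply: eq_bigr => T _; congr (_ * _).
  exact: cdag_cop.
rewrite exchange_big /= mulr_sumr; apply: eq_bigr => T _.
rewrite -mulr_sumr -mulr_suml.
have -> : \sum_(m : mode B) (m \in T)%:R = #|T|%:R :> C.
  by rewrite -natr_sum -sum1_card [in RHS]big_mkcond; congr (_%:R); apply: eq_bigr => m _; case: ifP.
have [->|hT] := eqVneq #|T| n; first by rewrite mulrCA.
by rewrite hn // !mulr0.
Qed.

Lemma n_electron_ann n f s psi : n_electron n.+1 psi -> n_electron n (ann f s psi).
Proof.
move=> hn T hT; rewrite sum_ffunE big1 // => z _; rewrite !ffunE; case: ifP => zT.
  exact: mulr0.
have -> : psi ((z, s) |: T) = 0 by apply: hn; rewrite cardsU1 zT add1n eqSS.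
by rewrite mulr0; exact: mulr0.
Qed.

Lemma parseval_step n chi psi : kerb chi -> kerb psi -> n_electron n psi ->
  n%:R * inner chi psi = \sum_m inner (aann m chi) (aann m psi).
Proof.
move=> hc hp hn; rewrite -number_sum // (eq_bigr _ (fun s _ => sum_copE s hc hp)).
by rewrite exchange_big pair_bigA /=; apply: eq_bigr => -[x s] _.
Qed.

Definition string (l : seq omode) psi : st := foldl (fun p m => aann m p) psi l.

Lemma stringZ l k psi : string l (k *: psi) = k *: string l psi.
Proof. by elim: l psi => //= m l ih psi; rewrite aannZ ih. Qed.
Lemma stringD l p q : string l (p + q) = string l p + string l q.
Proof. by elim: l p q => //= m l ih p q; rewrite aannD ih. Qed.
Lemma string0 l : string l 0 = 0.
Proof. by elim: l => //= m l; rewrite aann0. Qed.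
Lemma stringN l psi : string l (- psi) = - string l psi.
Proof. by rewrite -scaleN1r stringZ scaleN1r. Qed.
Lemma string_front (p1 p2 : seq omode) m psi :
  string (p1 ++ m :: p2) psi = (-1) ^+ (size p1) *: string (m :: p1 ++ p2) psi.
Proof.
elim: p1 psi => [|m1 p1 ih] psi; first by rewrite expr0 scale1r.
rewrite cat_cons [LHS]/= ih /= aann_anticomm stringN exprS mulN1r scaleNr.
by rewrite scalerN.
Qed.

(** The sign depends on the permutation alone and is chosen before [f] and [psi]; this lets
    amplitudes of different configurations be compared after the same reordering. *)
Lemma string_perm (I : eqType) (l l' : seq I) : perm_eq l l' ->
  exists e : nat, forall (f : I -> omode) psi,
    string (map f l) psi = (-1) ^+ e *: string (map f l') psi.
Proof.
elim: l l' => [|x l ih] l' hl.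
  by exists 0%N => f psi; rewrite expr0 scale1r; have /perm_nilP -> : perm_eq l' [::] by rewrite perm_sym.
have xl : x \in l' by rewrite -(perm_mem hl) mem_head.
case/splitPr: xl hl => p1 p2 hl.
have /ih [e he] : perm_eq l (p1 ++ p2).
  rewrite -(perm_cons x); apply: perm_trans hl _.
  by rewrite -cat1s (perm_catCA p1 [:: x] p2).
exists (e + size p1)%N => f psi.
rewrite map_cat /= string_front -map_cat size_map [LHS]/= he scalerA -exprD.
by rewrite -addnA addnn -mul2n exprD exprM sqrrN expr1n expr1n mulr1.
Qed.


(* The wave function of psi in the a-modes; set0 is the vacuum component. *)
Definition amp n psi (f : {ffun 'I_n -> omode}) : C := (string (map f (enum 'I_n)) psi) set0.

(** Brings two chosen electrons next to the state, with a common sign for all [f], so that relations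
    between two annihilators become relations between amplitudes. *)
Lemma amp_front n (i j : 'I_n) : i != j -> exists (e : nat) (rest : seq 'I_n), [/\ i \notin rest, j \notin rest &
  forall (f : {ffun 'I_n -> omode}) psi,
    amp psi f = (-1) ^+ e * (string (map f rest) (aann (f j) (aann (f i) psi))) set0].
Proof.
move=> ij; pose rest := [seq k <- enum 'I_n | (k != i) && (k != j)].
have hp : perm_eq (enum 'I_n) (i :: j :: rest).
  apply: uniq_perm; first exact: enum_uniq.
    by rewrite /= !inE !mem_filter !eqxx /= andbF negb_or ij filter_uniq ?enum_uniq.
  move=> k; have me : k \in enum 'I_n by rewrite mem_enum.
  by rewrite me !in_cons /rest seq.mem_filter me andbT; case: (k == i); case: (k == j).
have [e he] := string_perm hp.
exists e, rest; split; rewrite ?mem_filter ?eqxx ?andbF //.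
by move=> f psi; rewrite /amp he ffunE.
Qed.

Lemma amp_perm n psi (f : {ffun 'I_n -> omode}) (g : {perm 'I_n}) :
  exists e : nat, amp psi [ffun k => f (g k)] = (-1) ^+ e * amp psi f.
Proof.
have hp : perm_eq (map g (enum 'I_n)) (enum 'I_n).
  apply: uniq_perm; [by rewrite map_inj_uniq ?enum_uniq //; exact: perm_inj|exact: enum_uniq|].
  by move=> k; rewrite mem_enum; apply/mapP; exists (g^-1%g k); rewrite ?mem_enum // permKV.
have [e he] := string_perm hp.
exists e; rewrite /amp.
rewrite [map _ _](_ : _ = map f (map g (enum 'I_n))); last first.
  by elim: (enum 'I_n) => //= k l ->; rewrite ffunE.
by rewrite he ffunE.
Qed.

Lemma kerb_fin psi : fin mu psi -> kerb psi.
Proof. by case. Qed.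

Lemma scale_eq0 (k : C) psi : k != 0 -> k *: psi = 0 -> psi = 0.
Proof. by move=> k0 /eqP; rewrite scaler_eq0 (negbTE k0) => /eqP. Qed.

Lemma M_neq0 : M != 0.
Proof. by apply/eqP => /(congr1 (@complex.Re R)) /= h; move: hmu; rewrite h ltxx. Qed.

Lemma aann_updown x psi : fin mu psi -> aann (x, true) (aann (x, false) psi) = 0.
Proof.
move=> hf; have hk := kerb_fin hf; case: hf => _ _ h.
have := h (siteM B x); rewrite (cop_siteE x false hk) copZ cop_siteE; last exact: kerb_aann.
by rewrite scalerA; apply: scale_eq0; rewrite mulf_neq0 ?kappa_neq0.
Qed.

Lemma aann_same x s t psi : fin mu psi -> aann (x, s) (aann (x, t) psi) = 0.
Proof.
move=> hf; case: s; case: t; rewrite ?aann_sqr ?aann_updown //.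
by rewrite aann_anticomm aann_updown ?oppr0.
Qed.

(** At [u(x,y)] the annihilator is proportional to [a_x + a_y]. Absence of double occupancy there
    gives four terms; the two with both electrons on one site already vanish, and the rest is the
    singlet amplitude. *)
Lemma bond_singlet (b : bond B) psi : fin mu psi ->
  aann ((val b).1, true) (aann ((val b).2, false) psi) +
  aann ((val b).2, true) (aann ((val b).1, false) psi) = 0.
Proof.
move=> hf; have hk := kerb_fin hf; have h0 := aann_updown _ hf; case: hf => _ _ h.
have hu s q : kerb q -> cop (uO b, s) q = (M * K) *: (aann ((val b).1, s) q + aann ((val b).2, s) q).
  move=> hq; rewrite cop_uE // !cop_siteE // -scalerDr; exact: scalerA.
have := h (uO b); rewrite (hu false psi hk) copZ copD (hu true _ (kerb_aann _ hk)) (hu true _ (kerb_aann _ hk)).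
rewrite -scalerDr scalerA => /(scale_eq0 (mulf_neq0 (mulf_neq0 M_neq0 (kappa_neq0 mu)) (mulf_neq0 M_neq0 (kappa_neq0 mu)))).
exact: (middle_terms (h0 _) (h0 _)).
Qed.

Lemma nbr_bond x y : nbr x y -> (exists b : bond B, val b = (x, y)) \/ (exists b : bond B, val b = (y, x)).
Proof.
move=> xy; case: hB => _ /(_ _ _ xy).
have [h _|_] := boolP (B x y); first by left; exists (exist _ (x, y) h).
have [h _|_] := boolP (B y x); first by right; exists (exist _ (y, x) h).
by [].
Qed.

Lemma nbr_singlet x y psi : fin mu psi -> nbr x y ->
  aann (x, true) (aann (y, false) psi) + aann (y, true) (aann (x, false) psi) = 0.
Proof.
move=> hf /nbr_bond [] [b hb]; have h := bond_singlet b hf; rewrite hb in h; first exact: h.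
by apply: etrans h; exact: addrC.
Qed.

Lemma aann_swap x y s t psi : fin mu psi -> nbr x y ->
  aann (y, t) (aann (x, s) psi) = aann (y, s) (aann (x, t) psi).
Proof.
move=> hf xy; have h := addr0_eq (nbr_singlet hf xy).
have h' : aann (y, false) (aann (x, true) psi) = aann (y, true) (aann (x, false) psi).
  by rewrite aann_anticomm h.
by case: s; case: t; [reflexivity | exact: h' | exact: (esym h') | reflexivity].
Qed.

Definition swap_spin n (i j : 'I_n) (f : {ffun 'I_n -> omode}) : {ffun 'I_n -> omode} :=
  [ffun k => ((f k).1, (f (tperm i j k)).2)].

Lemma amp_same_site n psi (f : {ffun 'I_n -> omode}) i j :
  fin mu psi -> i != j -> (f i).1 = (f j).1 -> amp psi f = 0.
Proof.
move=> hf ij; have [e [rest [_ _ ->]]] := amp_front ij.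
case: (f i) => x s; case: (f j) => y t /= <-.
by rewrite aann_same // string0 ffunE mulr0.
Qed.

Lemma amp_swap n psi (f : {ffun 'I_n -> omode}) i j :
  fin mu psi -> i != j -> nbr (f i).1 (f j).1 -> amp psi (swap_spin i j f) = amp psi f.
Proof.
move=> hf ij; have [e [rest [ni nj he]]] := amp_front ij.
rewrite !he !ffunE tpermL tpermR.
have -> : [seq (swap_spin i j f) k | k <- rest] = map f rest.
  elim: rest ni nj {he} => //= k l ih; rewrite !inE !negb_or => /andP[ik il] /andP[jk jl].
  by rewrite ih // ffunE tpermD //; case: (f k).
case: (f i) => x s; case: (f j) => y t /= xy.
by rewrite (aann_swap t s hf xy).
Qed.

Definition fcons n (m : omode) (g : {ffun 'I_n -> omode}) : {ffun 'I_n.+1 -> omode} :=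
  [ffun i => if unlift ord0 i is Some k then g k else m].

Lemma fcons0 n m (g : {ffun 'I_n -> omode}) : fcons m g ord0 = m.
Proof. by rewrite ffunE unlift_none. Qed.

Lemma fconsS n m (g : {ffun 'I_n -> omode}) k : fcons m g (lift ord0 k) = g k.
Proof. by rewrite ffunE liftK. Qed.

Lemma sum_fcons (V : nmodType) n (F : {ffun 'I_n.+1 -> omode} -> V) :
  \sum_f F f = \sum_m \sum_(g : {ffun 'I_n -> omode}) F (fcons m g).
Proof.
rewrite pair_bigA /= (reindex (fun p : omode * {ffun 'I_n -> omode} => fcons p.1 p.2)) //.
exists (fun f : {ffun 'I_n.+1 -> omode} => (f ord0, [ffun k : 'I_n => f (lift ord0 k)])).
  move=> [m g] _; rewrite fcons0; congr (_, _); apply/ffunP => k.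
  by rewrite ffunE fconsS.
move=> f _; apply/ffunP => i; rewrite ffunE.
by case: unliftP => [k ->|->] //; rewrite ffunE.
Qed.

Lemma amp_fcons n m (g : {ffun 'I_n -> omode}) psi : amp psi (fcons m g) = amp (aann m psi) g.
Proof.
rewrite /amp enum_ordSl /= fcons0; congr ((string _ _) _).
by elim: (enum 'I_n) => //= k l ->; rewrite fconsS.
Qed.

(** Iterates [parseval_step], removing one electron at a time. The factorial appears because
    amplitudes are indexed by ordered lists of modes. *)
Lemma parseval n chi psi : kerb chi -> kerb psi -> n_electron n psi ->
  (n`!)%:R * inner chi psi = \sum_(f : {ffun 'I_n -> omode}) ((amp chi f)^*)%C * amp psi f.
Proof.
elim: n chi psi => [|n ih] chi psi hc hp hn.
  pose f0 : {ffun 'I_0 -> omode} := [ffun=> (0, true)].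
  rewrite fact0 mul1r (bigD1 f0) //= [X in _ = _ + X]big1 ?addr0; last first.
    by move=> f /eqP []; apply/ffunP => -[].
  rewrite /inner (bigD1 set0) //= big1 ?addr0; last first.
    by move=> T T0; rewrite hn ?mulr0 // cards_eq0.
  by rewrite /amp (_ : enum 'I_0 = [::]) //; apply: size0nil; rewrite size_enum_ord.
rewrite factS natrM [_%:R * _%:R]mulrC -mulrA (parseval_step hc hp hn) mulr_sumr sum_fcons.
apply: eq_bigr => m _; rewrite ih; [|exact: kerb_aann|exact: kerb_aann|exact: n_electron_ann].
by apply: eq_bigr => g _; rewrite !amp_fcons.
Qed.

Definition set_spin n (f : {ffun 'I_n -> omode}) (i : 'I_n) t : {ffun 'I_n -> omode} :=
  [ffun k => if k == i then ((f k).1, t) else f k].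

Lemma string_flip n (f : {ffun 'I_n -> omode}) s t l psi : uniq l ->
  string (map f l) (flip s t psi) = flip s t (string (map f l) psi) +
    \sum_(i <- l) ((f i).2 == s)%:R *: string (map (set_spin f i t) l) psi.
Proof.
elim: l psi => [|i l ih] psi; first by rewrite big_nil addr0.
case/andP => il ul; rewrite [LHS]/= /aann ann_flip stringD stringZ ih // big_cons.
have e1 : [seq (set_spin f i t) k | k <- l] = map f l.
  elim: l il {ih ul} => //= k l ih; rewrite inE negb_or => /andP[ik il].
  by rewrite ih // ffunE eq_sym (negbTE ik).
have e2 k : k \in l -> string [seq (set_spin f k t) j | j <- i :: l] psi =
    string [seq (set_spin f k t) j | j <- l] (ann (orb_a mu (f i).1) (f i).2 psi).
  move=> kl; have E : set_spin f k t i = f i.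
    by rewrite ffunE; case: eqVneq => // ik; move: il; rewrite ik kl.
  change (string [seq (set_spin f k t) j | j <- l] (aann (set_spin f k t i) psi) =
    string [seq (set_spin f k t) j | j <- l] (aann (f i) psi)).
  by rewrite E.
have e3 : string [seq (set_spin f i t) k | k <- i :: l] psi =
   string (map f l) (ann (orb_a mu (f i).1) t psi).
  have E : set_spin f i t i = ((f i).1, t) by rewrite ffunE eqxx.
  change (string [seq (set_spin f i t) k | k <- l] (aann (set_spin f i t i) psi) =
    string (map f l) (aann ((f i).1, t) psi)).
  by rewrite e1 E.
rewrite e3 [s == _]eq_sym; apply: sum_reorder.
by apply: eq_big_seq => k kl; rewrite e2.
Qed.

Lemma amp_flip n (f : {ffun 'I_n -> omode}) s t psi :
  amp (flip s t psi) f = \sum_i ((f i).2 == s)%:R * amp psi (set_spin f i t).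
Proof.
(* The term with the flip outermost vanishes, since a creation operator has no component on the
   vacuum. *)
rewrite /amp string_flip ?enum_uniq // ffunE sum_ffunE big1 ?add0r; last first.
  by move=> z _; rewrite ffunE in_set0.
by rewrite sum_ffunE big_enum; apply: eq_bigr => i _; rewrite ffunE.
Qed.

End Amplitude.

(** * Configurations, holes and the bonds leaving the occupied set *)

Section Configurations.
Variables (R : realType) (L : nat) (B : rel (site L)) (mu : R).
Hypotheses (hL : (2 < L)%N) (hB : is_bond_set B) (hmu : 0 < mu).
Local Notation C := R[i].
Local Notation st := (state R B).
Local Notation omode := (site L * bool)%type.
Implicit Types (s t r : bool) (psi chi p q phi : st) (x y : site L).

Definition nsq (c : C) : R := complex.Re ((c^*)%C * c).

Lemma nsqE a b : nsq (Complex a b) = a ^+ 2 + b ^+ 2.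
Proof. by rewrite /nsq /= !expr2; ring. Qed.

Lemma nsq_ge0 c : 0 <= nsq c.
Proof. by case: c => a b; rewrite nsqE addr_ge0 ?sqr_ge0. Qed.

Lemma nsq_eq0 c : nsq c = 0 -> c = 0.
Proof.
case: c => a b; rewrite nsqE => /eqP; rewrite paddr_eq0 ?sqr_ge0 // !sqrf_eq0.
by case/andP => /eqP -> /eqP ->.
Qed.

Lemma nsq_sign e c : nsq ((-1) ^+ e * c) = nsq c.
Proof.
rewrite -signr_odd; case: (odd e); rewrite ?mul1r ?expr1 ?mulN1r //.
by case: c => a b; rewrite /= !nsqE !sqrrN.
Qed.

Lemma amgm (u v : C) : - (nsq u / 2 + nsq v / 2) <= complex.Re ((u^*)%C * v).
Proof.
case: u => a b; case: v => c d; rewrite !nsqE /=.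
have := sqr_ge0 (a + c); have := sqr_ge0 (b + d); nra.
Qed.

Definition holes n (f : {ffun 'I_n -> omode}) : {set site L} := ~: [set (f i).1 | i : 'I_n].
Definition adjacency (D : {set site L}) : nat := \sum_(x in D) #|[set y in D | nbr x y]|.
Definition exits (D : {set site L}) x : nat := #|[set y in D | nbr x y]|.

Lemma exits_sum D x : exits D x = (\sum_(y | nbr x y) (y \in D))%N.
Proof.
rewrite /exits -sum1_card big_mkcond [RHS]big_mkcond; apply: eq_bigr => y _.
by rewrite inE; case: (y \in D); case: (nbr x y).
Qed.

(** Double counting: each of the six neighbours of a hole is either occupied or a hole. *)
Lemma boundary_card (D : {set site L}) :
  (\sum_(x in ~: D) exits D x + adjacency D = 6 * #|D|)%N.
Proof.
transitivity (\sum_x exits D x)%N.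
  rewrite [RHS](bigID (mem D)) /= addnC; congr (_ + _)%N.
  by apply: eq_bigl => x; rewrite inE.
rewrite (eq_bigr _ (fun x _ => exits_sum D x)).
rewrite (exchange_big_dep predT) //= mulnC -sum_nat_const.
rewrite [RHS]big_mkcond; apply: eq_bigr => y _.
case: (y \in D); last by rewrite big1.
by rewrite -[RHS](card_nbr hL y); apply: eq_bigl => x; rewrite nbr_sym.
Qed.

Section FixedState.
Variables (n : nat) (psi : st).
Hypotheses (hf : fin mu psi).
Local Notation w := (@amp R L B mu n psi).
Implicit Types f : {ffun 'I_n -> omode}.

Lemma amp_inj f : w f != 0 -> injective (fun i => (f i).1).
Proof.
move=> wf i j ij; apply/eqP; apply: contraNT wf => nij.
by apply/eqP; exact: (amp_same_site hL hB hf nij ij).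
Qed.

Lemma card_holes f : w f != 0 -> #|holes f| = (L * L - n)%N.
Proof.
move=> wf; rewrite /holes cardsCs setCK card_imset ?card_ord; last exact: amp_inj.
by rewrite (card_site hL).
Qed.

Lemma sum_exits f : w f != 0 ->
  (\sum_i exits (holes f) (f i).1 + adjacency (holes f) = 6 * (L * L - n))%N.
Proof.
move=> wf; rewrite -(card_holes wf) -boundary_card; congr (_ + _)%N.
by rewrite /holes setCK big_imset //= => i j _ _; exact: amp_inj.
Qed.

Lemma nsq_amp_perm (f : {ffun 'I_n -> omode}) (g : {perm 'I_n}) : nsq (w [ffun k => f (g k)]) = nsq (w f).
Proof. by have [e ->] := amp_perm mu psi f g; rewrite nsq_sign. Qed.

Lemma ffun_perm_inj (g : {perm 'I_n}) :
  injective (fun f : {ffun 'I_n -> omode} => [ffun k => f (g k)]).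
Proof.
move=> f f' /ffunP h; apply/ffunP => k.
by have := h (g^-1%g k); rewrite !ffunE permKV.
Qed.

Lemma holes_perm (f : {ffun 'I_n -> omode}) (g : {perm 'I_n}) : holes [ffun k => f (g k)] = holes f.
Proof.
rewrite /holes; congr (~: _); apply/setP => x; apply/imsetP/imsetP => -[k _ ->].
  by exists (g k); rewrite // ffunE.
by exists (g^-1%g k); rewrite // ffunE permKV.
Qed.

(** Relabelling electrons changes amplitudes only by a sign, so all electrons have the same mean
    number of exits. *)
Lemma sum_exits_sym i j :
  \sum_f nsq (w f) * (exits (holes f) (f i).1)%:R =
  \sum_f nsq (w f) * (exits (holes f) (f j).1)%:R.
Proof.
rewrite (reindex_inj (@ffun_perm_inj (tperm i j))); apply: eq_bigr => f _.
by rewrite nsq_amp_perm holes_perm ffunE tpermL.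
Qed.
End FixedState.

Lemma parseval_sqn n psi : kerb mu psi -> n_electron n psi ->
  (n`!)%:R * sqn psi = \sum_(f : {ffun 'I_n -> omode}) nsq (amp mu psi f).
Proof.
move=> hk hn; have := congr1 (@complex.Re R) (parseval hL hB hk hk hn).
rewrite inner_sqn -(rC_nat R) ReZ /= => ->.
exact: Re_sum.
Qed.

Lemma Re_hop x y psi :
  complex.Re (inner psi (hop mu x y psi)) = \sum_s complex.Re (inner (aann mu (x, s) psi) (aann mu (y, s) psi)).
Proof.
rewrite /hop inner_sumr Re_sum; apply: eq_bigr => s _.
by rewrite inner_cre //; exact: real_orb_a.
Qed.

End Configurations.

(** * Lower bound on the kinetic energy *)
Section KineticBound.
Variables (R : realType) (L : nat) (B : rel (site L)) (mu : R).
Hypotheses (hL : (2 < L)%N) (hB : is_bond_set B) (hmu : 0 < mu).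
Local Notation C := R[i].
Local Notation st := (state R B).
Local Notation omode := (site L * bool)%type.
Implicit Types (s t r : bool) (psi chi p q phi : st) (x y : site L).

(* AM-GM bounds each hopping matrix element by the weights of its two
   configurations; in total every configuration is charged once for each bond from
   an occupied site to a hole. *)
Lemma kin_lower n psi m : fin mu psi -> n_electron n.+1 psi ->
  (forall f : {ffun 'I_n.+1 -> omode}, amp mu psi f != 0 -> (m <= adjacency (holes f))%N) ->
  (m%:R - 6 * (L * L - n.+1)%:R) * sqn psi <= ev (kin mu) psi.
Proof.
move=> hf hn hm; have hk := kerb_fin hf.
pose w (f : {ffun 'I_n.+1 -> omode}) := amp mu psi f.
pose e (f : {ffun 'I_n.+1 -> omode}) y : R := (y \in holes f)%:R.
pose Q x s g y := nsq (w (fcons (x, s) g)) * e (fcons (x, s) g) y.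
have Q0 x s g y : 0 <= Q x s g y by rewrite mulr_ge0 ?nsq_ge0 ?ler0n.
have evE : ev (kin mu) psi = \sum_x \sum_(y | nbr x y) \sum_s
    complex.Re (inner (aann mu (x, s) psi) (aann mu (y, s) psi)).
  rewrite /ev /kin inner_sumr Re_sum; apply: eq_bigr => x _.
  by rewrite inner_sumr Re_sum; apply: eq_bigr => y _; exact: Re_hop.
have n0 : 0 < (n`!)%:R :> R by rewrite ltr0n fact_gt0.
have term x y s : nbr x y -> - (\sum_g (Q x s g y / 2 + Q y s g x / 2)) <=
    (n`!)%:R * complex.Re (inner (aann mu (x, s) psi) (aann mu (y, s) psi)).
  move=> xy.
  have -> : (n`!)%:R * complex.Re (inner (aann mu (x, s) psi) (aann mu (y, s) psi)) =
      \sum_g complex.Re (((w (fcons (x, s) g))^*)%C * w (fcons (y, s) g)).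
    have := parseval hL hB (kerb_aann (x, s) hk) (kerb_aann (y, s) hk) (n_electron_ann (orb_a mu y) s hn).
    move/(congr1 (@complex.Re R)); rewrite -{1}(rC_nat R) ReZ => ->; rewrite Re_sum.
    by apply: eq_bigr => g _; rewrite /w !amp_fcons.
  rewrite -sumrN; apply: ler_sum => g _.
  have [u0|u0] := eqVneq (w (fcons (x, s) g)) 0.
    rewrite u0 conjc0 mul0r oppr_le0; apply: addr_ge0; apply: divr_ge0; rewrite ?Q0 //.
  have [v0|v0] := eqVneq (w (fcons (y, s) g)) 0.
    rewrite v0 mulr0 oppr_le0; apply: addr_ge0; apply: divr_ge0; rewrite ?Q0 //.
  (* If both amplitudes are nonzero, the hard core keeps the other electrons off both sites, so the
     vacated site is a hole of either configuration. *)
  have nin z z' : z != z' -> w (fcons (z, s) g) != 0 -> w (fcons (z', s) g) != 0 ->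
      e (fcons (z, s) g) z' = 1.
    move=> zz' h1 h2; rewrite /e inE; case: imsetP => // -[i _].
    case: (unliftP ord0 i) => [k ->|->]; last by rewrite fcons0 /= => h; rewrite h eqxx in zz'.
    rewrite fconsS => h; have /(_ (lift ord0 k) ord0) := amp_inj hL hB hf h2.
    by rewrite fcons0 fconsS /= -h => /(_ erefl) /eqP.
  have xny : x != y by apply: contraTneq xy => ->; rewrite nbr_irrefl.
  rewrite /Q (nin x y) // (nin y x) // 1?eq_sym // !mulr1.
  exact: amgm.
have sumQ : \sum_x \sum_(y | nbr x y) \sum_s \sum_g (Q x s g y / 2 + Q y s g x / 2) =
    \sum_f nsq (w f) * (exits (holes f) (f ord0).1)%:R.
  transitivity (\sum_x \sum_(y | nbr x y) \sum_s \sum_g Q x s g y).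
    pose A x y := \sum_s \sum_g Q x s g y / 2.
    have -> : \sum_x \sum_(y | nbr x y) \sum_s \sum_g (Q x s g y / 2 + Q y s g x / 2) =
      \sum_x \sum_(y | nbr x y) A x y + \sum_x \sum_(y | nbr x y) A y x.
      rewrite -big_split; apply: eq_bigr => x _; rewrite -big_split; apply: eq_bigr => y _.
      by rewrite -big_split; apply: eq_bigr => s _; rewrite -big_split.
    rewrite [X in _ + X](exchange_big_dep predT) //= -big_split /=; apply: eq_bigr => x _.
    rewrite [X in _ + X](eq_bigl (fun y => nbr x y)); last by move=> y; rewrite nbr_sym.
    rewrite -big_split /=; apply: eq_bigr => y _; rewrite /A -big_split /=.
    apply: eq_bigr => s _; rewrite -big_split /=; apply: eq_bigr => g _.
    by rewrite -splitr.
  rewrite (eq_bigr (fun x => \sum_s \sum_g \sum_(y | nbr x y) Q x s g y)); last first.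
    by move=> x _; rewrite exchange_big; apply: eq_bigr => s _; rewrite exchange_big.
  rewrite pair_bigA /=.
  rewrite sum_fcons; apply: eq_bigr => -[x s] _ /=; apply: eq_bigr => g _.
  by rewrite fcons0 exits_sum natr_sum mulr_sumr.
have lower : - \sum_f nsq (w f) * (exits (holes f) (f ord0).1)%:R <= (n`!)%:R * ev (kin mu) psi.
  rewrite -sumQ evE mulr_sumr -sumrN; apply: ler_sum => x _.
  rewrite mulr_sumr -sumrN; apply: ler_sum => y xy.
  by rewrite mulr_sumr -sumrN; apply: ler_sum => s _; exact: term.
(* Expanding the hopping term singles out electron [ord0]; antisymmetry spreads its exits over all
   electrons, with the factor that separates the two factorials. *)
have sym : n.+1%:R * (\sum_f nsq (w f) * (exits (holes f) (f ord0).1)%:R) =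
    \sum_f nsq (w f) * (\sum_i exits (holes f) (f i).1)%:R.
  under [RHS]eq_bigr do rewrite natr_sum mulr_sumr.
  rewrite exchange_big /= [RHS](eq_bigr (fun=> \sum_f nsq (w f) * (exits (holes f) (f ord0).1)%:R)).
    by rewrite sumr_const card_ord mulr_natl.
  by move=> i _; exact: sum_exits_sym.
have upper : \sum_f nsq (w f) * (\sum_i exits (holes f) (f i).1)%:R <=
    \sum_f nsq (w f) * (6 * (L * L - n.+1)%:R - m%:R).
  apply: ler_sum => f _; have [wf|wf] := eqVneq (w f) 0.
    by rewrite wf /nsq mulr0 /= !mul0r.
  apply: ler_wpM2l; first exact: nsq_ge0.
  have := sum_exits hL hB hf wf; have := hm _ wf => h1 h2.
  have : (m%:R <= (adjacency (holes f))%:R :> R) by rewrite ler_nat.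
  have := congr1 (fun k => k%:R : R) h2; rewrite natrD natrM => h3; lra.
rewrite -mulr_suml -(parseval_sqn hL hB hk hn) in upper.
have f0 : 0 < ((n.+1)`!)%:R :> R by rewrite ltr0n fact_gt0.
rewrite -(ler_pM2l f0).
have l2 : - (n.+1%:R * \sum_f nsq (w f) * (exits (holes f) (f ord0).1)%:R) <= ((n.+1)`!)%:R * ev (kin mu) psi.
  by rewrite factS natrM -mulrN -mulrA ler_wpM2l.
apply: le_trans l2; rewrite sym.
lra.
Qed.

End KineticBound.

(** * The Casimir operator and spin exchange *)
Section SpinSwap.
Variables (R : realType) (L : nat) (B : rel (site L)) (mu : R).
Local Notation C := R[i].
Local Notation st := (state R B).
Local Notation omode := (site L * bool)%type.
Variable n : nat.
Implicit Types (f : {ffun 'I_n -> omode}) (s t r : bool) (psi : st) (i j k : 'I_n).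
Local Notation ampn := (@amp R L B mu n).

Lemma ampD p q f : ampn (p + q) f = ampn p f + ampn q f.
Proof. by rewrite /amp stringD ffunE. Qed.

Lemma ampZ c p f : ampn (c *: p) f = c * ampn p f.
Proof. by rewrite /amp stringZ ffunE. Qed.

Lemma ampN p f : ampn (- p) f = - ampn p f.
Proof. by rewrite /amp stringN ffunE. Qed.

Lemma set_spin_id f i : set_spin f i (f i).2 = f.
Proof. by apply/ffunP => k; rewrite ffunE; case: eqVneq => [->|//]; case: (f i). Qed.

Lemma set_spin_back f i t : set_spin (set_spin f i t) i (f i).2 = f.
Proof.
by apply/ffunP => k; rewrite !ffunE; case: eqVneq => [->|//] /=; case: (f i).
Qed.

Lemma set_spin_swap f i j : i != j ->
  set_spin (set_spin f i (f j).2) j (f i).2 = swap_spin i j f.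
Proof.
move=> ij; apply/ffunP => k; rewrite !ffunE.
have [->|kj] := eqVneq k j; first by rewrite tpermR eq_sym (negbTE ij).
have [->|ki] := eqVneq k i; first by rewrite tpermL.
by rewrite tpermD 1?eq_sym //; case: (f k).
Qed.

Lemma swap_spin_same f i j : (f i).2 = (f j).2 -> swap_spin i j f = f.
Proof.
move=> h; apply/ffunP => k; rewrite ffunE.
by rewrite [RHS]surjective_pairing; congr (_, _); case: tpermP => [->|->|]; rewrite ?h.
Qed.

Definition dlt (b : bool) : C := b%:R.

(** The two flips act either on one electron, which restores its spin, or on two electrons of
    opposite spins, which exchanges them. *)
Lemma amp_flip_flip s psi f :
  ampn (flip s (~~ s) (flip (~~ s) s psi)) f =
  \sum_i dlt ((f i).2 == s) * ampn psi f +
  \sum_i \sum_(j | j != i) dlt (((f i).2 == s) && ((f j).2 == ~~ s)) * ampn psi (swap_spin i j f).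
Proof.
rewrite amp_flip -big_split; apply: eq_bigr => i _ /=.
have [si|] := eqVneq (f i).2 s; last first.
  by rewrite mul0r /dlt mul0r add0r big1 // => j _; rewrite mul0r.
rewrite mul1r /dlt mul1r amp_flip (bigD1 i) //=; congr (_ + _).
  by rewrite {1}/set_spin ffunE eqxx /= eqxx mul1r -{2}si set_spin_back.
apply: eq_bigr => j ji; rewrite {1}/set_spin ffunE (negbTE ji).
have [sj|_] := eqVneq (f j).2 (~~ s); last by rewrite !mul0r.
by rewrite !mul1r -sj -si set_spin_swap // eq_sym.
Qed.

Definition sg f i : C := dlt ((f i).2 == true) - dlt ((f i).2 == false).

Lemma amp_zflip psi f : ampn (zflip psi) f = (\sum_i sg f i) * ampn psi f.
Proof.
rewrite /zflip ampD ampN !amp_flip mulr_suml -sumrB; apply: eq_bigr => i _.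
rewrite /sg mulrBl; have E := set_spin_id f i.
by case si : (f i).2 E => E; rewrite /dlt /= ?mul0r // ?mul1r E.
Qed.

Lemma sum_offdiag (F : 'I_n -> 'I_n -> C) :
  \sum_i \sum_j F i j = \sum_i F i i + \sum_i \sum_(j | j != i) F i j.
Proof. by rewrite -big_split; apply: eq_bigr => i _; rewrite (bigD1 i). Qed.

(** The exchange identity [S_i . S_j = (P_ij - 1/2) / 2] on the four pairs of spins, [u] being the
    amplitude and [v] the one after the exchange, which is trivial for equal spins. *)
Lemma pair_swap (a b : bool) (u v : C) : (a = b -> v = u) ->
  2^-1 * (dlt ((a == true) && (b == false)) * v + dlt ((a == false) && (b == true)) * v)
  + 4^-1 * ((dlt (a == true) - dlt (a == false)) * (dlt (b == true) - dlt (b == false)) * u) =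
  2^-1 * (v - 2^-1 * u).
Proof.
have e2 : (4^-1 : C) = 2^-1 * 2^-1 by rewrite -invfM -natrM.
have e1 : (2^-1 : C) * 2 = 1 by rewrite mulVf // pnatr_eq0.
rewrite e2; move: (2^-1 : C) e1 => h e1.
case: a; case: b; rewrite /dlt /= => huv.
- rewrite (huv erefl); transitivity (h * u * (h * 2) - h * (h * u)); first by ring.
  by rewrite e1; ring.
- ring.
- ring.
- rewrite (huv erefl); transitivity (h * u * (h * 2) - h * (h * u)); first by ring.
  by rewrite e1; ring.
Qed.

Lemma amp_Stot_sq psi f : ampn (Stot_sq psi) f =
  (3 / 4 * n%:R) * ampn psi f +
  \sum_i \sum_(j | j != i) 2^-1 * (ampn psi (swap_spin i j f) - 2^-1 * ampn psi f).
Proof.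
rewrite Stot_sqE ampD !ampZ ampD (amp_flip_flip true) (amp_flip_flip false) !amp_zflip /=.
set u := ampn psi f; set S := \sum_i sg f i.
have hS : S * (S * u) = n%:R * u + \sum_i \sum_(j | j != i) (sg f i * sg f j * u).
  have -> : S * (S * u) = \sum_i \sum_j (sg f i * sg f j * u).
    rewrite mulrA /S mulr_suml mulr_suml; apply: eq_bigr => i _.
    by rewrite mulr_sumr mulr_suml.
  rewrite sum_offdiag; congr (_ + _).
  rewrite -mulr_suml; congr (_ * _); rewrite (eq_bigr (fun=> 1)) ?sumr_const ?card_ord //.
  by move=> i _; rewrite /sg /dlt; case: (f i).2 => /=; ring.
have hD : \sum_i dlt ((f i).2 == true) * u + \sum_i dlt ((f i).2 == false) * u = n%:R * u.
  rewrite -big_split -[n in RHS]card_ord -sum1_card natr_sum mulr_suml; apply: eq_bigr => i _ /=.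
  by rewrite /dlt; case: (f i).2 => /=; ring.
have hE : \sum_i \sum_(j | j != i) 2^-1 * (ampn psi (swap_spin i j f) - 2^-1 * u) =
  2^-1 * (\sum_i \sum_(j | j != i) dlt (((f i).2 == true) && ((f j).2 == false)) * ampn psi (swap_spin i j f)
   + \sum_i \sum_(j | j != i) dlt (((f i).2 == false) && ((f j).2 == true)) * ampn psi (swap_spin i j f))
  + 4^-1 * \sum_i \sum_(j | j != i) (sg f i * sg f j * u).
  rewrite -big_split !mulr_sumr -big_split; apply: eq_bigr => i _ /=.
  rewrite -big_split !mulr_sumr -big_split; apply: eq_bigr => j _ /=.
  apply: esym; apply: (pair_swap (a := (f i).2) (b := (f j).2)) => h.
  by rewrite swap_spin_same.
rewrite hS hE; move: hD.
move: (\sum_i dlt ((f i).2 == true) * u) (\sum_i dlt ((f i).2 == false) * u).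
move: (\sum_i \sum_(j | j != i) (sg f i * sg f j * u)) => D.
move: (\sum_i \sum_(j | j != i) dlt (((f i).2 == true) && ((f j).2 == false)) * ampn psi (swap_spin i j f)) => B1.
move: (\sum_i \sum_(j | j != i) dlt (((f i).2 == false) && ((f j).2 == true)) * ampn psi (swap_spin i j f)) => B2.
move=> A1 A2 hA; have -> : A1 + B1 + (A2 + B2) = n%:R * u + (B1 + B2) by rewrite -hA; ring.
by field.
Qed.

End SpinSwap.

(** * Casimir bound from exchange symmetry inside a cluster *)

Section SpinBound.
Variables (R : realType) (L : nat) (B : rel (site L)) (mu : R).
Local Notation C := R[i].
Local Notation st := (state R B).
Local Notation omode := (site L * bool)%type.
Variables (n : nat) (psi : st) (lam0 : R) (f0 : {ffun 'I_n -> omode}) (A : {set 'I_n}).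
Implicit Types (f : {ffun 'I_n -> omode}) (i j k : 'I_n).
Local Notation w := (@amp R L B mu n psi).
Hypotheses (hS : Stot_sq psi = rC lam0 *: psi) (w0 : w f0 != 0).
Let same f := [forall k, (f k).1 == (f0 k).1].
Hypothesis (hA : forall i j f, i \in A -> j \in A -> i != j -> same f -> w (swap_spin i j f) = w f).

(** Freezing the positions to those of [f0] leaves a spin wave function. [F] is its squared norm and
    [P i j] the unnormalized expectation of the exchange of [i] and [j]. *)
Let F : R := \sum_(f | same f) nsq (w f).
Let P i j : R := \sum_(f | same f) complex.Re (((w f)^*)%C * w (swap_spin i j f)).

Lemma same_swap i j f : same (swap_spin i j f) = same f.
Proof. by apply: eq_forallb => k; rewrite ffunE. Qed.

Lemma swapK i j : involutive (@swap_spin L n i j).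
Proof. by move=> f; apply/ffunP => k; rewrite !ffunE tpermK; case: (f k). Qed.

Lemma F_gt0 : 0 < F.
Proof.
have sf0 : same f0 by apply/forallP.
rewrite /F (bigD1 f0) //= ltr_wpDr //; first by apply: sumr_ge0 => f _; exact: nsq_ge0.
by rewrite lt_def nsq_ge0 andbT; apply: contra_neq w0; exact: nsq_eq0.
Qed.

(** The exchange is an involution that preserves the norm, so its expectation is at least [- F];
    AM-GM proves this termwise. *)
Lemma P_lower i j : - F <= P i j.
Proof.
have e : F = \sum_(f | same f) (nsq (w f) / 2 + nsq (w (swap_spin i j f)) / 2).
  rewrite big_split /= -!mulr_suml.
  rewrite -[X in _ + X / 2](_ : F = _); first by rewrite -splitr.
  rewrite /F (reindex_inj (inv_inj (swapK i j))) /=; apply: eq_bigl => f; exact: same_swap.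
rewrite e -sumrN; apply: ler_sum => f _; exact: amgm.
Qed.

Lemma P_sym i j : i \in A -> j \in A -> i != j -> P i j = F.
Proof. by move=> iA jA ij; apply: eq_bigr => f sf; rewrite hA. Qed.

Lemma casimir_sum : lam0 * F = 3 / 4 * n%:R * F + \sum_i \sum_(j | j != i) 2^-1 * (P i j - 2^-1 * F).
Proof.
have h2 : rC (2^-1) = 2^-1 :> C by rewrite /rC fmorphV rmorph_nat.
have h3 : rC (3 / 4 * n%:R) = 3 / 4 * n%:R :> C by rewrite /rC !rmorphM fmorphV !rmorph_nat.
have t f : lam0 * nsq (w f) = 3 / 4 * n%:R * nsq (w f) +
   \sum_i \sum_(j | j != i) 2^-1 * (complex.Re (((w f)^*)%C * w (swap_spin i j f)) - 2^-1 * nsq (w f)).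
  have := amp_Stot_sq mu psi f; rewrite hS ampZ => /(congr1 (fun c => complex.Re (((w f)^*)%C * c))).
  rewrite mulrDr ReD mulrCA ReZ => ->; congr (_ + _).
    by rewrite -h3 mulrCA ReZ.
  rewrite mulr_sumr Re_sum; apply: eq_bigr => i _; rewrite mulr_sumr Re_sum; apply: eq_bigr => j _.
  rewrite -h2 mulrCA ReZ; congr (_ * _).
  by rewrite mulrBr ReD mulrCA /nsq -ReZ; case: (rC _ * _).
rewrite /F !mulr_sumr (eq_bigr _ (fun f _ => t f)) big_split /=; congr (_ + _).
rewrite exchange_big; apply: eq_bigr => i _; rewrite exchange_big; apply: eq_bigr => j _ /=.
by rewrite -mulr_sumr sumrB -mulr_sumr.
Qed.

Lemma spin_bound : 3 / 4 * n%:R - 3 / 4 * (n%:R * (n%:R - 1)) + #|A|%:R * (#|A|%:R - 1) <= lam0.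
Proof.
have F0 := F_gt0.
pose c i j : R := ((i \in A) && (j \in A))%:R.
(* A pair inside [A] contributes [(1 - 1/2) / 2 = 1 - 3/4], any other pair at least
   [(-1 - 1/2) / 2 = - 3/4]. *)
have low i j : j != i -> (c i j - 3 / 4) * F <= 2^-1 * (P i j - 2^-1 * F).
  move=> ji; rewrite /c; case iA : (i \in A); case jA : (j \in A) => /=;
    try by have := P_lower i j; lra.
  by rewrite P_sym // 1?eq_sym //; lra.
have cnt : \sum_i \sum_(j | j != i) (c i j - 3 / 4) =
   #|A|%:R * (#|A|%:R - 1) - 3 / 4 * (n%:R * (n%:R - 1)).
  have off (G : 'I_n -> 'I_n -> R) : \sum_i \sum_(j | j != i) G i j = \sum_i \sum_j G i j - \sum_i G i i.
    by rewrite -sumrB; apply: eq_bigr => i _; rewrite [X in _ = X - _](bigD1 i) //= [G i i + _]addrC addrK.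
  have cA : \sum_i (i \in A)%:R = #|A|%:R :> R.
    by rewrite -natr_sum -sum1_card [in RHS]big_mkcond; congr (_%:R); apply: eq_bigr => i _; case: (i \in A).
  rewrite off.
  have -> : \sum_i (c i i - 3 / 4) = #|A|%:R - 3 / 4 * n%:R.
    rewrite sumrB sumr_const card_ord -[_ *+ n]mulr_natr; congr (_ - _).
    by rewrite -cA; apply: eq_bigr => i _; rewrite /c andbb.
  have -> : \sum_i \sum_j (c i j - 3 / 4) = #|A|%:R * #|A|%:R - 3 / 4 * (n%:R * n%:R).
    rewrite (eq_bigr (fun i => (i \in A)%:R * #|A|%:R - 3 / 4 * n%:R)).
      rewrite sumrB -mulr_suml cA sumr_const card_ord -[_ *+ n]mulr_natr; congr (_ - _); ring.
    move=> i _; rewrite sumrB sumr_const card_ord -[_ *+ n]mulr_natr; congr (_ - _).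
    by rewrite -cA mulr_sumr; apply: eq_bigr => j _; rewrite /c; case: (i \in A); case: (j \in A); rewrite /= ?mulr0 ?mul0r ?mulr1.
  ring.
rewrite -(ler_pM2r F0) casimir_sum.
have : (\sum_i \sum_(j | j != i) (c i j - 3 / 4)) * F <= \sum_i \sum_(j | j != i) 2^-1 * (P i j - 2^-1 * F).
  rewrite mulr_suml; apply: ler_sum => i _; rewrite mulr_suml; apply: ler_sum => j; exact: low.
rewrite cnt; lra.
Qed.
End SpinBound.

(** * Low-momentum plane waves *)
Section Trigonometry.
Import numFieldNormedType.Exports.
Local Open Scope classical_set_scope.

Section Trig.
Variable R : realType.
Implicit Types x y : R.

Lemma sin_mvt x : 0 < x -> exists2 c, 0 < c < x & sin x = cos c * x.
Proof.
move=> x0.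
have h1 z : z \in `]0, x[%R -> is_derive z 1 (@sin R) (cos z) by move=> _; exact: is_derive_sin.
have h2 : {within `[0, x], continuous (@sin R)}.
  by apply: continuous_subspaceT => z; exact: continuous_sin.
have [c] := MVT x0 h1 h2.
by rewrite in_itv /= sin0 !subr0 => h3 h4; exists c.
Qed.

Lemma sin_sqr_le x : sin x ^+ 2 <= x ^+ 2.
Proof.
wlog x0 : x / 0 <= x => [h|].
  have [/h//|/ltW xn] := leP 0 x.
  by have := h (- x); rewrite oppr_ge0 xn sinN !sqrrN; apply.
have [->|xn0] := eqVneq x 0; first by rewrite sin0.
have [|c _ ->] := @sin_mvt x; first by rewrite lt_def xn0.
rewrite exprMn ler_piMl ?sqr_ge0 // -(expr1n R 2) -[leLHS]sqr_normr ler_sqr ?nnegrE ?normr_ge0 //; exact: cos_max.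
Qed.

Lemma cos_ge x : 1 - cos x <= x ^+ 2 / 2.
Proof.
have -> : cos x = cos ((x / 2) *+ 2) by rewrite -mulr_natr divfK.
rewrite cos_mulr2n; have := sin_sqr_le (x / 2); rewrite sin2cos2 => h.
rewrite -mulr_natr; rewrite exprMn in h; lra.
Qed.

(* 192/17 < 125/11, which is what makes 11/5 pi^2 < 25. *)
Lemma pi_sqr_le : (pi : R) ^+ 2 <= 192 / 17.
Proof.
have pi0 := pi_gt0 R.
(* From [x cos x <= sin x], [x^2] is at most [tan^2 (pi/8) = (1 - d) / (1 + d)] with
   [d = cos (pi/4)]. The bound [d >= 7/10] gives [3/17], and [64 * 3/17 = 192/17]. *)
pose x : R := pi / 8.
have x0 : 0 < x by rewrite divr_gt0.
have [c /andP[c0 cx] sE] := sin_mvt x0.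
have cpos : 0 < cos x by apply: cos_gt0_pihalf; rewrite /x; apply/andP; split; lra.
have ccos : cos x <= cos c.
  rewrite ltW // ltr_cos // in_itv /= /x; apply/andP; split; rewrite /x in cx; lra.
have h1 : x * cos x <= sin x by rewrite sE mulrC ler_wpM2r // ltW.
have h2 : x ^+ 2 * cos x ^+ 2 <= 1 - cos x ^+ 2.
  rewrite -sin2cos2 -exprMn ler_sqr // nnegrE; first by rewrite mulr_ge0 ?ltW.
  by apply: le_trans h1; rewrite mulr_ge0 ?ltW.
pose d : R := cos (pi / 4).
have dE : d = cos x ^+ 2 *+ 2 - 1.
  by rewrite -cos_mulr2n /x /d; congr cos; rewrite -mulr_natr; field.
have d0 : 0 < d by apply: cos_gt0_pihalf; apply/andP; split; lra.
have d2 : d ^+ 2 = 1 / 2.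
  have := cos_mulr2n (pi / 4 : R); rewrite -/d (_ : (pi / 4) *+ 2 = pi / 2).
    by rewrite cos_pihalf -mulr_natr => h; lra.
  by rewrite -mulr_natr; field.
have d7 : 7 / 10 <= d by nra.
have -> : (pi : R) ^+ 2 = 64 * x ^+ 2 by rewrite /x expr_div_n; field.
rewrite -mulr_natr in dE.
have C2 : cos x ^+ 2 = (1 + d) / 2 by lra.
rewrite C2 in h2.
have : x ^+ 2 * (1 + d) <= 1 - d by lra.
have := sqr_ge0 x; nra.
Qed.
End Trig.

Section PickLow.
Variables (R : realFieldType) (T : finType) (F : T -> R).

(** Removing an element where [F] is largest does not raise the average; this is repeated until [h]
    elements remain. *)
Lemma pick_low (S : {set T}) h : (h <= #|S|)%N ->
  exists2 Y : {set T}, (Y \subset S) && (#|Y| == h) & #|S|%:R * \sum_(k in Y) F k <= h%:R * \sum_(k in S) F k.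
Proof.
move: {2}(#|S| - h)%N (leqnn (#|S| - h)) => d; elim: d S => [|d ih] S hd hS.
  have e : #|S| = h by apply/eqP; rewrite eqn_leq hS andbT -subn_eq0 -leqn0.
  by exists S; rewrite ?e ?fintype.subxx ?eqxx.
have [e|ne] := eqVneq #|S| h.
  by exists S; rewrite ?e ?fintype.subxx ?eqxx.
have hlt : (h < #|S|)%N by rewrite ltn_neqAle eq_sym ne.
have [k0 k0S] : exists k, k \in S by apply/set0Pn; rewrite -card_gt0; case: #|S| hlt.
case: (arg_maxP F k0S) => k kS' kmax'.
have kS : k \in S := kS'; have kmax j : j \in S -> F j <= F k := kmax' j.
have cS : #|S| = (#|S :\ k|).+1 by rewrite (cardsD1 k S) kS.
have [||Y /andP[YS Yh] hY] := ih (S :\ k); rewrite ?cS in hd hlt *; try lia.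
exists Y; first by rewrite Yh andbT; apply: (fintype.subset_trans YS); exact: subsetDl.
rewrite (big_setD1 k kS) /=.
set n := #|S :\ k| in hY hlt *; set A := \sum_(i in Y) F i in hY *; set Z := \sum_(i in S :\ k) F i in hY *.
have YF : A <= h%:R * F k.
  rewrite /A -(eqP Yh) mulr_natl -sumr_const; apply: ler_sum => j jY.
  by apply: kmax; have := fintype.subsetP YS _ jY; rewrite !inE => /andP[].
have ZA : Z <= n%:R * F k.
  rewrite /Z /n mulr_natl -sumr_const; apply: ler_sum => j; rewrite !inE => /andP[_ jS].
  exact: kmax.
rewrite -natr1 mulrDl mul1r mulrDr; apply: le_trans (lerD hY YF) _.
by rewrite addrC.
Qed.
End PickLow.
End Trigonometry.

(** * Plane waves on the torus and the spectrum of the hopping matrix *)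

Section Fourier.
Variables (R : realType) (n : nat).
Local Notation L := n.+3.
Local Notation C := R[i].
Implicit Types (x d k : site L) (a c : 'Z_L).

Definition ex (t : R) : C := Complex (cos t) (sin t).
Definition wv : R := 2 * pi / L%:R.
Definition zeta : C := ex wv.

Lemma conj_one : ((1 : C)^*)%C = 1. Proof. exact: rmorph1. Qed.

Lemma exD s t : ex (s + t) = ex s * ex t.
Proof. by rewrite /ex cosD sinD; congr Complex; rewrite addrC [cos s * _]mulrC [sin s * _]mulrC addrC. Qed.

Lemma ex0 : ex 0 = 1.
Proof. by rewrite /ex cos0 sin0. Qed.

Lemma exN t : ex (- t) = ((ex t)^*)%C.
Proof. by rewrite /ex cosN sinN. Qed.

Lemma exX t m : ex (t * m%:R) = ex t ^+ m.
Proof. by elim: m => [|m ih]; rewrite ?mulr0 ?ex0 // mulrSr mulrDr mulr1 exD ih exprSr. Qed.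

Lemma zetaL : zeta ^+ L = 1.
Proof.
rewrite -exX /wv divfK ?pnatr_eq0 // /ex mulrC mulr_natr cos2pi sin2pi.
by [].
Qed.

Lemma zeta_prim m : (0 < m < L)%N -> zeta ^+ m != 1.
Proof.
move=> /andP[m0 mL]; rewrite -exX; apply/eqP => /(congr1 (@complex.Re R)) /=.
set t := wv * m%:R => h.
have pi0 := pi_gt0 R.
(* Half angles: [t / 2] lies strictly between 0 and pi, so [cos t = 1 - 2 sin^2 (t / 2) < 1]. *)
have tE : t = (t / 2) *+ 2 by rewrite -mulr_natr divfK.
have s0 : 0 < sin (t / 2).
  have m1 : 0 < m%:R / L%:R :> R by rewrite divr_gt0 ?ltr0n.
  have m2 : m%:R / L%:R < 1 :> R by rewrite ltr_pdivrMr ?ltr0n // mul1r ltr_nat.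
  have -> : t / 2 = pi * (m%:R / L%:R).
    have L0 : (L%:R : R) != 0 by rewrite pnatr_eq0.
    by rewrite /t /wv; move: L0; move: (L%:R : R) (m%:R : R) => l r l0; field.
  by apply: sin_gt0_pi; rewrite mulr_gt0 //= gtr_pMr.
move: h; rewrite tE cos_mulr2n => h.
have := cos2Dsin2 (t / 2); rewrite -mulr_natr in h; have := exprn_gt0 2 s0; lra.
Qed.

Lemma zeta_conj m : ((zeta ^+ m)^*)%C * zeta ^+ m = 1.
Proof. by rewrite -exX -exN -exD addNr ex0. Qed.

Lemma zeta_mod m : zeta ^+ (m %% L) = zeta ^+ m.
Proof. by rewrite {2}(divn_eq m L) exprD mulnC exprM zetaL expr1n mul1r. Qed.

Definition chi k x : C := zeta ^+ (k.1 * x.1 + k.2 * x.2).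

Lemma chiC k x : chi k x = chi x k.
Proof. by rewrite /chi mulnC [X in (_ + X)%N]mulnC. Qed.

Lemma zeta_mulD (u v m : nat) : zeta ^+ (m * ((u + v) %% L)) = zeta ^+ (m * u) * zeta ^+ (m * v).
Proof. by rewrite -zeta_mod modnMmr zeta_mod mulnDr exprD. Qed.

Lemma chiD k x d : chi k (shift x d) = chi k x * chi k d.
Proof. by rewrite /chi /shift /= !exprD !zeta_mulD mulrACA. Qed.

Lemma chi0 k : chi k (0, 0) = 1.
Proof. by rewrite /chi /= !muln0 addn0 expr0. Qed.

Lemma chi_conj k x : ((chi k x)^*)%C * chi k x = 1.
Proof. exact: zeta_conj. Qed.

Lemma chiN k d : chi k (- d.1, - d.2) = ((chi k d)^*)%C.
Proof.
have h : chi k d * chi k (- d.1, - d.2) = 1.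
  by rewrite -chiD /shift /= !subrr chi0.
by rewrite -[LHS]mul1r -(chi_conj k d) -mulrA h mulr1.
Qed.

Lemma orth1 a c : \sum_(x : 'Z_L) ((zeta ^+ (a * x))^*)%C * zeta ^+ (c * x) = (a == c)%:R * L%:R.
Proof.
pose q := ((zeta ^+ a)^*)%C * zeta ^+ c.
have qX (m : nat) : ((zeta ^+ (a * m))^*)%C * zeta ^+ (c * m) = q ^+ m.
  by rewrite /q exprMn -!exprM -rmorphXn /= -exprM.
rewrite (eq_bigr (fun x : 'Z_L => q ^+ x)); last by move=> x _; exact: qX.
case: (eqVneq a c) => [ac|ac].
  have q1 : q = 1 by rewrite /q ac; exact: zeta_conj.
  by rewrite q1 (eq_bigr (fun=> 1)) ?sumr_const ?card_ord ?mul1r // => x _; rewrite expr1n.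
rewrite mul0r.
have qL : q ^+ L = 1.
  by rewrite -qX [(a * L)%N]mulnC [(c * L)%N]mulnC !exprM zetaL !expr1n mulr1 conj_one.
have qn1 : q != 1.
  apply/eqP => q1.
  have e : zeta ^+ c = zeta ^+ a.
    by rewrite -[LHS]mul1r -(zeta_conj a) [X in X * _]mulrC -mulrA -/q q1 mulr1.
  have [lt|lt|eq] := ltngtP (val a) (val c).
  - have /negP := @zeta_prim (val c - val a) ltac:(rewrite subn_gt0 lt; exact: leq_ltn_trans (leq_subr _ _) (ltn_ord c)).
    apply; apply/eqP; apply: (mulfI (x := zeta ^+ a)).
      by apply/eqP => z0; have := zeta_conj a; rewrite z0 mulr0 => /eqP; rewrite eq_sym oner_eq0.
    by rewrite -exprD subnKC ?(ltnW lt) // mulr1.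
  - have /negP := @zeta_prim (val a - val c) ltac:(rewrite subn_gt0 lt; exact: leq_ltn_trans (leq_subr _ _) (ltn_ord a)).
    apply; apply/eqP; apply: (mulfI (x := zeta ^+ c)).
      by apply/eqP => z0; have := zeta_conj c; rewrite z0 mulr0 => /eqP; rewrite eq_sym oner_eq0.
    by rewrite -exprD subnKC ?(ltnW lt) // mulr1.
  - by move/eqP: ac; apply; apply: val_inj.
have := subrX1 q L; rewrite qL subrr => /esym /eqP; rewrite mulf_eq0 subr_eq0 (negbTE qn1) /=.
by move/eqP.
Qed.

Lemma orth k k' : \sum_x ((chi k x)^*)%C * chi k' x = (k == k')%:R * (L%:R * L%:R).
Proof.
rewrite -(pair_bigA _ (fun a c => ((chi k (a, c))^*)%C * chi k' (a, c))) /=.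
rewrite (eq_bigr (fun a : 'Z_L => (((zeta ^+ (k.1 * a))^*)%C * zeta ^+ (k'.1 * a)) *
   \sum_(c : 'Z_L) ((zeta ^+ (k.2 * c))^*)%C * zeta ^+ (k'.2 * c))); last first.
  move=> a _; rewrite mulr_sumr; apply: eq_bigr => c _.
  by rewrite /chi /= !exprD rmorphM /= mulrACA.
rewrite -mulr_suml !orth1 mulrACA; congr (_ * _).
case: k => a c; case: k' => a' c' /=; rewrite xpair_eqE.
by case: (a == a'); case: (c == c'); rewrite /= ?mulr1 ?mulr0 ?mul0r.
Qed.

(** The hopping eigenvalue [2 (cos k1 + cos k2 + cos (k1 - k2))] at momentum [k], the momenta being
    multiples of [wv]. *)
Definition band k : R := 2 * (complex.Re (zeta ^+ k.1) + complex.Re (zeta ^+ k.2) +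
   complex.Re (zeta ^+ k.1 * ((zeta ^+ k.2)^*)%C)).

Lemma add_conj (u : C) : u + (u^*)%C = rC (2 * complex.Re u).
Proof. by case: u => a b; rewrite /rC /=; congr Complex; ring. Qed.

Lemma sum_dirs_chi k : \sum_(d <- dirs L) chi k d = rC (band k).
Proof.
rewrite /dirs !big_cons big_nil addr0.
have h10 := chiN k (1, 0); have h01 := chiN k (0, 1); have h11 := chiN k (1, -1).
rewrite /= oppr0 in h10 h01; rewrite /= opprK in h11; rewrite h10 h01 h11.
have e10 : chi k (1, 0) = zeta ^+ k.1 by rewrite /chi /= muln0 addn0 muln1.
have e01 : chi k (0, 1) = zeta ^+ k.2 by rewrite /chi /= muln0 add0n muln1.
have e11 : chi k (1, -1) = zeta ^+ k.1 * ((zeta ^+ k.2)^*)%C.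
  rewrite -e10 -e01 -h01 -chiD; congr chi; rewrite /shift /=.
  by rewrite addr0 add0r.
rewrite e11 e10 e01 /band !addrA.
have E (u v w : C) : u + (u^*)%C + v + (v^*)%C + w + (w^*)%C = (u + (u^*)%C) + (v + (v^*)%C) + (w + (w^*)%C).
  by rewrite !addrA.
rewrite E !add_conj /rC -!rmorphD /=; congr Complex; ring.
Qed.

Lemma eigen_chi k x : \sum_(y | nbr x y) chi k y = rC (band k) * chi k x.
Proof.
rewrite sum_nbr // -sum_dirs_chi mulr_suml; apply: eq_bigr => d _.
by rewrite chiD mulrC.
Qed.

Lemma rC_inj : injective (@rC R).
Proof. by move=> a c /(congr1 (@complex.Re R)). Qed.

(** The trace of the hopping matrix, which vanishes because no site is its own neighbour. It
    converts filled momenta into omitted ones. *)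
Lemma sum_band : \sum_k band k = 0.
Proof.
apply: rC_inj; rewrite /rC rmorph_sum /=.
rewrite (eq_bigr (fun k => \sum_(d <- dirs L) chi k d)); last by move=> k _; rewrite sum_dirs_chi.
rewrite exchange_big /= big_seq big1 // => d hd.
have d0 : (0, 0) != d.
  apply: contraTneq hd => <-; have := nbr_irrefl ((0, 0) : site L).
  by rewrite /nbr /= !subrr => h; rewrite /dirs h.
have o := orth (0, 0) d; rewrite (negbTE d0) mul0r in o; rewrite -[RHS]o; apply: eq_bigr => k _.
by rewrite chiC [chi (0,0) k]chiC chi0 conj_one mul1r.
Qed.

End Fourier.

(** * The cost of the omitted low momenta *)

Section LowMomenta.
Variables (R : realType) (n : nat).
Local Notation L := n.+3.
Local Notation C := R[i].
Local Notation w := (wv R n).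
Local Notation z := (zeta R n).

Lemma zeta_natr (m : nat) : z ^+ ((m%:R)%R : 'Z_L) = ex (w * m%:R).
Proof. by rewrite exX -/z val_Zp_nat // zeta_mod. Qed.

Lemma zeta_sub (a c : nat) : z ^+ ((a%:R - c%:R)%R : 'Z_L) = ex (w * (a%:R - c%:R)).
Proof.
have h : z ^+ ((a%:R - c%:R)%R : 'Z_L) * z ^+ ((c%:R)%R : 'Z_L) = z ^+ ((a%:R)%R : 'Z_L).
  rewrite -exprD -[LHS]zeta_mod; congr (z ^+ _).
  by rewrite -[in RHS](subrK (c%:R : 'Z_L) (a%:R)).
rewrite mulrBr exD exN; rewrite !zeta_natr in h.
rewrite -h -mulrA.
have := zeta_conj R n c; rewrite -exX => h2.
by rewrite [X in _ = _ * X]mulrC h2 mulr1.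
Qed.

Definition box (c a b : nat) : site L := ((a%:R - c%:R : 'Z_L), (b%:R - c%:R : 'Z_L)).

(** Times [wv^2], the second-order Taylor term of [6 - band] at zero momentum, evaluated at
    [box c a b]. *)
Definition quad (c a b : nat) : R := (a%:R - c%:R) ^+ 2 + (b%:R - c%:R) ^+ 2 + (a%:R - b%:R) ^+ 2.

Lemma band_box c a b : 6 - band R (box c a b) <= w ^+ 2 * quad c a b.
Proof.
rewrite /band /box /= !zeta_sub -exN -exD -mulrBr /=.
have -> : a%:R - c%:R - (b%:R - c%:R) = a%:R - b%:R :> R by ring.
have c2 t : 2 - 2 * cos (w * t) <= w ^+ 2 * t ^+ 2.
  have := cos_ge (w * t); rewrite exprMn; move: (w ^+ 2 * t ^+ 2) (cos _) => A u; lra.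
have -> : w ^+ 2 * quad c a b = w ^+ 2 * (a%:R - c%:R) ^+ 2 + w ^+ 2 * (b%:R - c%:R) ^+ 2
    + w ^+ 2 * (a%:R - b%:R) ^+ 2.
  by rewrite /quad; move: (w ^+ 2) => W; ring.
move: (c2 (a%:R - c%:R)) (c2 (b%:R - c%:R)) (c2 (a%:R - b%:R)).
move: (w ^+ 2 * (a%:R - c%:R) ^+ 2) (w ^+ 2 * (b%:R - c%:R) ^+ 2) (w ^+ 2 * (a%:R - b%:R) ^+ 2) => A1 A2 A3.
move: (cos (w * (a%:R - c%:R))) (cos (w * (b%:R - c%:R))) (cos (w * (a%:R - b%:R))) => u1 u2 u3 h1 h2 h3; lra.
Qed.

Lemma band_le6 k : band R (k : site L) <= 6.
Proof.
rewrite /band.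
have r (m : nat) : complex.Re (z ^+ m) <= 1 by rewrite -exX; exact: cos_le1.
have r2 (m m' : nat) : complex.Re (z ^+ m * ((z ^+ m')^*)%C) <= 1.
  by rewrite -!exX -exN -exD; exact: cos_le1.
have := r k.1; have := r k.2; have := r2 k.1 k.2; lra.
Qed.

Lemma sum_id s : \sum_(i < s) (i%:R : R) = s%:R * (s%:R - 1) / 2.
Proof.
elim: s => [|s ih]; first by rewrite big_ord0 !mul0r.
by rewrite big_ord_recr /= ih -natr1; field.
Qed.

Lemma sum_sq s : \sum_(i < s) (i%:R ^+ 2 : R) = s%:R * (s%:R - 1) * (2 * s%:R - 1) / 6.
Proof.
elim: s => [|s ih]; first by rewrite big_ord0 !mul0r.
by rewrite big_ord_recr /= ih -natr1; field.
Qed.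

Lemma sum_quad s c : \sum_(i < s) \sum_(j < s) quad c i j =
  2 * s%:R * (s%:R * (s%:R - 1) * (2 * s%:R - 1) / 6 - c%:R * (s%:R * (s%:R - 1)) + s%:R * c%:R ^+ 2)
  + s%:R ^+ 2 * (s%:R ^+ 2 - 1) / 6.
Proof.
have S1 := sum_id s; have S2 := sum_sq s.
have c1 (k : R) : \sum_(i < s) k = s%:R * k by rewrite sumr_const card_ord mulr_natl.
have q i : \sum_(j < s) quad c i j = s%:R * (2 * i%:R ^+ 2 - 2 * c%:R * i%:R + 2 * c%:R ^+ 2)
    + 2 * \sum_(j < s) (j%:R ^+ 2 : R) - (2 * c%:R + 2 * i%:R) * \sum_(j < s) (j%:R : R).
  rewrite !mulr_sumr -c1 -big_split -sumrB; apply: eq_bigr => j _ /=; rewrite /quad; ring.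
rewrite (eq_bigr _ (fun (i : 'I_s) _ => q i)) sumrB big_split /= c1 -mulr_sumr -mulr_suml.
rewrite !(big_split, sumrB, sumrN) /= -!mulr_sumr !c1 S1 S2.
by field.
Qed.

Lemma box_inj (c a b a' b' : nat) : (a < L)%N -> (b < L)%N -> (a' < L)%N -> (b' < L)%N ->
  box c a b = box c a' b' -> (a, b) = (a', b').
Proof.
move=> la lb la' lb' [] h1 h2.
have i1 : (a%:R : 'Z_L) = a'%:R by rewrite -[LHS](subrK c%:R) -[RHS](subrK c%:R); congr (_ + _); apply: val_inj.
have i2 : (b%:R : 'Z_L) = b'%:R by rewrite -[LHS](subrK c%:R) -[RHS](subrK c%:R); congr (_ + _); apply: val_inj.
move/(congr1 (fun u : 'Z_L => nat_of_ord u)): i1; move/(congr1 (fun u : 'Z_L => nat_of_ord u)): i2.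
by rewrite !val_Zp_nat // !modn_small // => -> ->.
Qed.


(* The momenta of an s * s box centred at c are used, minus the best ones: h
   points chosen among s^2 carry at most the fraction (h-1)/(s^2-1) of the total
   because the centre contributes 0. *)
Lemma momentum_count (s h : nat) : (1 < s)%N -> ((s.-1) ^ 2 < h)%N -> (h <= s ^ 2)%N ->
  exists c : nat, (c < s)%N /\
  (h%:R - 1) * \sum_(i < s) \sum_(j < s) quad c i j <= 11 / 20 * h%:R ^+ 2 * (s%:R ^+ 2 - 1).
Proof.
move=> s1 hlow hup; exists (s.-1./2); split; first by rewrite -divn2; lia.
rewrite sum_quad.
have s2 : 2 <= s%:R :> R by rewrite ler_nat.
have hl : (s%:R - 1) ^+ 2 + 1 <= h%:R :> R.
  have -> : s%:R - 1 = s.-1%:R :> R by rewrite -{1}(prednK (ltnW s1)) -natr1 addrK.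
  by rewrite -natrX natr1 ler_nat.
have par : (2 * (s.-1./2)%:R = s%:R - 1 :> R) \/ (2 * (s.-1./2)%:R = s%:R - 2 :> R /\ s != 3).
  have e := odd_double_half s.-1.
  case o : (odd s.-1) e => e.
    right; split; last by apply: contraTneq o => ->.
    have -> : s%:R = 2 * (s.-1./2)%:R + 2 :> R by rewrite -natrM -natrD; congr (_%:R); lia.
    by rewrite addrK.
  left; have -> : s%:R = 2 * (s.-1./2)%:R + 1 :> R by rewrite -natrM -[1]/(1%:R) -natrD; congr (_%:R); lia.
  by rewrite addrK.
set c : R := (s.-1./2)%:R in par *.
(* The ratio of the two sides without the factor [11/20] tends to [1/3] for large boxes. Small boxes
   dictate the constant, [s = 4] and [h = 10] being the tightest, and require separate cases. *)
have s3 : s%:R = 2 :> R \/ s%:R = 3 :> R \/ 4 <= s%:R :> R.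
  have : s = 2%N \/ s = 3%N \/ (4 <= s)%N by lia.
  by case=> [->|[->|h4]]; [left|right; left|right; right; rewrite ler_nat].
have ne3 : s != 3 -> s%:R != 3 :> R by rewrite eqr_nat.
set S : R := s%:R in s2 hl par s3 ne3 *; set H : R := h%:R in hl *.
(* The first term is the sum about the exact centre. For even [s] that centre is half-integral, and
   moving it to a lattice point costs [S^2 / 2]. *)
have G : 2 * S * (S * (S - 1) * (2 * S - 1) / 6 - c * (S * (S - 1)) + S * c ^+ 2) + S ^+ 2 * (S ^+ 2 - 1) / 6
   = S ^+ 2 * (S ^+ 2 - 1) / 3 + (if c == (S - 1) / 2 then 0 else S ^+ 2 / 2).
  case: eqVneq => [->|ne]; first by field.
  have -> : c = (S - 2) / 2 by case: par => [p|[p _]]; [case/negP: ne; apply/eqP; lra|lra].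
  by field.
rewrite G {G}.
have hle : (if c == (S - 1) / 2 then 0 else S ^+ 2 / 2) <= S ^+ 2 / 2 :> R.
  by case: ifP => _ //; have := sqr_ge0 S; lra.
case: s3 => [S2|[S3|S4]].
- rewrite S2 in hle hl *.
  have : (H - 1) * (2 ^+ 2 * (2 ^+ 2 - 1) / 3 + (if c == (2 - 1) / 2 then 0 else 2 ^+ 2 / 2)) <= (H - 1) * 6.
    move: (if _ then _ else _) hle => I hle; apply: ler_wpM2l; first by lra.
    by rewrite expr2; rewrite expr2 in hle; lra.
  (* [20/11] is the vertex of the quadratic [33/20 H^2 - 6 H + 6], which is positive. *)
  move=> u; apply: le_trans u _; have := sqr_ge0 (H - 20 / 11); nra.
- have E : c = (S - 1) / 2.
    case: par => [p|[_ p]]; first lra.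
    by have := ne3 p; rewrite S3 eqxx.
  rewrite E eqxx addr0 S3 in hl *.
  have : 0 <= (H - 5) * (H - 5 / 11) by apply: mulr_ge0; lra.
  nra.
(* [H - 1 >= (S - 1)^2] bounds the left side by [(H - 1)^2 + 2 (H - 1) = H^2 - 1]. *)
- have key : (H - 1) * ((S - 1) ^+ 2 + 2) <= H ^+ 2.
    have : 0 <= (H - 1) * (H - 1 - (S - 1) ^+ 2) by apply: mulr_ge0; have := sqr_ge0 (S - 1); lra.
    by nra.
  have H1 : 0 <= H - 1 by have := sqr_ge0 (S - 1); lra.
  have P : S ^+ 2 * (S ^+ 2 - 1) / 3 + S ^+ 2 / 2 <= 11 / 20 * ((S - 1) ^+ 2 + 2) * (S ^+ 2 - 1).
    have S16 : 16 <= S ^+ 2 by nra.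
    have a1 : S ^+ 2 / 2 <= 8 / 15 * (S ^+ 2 - 1) by lra.
    have a2 : S ^+ 2 / 3 + 8 / 15 <= 11 / 20 * ((S - 1) ^+ 2 + 2).
      have : 0 <= (S - 4) * (13 * S - 14) by apply: mulr_ge0; lra.
      by nra.
    have : (S ^+ 2 / 3 + 8 / 15) * (S ^+ 2 - 1) <= 11 / 20 * ((S - 1) ^+ 2 + 2) * (S ^+ 2 - 1).
      by apply: ler_wpM2r a2; lra.
    lra.
  apply: le_trans (_ : (H - 1) * (11 / 20 * ((S - 1) ^+ 2 + 2) * (S ^+ 2 - 1)) <= _).
    move: (if _ then _ else _) hle => I hle; apply: (ler_wpM2l H1); apply: le_trans P; lra.
  have : (H - 1) * ((S - 1) ^+ 2 + 2) * (S ^+ 2 - 1) <= H ^+ 2 * (S ^+ 2 - 1).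
    by apply: ler_wpM2r key; nra.
  lra.
Qed.

(** The prefactor is the [11/20] of [momentum_count] times [wv^2 L^2 = 4 pi^2]. *)
Lemma low_momenta h : (h <= L * L)%N ->
  exists2 Y : {set site L}, #|Y| = h & L%:R ^+ 2 * \sum_(k in Y) (6 - band R k) <= (11 / 5 * pi ^+ 2) * h%:R ^+ 2.
Proof.
move=> hL; have [->|h0] := posnP h.
  by exists set0; rewrite ?cards0 // big_set0 mulr0 expr0n /= mulr0.
(* The smallest box with at least [h] points; minimality of its side yields [(s - 1)^2 < h]. *)
have ex_s : exists s, (h <= s ^ 2)%N by exists L; rewrite expnS expn1.
case: (ex_minnP ex_s) => s hs smin.
have sL : (s <= L)%N by apply: smin; rewrite expnS expn1.
have s0 : (0 < s)%N by case: s hs {smin sL} => //; rewrite leqNgt h0.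
have hlow : ((s.-1) ^ 2 < h)%N.
  by rewrite ltnNge; apply/negP => /smin; rewrite leqNgt prednK ?leqnn.
have z00 : band R ((0, 0) : site L) = 6.
  apply/le_anti; rewrite band_le6 /=; have := band_box 0 0 0.
  by rewrite /quad /box !subrr expr0n /= !addr0 mulr0 subr_le0.
have [s1|s1] := ltnP 1 s; last first.
  have sE : s = 1%N by apply/eqP; rewrite eqn_leq s1.
  have hE : h = 1%N by apply/eqP; rewrite eqn_leq h0 andbT; rewrite sE in hs.
  exists [set (0, 0)]; first by rewrite cards1.
  rewrite big_set1 z00 subrr mulr0; apply: mulr_ge0; last exact: sqr_ge0.
  by apply: mulr_ge0; [lra|exact: sqr_ge0].
have [c [cs key]] := momentum_count s1 hlow hs.
pose bx (p : 'I_s * 'I_s) := box c p.1 p.2.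
have bx_inj : injective bx.
  move=> [i j] [i' j'] /box_inj /= h'; have lt (k : 'I_s) : (k < L)%N := leq_trans (ltn_ord k) sL.
  by have [e1 e2] := h' (lt _) (lt _) (lt _) (lt _); congr (_, _); apply: val_inj.
pose S := [set bx p | p : 'I_s * 'I_s].
pose F k := 6 - band R (k : site L).
have F0 k : 0 <= F k by rewrite subr_ge0 band_le6.
have cardS : #|S| = (s ^ 2)%N by rewrite card_imset // card_prod card_ord expnS expn1.
have zS : (0, 0) \in S.
  apply/imsetP; exists (Ordinal cs, Ordinal cs) => //.
  by rewrite /bx /box /= !subrr.
have cardS0 : #|S :\ (0, 0)| = (s ^ 2).-1 by have := cardsD1 (0, 0) S; rewrite zS cardS => ->.
have [|Y0 /andP[Y0S /eqP Y0h] hY] := @pick_low _ _ F (S :\ (0, 0)) h.-1.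
  by rewrite cardS0 -!subn1 leq_sub2r.
have z0 : (0, 0) \notin Y0 by apply/negP => /(fintype.subsetP Y0S); rewrite !inE eqxx.
exists ((0, 0) |: Y0); first by rewrite cardsU1 z0 Y0h add1n prednK.
have sumY : \sum_(k in (0, 0) |: Y0) (6 - band R k) = \sum_(k in Y0) F k.
  by rewrite big_setU1 //= z00 subrr add0r.
have sumS : \sum_(k in S :\ (0, 0)) F k <= w ^+ 2 * \sum_(i < s) \sum_(j < s) quad c i j.
  have -> : \sum_(k in S :\ (0, 0)) F k = \sum_(k in S) F k.
    by rewrite [RHS](big_setD1 _ zS) /= /F z00 subrr add0r.
  rewrite big_imset /=; last by move=> ? ? _ _; exact: bx_inj.
  rewrite pair_bigA /= mulr_sumr; apply: ler_sum => p _; exact: band_box.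
rewrite sumY.
have Spos : 0 < s%:R ^+ 2 - 1 :> R.
  have : 2 <= s%:R :> R by rewrite ler_nat.
  by nra.
have e1 : ((s ^ 2).-1)%:R = s%:R ^+ 2 - 1 :> R by rewrite -natrX -[in RHS](prednK (_ : 0 < s ^ 2)%N) ?expn_gt0 ?s0 // -natr1 addrK.
have e2 : (h.-1)%:R = h%:R - 1 :> R by rewrite -[in RHS](prednK h0) -natr1 addrK.
rewrite cardS0 e1 e2 in hY.
have h1 : 0 <= h%:R - 1 :> R by rewrite subr_ge0 ler1n.
have w0 : 0 <= w ^+ 2 by exact: sqr_ge0.
have b1 : (s%:R ^+ 2 - 1) * \sum_(k in Y0) F k <= w ^+ 2 * (11 / 20 * h%:R ^+ 2 * (s%:R ^+ 2 - 1)).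
  apply: le_trans hY _; apply: le_trans (ler_wpM2l h1 sumS) _.
  by rewrite mulrCA; exact: ler_wpM2l.
have b2 : \sum_(k in Y0) F k <= w ^+ 2 * (11 / 20 * h%:R ^+ 2).
  by rewrite -(ler_pM2l Spos); apply: le_trans b1 _; rewrite le_eqVlt; apply/orP; left; apply/eqP; ring.
have L2 : 0 <= (L%:R : R) ^+ 2 by exact: sqr_ge0.
apply: le_trans (ler_wpM2l L2 b2) _; rewrite /wv.
have L0 : (L%:R : R) != 0 by rewrite pnatr_eq0.
rewrite le_eqVlt; apply/orP; left; apply/eqP.
by move: L0; move: (L%:R : R) => l l0; field.
Qed.

End LowMomenta.

Lemma opp_opp_terms (V : zmodType) (a b c : V) : a - - b + (0 - - c) = a + (b + c).
Proof. by rewrite sub0r !opprK addrA. Qed.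

(** * Spin-polarized Slater determinants as trial states *)

Section Slater.
Variables (R : realType) (n : nat).
Local Notation L := n.+3.
Variables (B : rel (site L)) (mu : R).
Hypotheses (hB : is_bond_set B).
Local Notation C := R[i].
Local Notation st := (state R B).
Implicit Types (x y k : site L) (p q : st) (z : lam B).

Let hL : (2 < L)%N := isT.

Definition plane k : lam B -> C := fun z => \sum_x (L%:R^-1 * chi R k x) * orb_a mu x z.

Lemma cre_conj f s p q : inner p (cre f s q) = inner (ann (fun z => ((f z)^*)%C) s p) q.
Proof.
rewrite inner_sumr inner_suml; apply: eq_bigr => z _.
by rewrite innerZr inner_cdag innerZl conjcK.
Qed.

Lemma orb_plane x k : \sum_z orb_a mu x z * plane k z = L%:R^-1 * chi R k x.
Proof.
rewrite (eq_bigr (fun z => \sum_y (L%:R^-1 * chi R k y) * (orb_a mu x z * orb_a mu y z))); last first.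
  by move=> z _; rewrite mulr_sumr; apply: eq_bigr => y _; rewrite mulrCA.
rewrite exchange_big /= (bigD1 x) //= [X in _ + X]big1 => [|y yx].
  by rewrite -mulr_sumr (orb_aa mu hL hB) eqxx mulr1 addr0.
by rewrite -mulr_sumr (orb_aa mu hL hB) eq_sym (negbTE yx) mulr0.
Qed.

Lemma conj_plane k z : ((plane k z)^*)%C = \sum_x (L%:R^-1 * ((chi R k x)^*)%C) * orb_a mu x z.
Proof.
rewrite /plane (rmorph_sum (@conjc R)) /=; apply: eq_bigr => x _.
by rewrite !conjCM real_orb_a conjc_inv conj_nat.
Qed.

Lemma plane_orth k k' : \sum_z ((plane k z)^*)%C * plane k' z = (k == k')%:R.
Proof.
rewrite (eq_bigr (fun z => \sum_x (L%:R^-1 * ((chi R k x)^*)%C) * (orb_a mu x z * plane k' z))); last first.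
  by move=> z _; rewrite conj_plane mulr_suml; apply: eq_bigr => x _; rewrite mulrA.
rewrite exchange_big /= (eq_bigr (fun x => (L%:R^-1 * L%:R^-1) * (((chi R k x)^*)%C * chi R k' x))); last first.
  by move=> x _; rewrite -mulr_sumr orb_plane mulrACA.
rewrite -mulr_sumr orth mulrCA mulrACA mulVf ?mulr1 // pnatr_eq0 //.
Qed.

Lemma perp_plane (f : lam B -> C) k : (forall x, \sum_z f z * orb_a mu x z = 0) -> \sum_z f z * plane k z = 0.
Proof.
move=> h; rewrite (eq_bigr (fun z => \sum_x (L%:R^-1 * chi R k x) * (f z * orb_a mu x z))); last first.
  by move=> z _; rewrite mulr_sumr; apply: eq_bigr => x _; rewrite mulrCA.
by rewrite exchange_big big1 // => x _; rewrite -mulr_sumr h mulr0.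
Qed.

Definition vac : st := [ffun T : basis B => (T == set0)%:R].

Lemma cop_vac m : cop m vac = 0.
Proof.
apply/ffunP => T; rewrite !ffunE; case: ifP => // _.
by rewrite (_ : (m |: T == set0) = false) ?mulr0 //; apply/negP => /eqP /setP /(_ m); rewrite !inE eqxx.
Qed.

Lemma ann_vac f s : ann f s vac = 0.
Proof. by rewrite /ann big1 // => z _; rewrite cop_vac; exact: scaler0. Qed.

(** All spins are up, which excludes double occupancy; the plane waves are built from the [orb_a],
    which excludes bond energy. *)
Definition slater (K : seq (site L)) : st := foldr (fun k p => cre (plane k) true p) vac K.

Lemma cop_cre_down z f p : cop (z, false) (cre f true p) = - cre f true (cop (z, false) p).
Proof.
rewrite /cre cop_sum -sumrN; apply: eq_bigr => w _.
by rewrite copZ cop_cdag_at andbF scale0r sub0r; exact: scalerN.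
Qed.

Lemma slater_down K z : cop (z, false) (slater K) = 0.
Proof.
elim: K => [|k K ih]; first exact: cop_vac.
by rewrite [slater _]/= cop_cre_down ih cre_0; exact: oppr0.
Qed.

Lemma ann_slater f s K : (forall k, k \in K -> \sum_z f z * plane k z = 0) -> ann f s (slater K) = 0.
Proof.
elim: K => [|k K ih] h; first exact: ann_vac.
rewrite [slater _]/= ann_cre h ?mem_head // mulr0 scale0r ih ?cre_0 ?subrr //.
by move=> k' k'K; apply: h; rewrite inE k'K orbT.
Qed.

Lemma slater_fin K : fin mu (slater K).
Proof.
split=> [b s|b s|z].
- by apply: ann_slater => k _; apply: perp_plane => x; exact: orb_ua.
- by apply: ann_slater => k _; apply: perp_plane => x; exact: orb_ubara.
- by rewrite slater_down cop_0.
Qed.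

Lemma slater_norm K : uniq K -> inner (slater K) (slater K) = 1.
Proof.
elim: K => [_|k K ih /andP[kK uK]].
  rewrite /inner (bigD1 set0) //= big1 ?addr0; last by move=> T /negbTE T0; rewrite !ffunE T0 mulr0.
  by rewrite !ffunE eqxx mulr1; exact: conj_one.
rewrite [slater _]/= cre_conj ann_cre plane_orth !eqxx /= mulr1 scale1r.
rewrite ann_slater ?cre_0 ?subr0 ?ih // => k' k'K.
by rewrite plane_orth; case: eqVneq => // e; move: kK; rewrite e k'K.
Qed.

Lemma cre_electron f s m p : n_electron m p -> n_electron m.+1 (cre f s p).
Proof.
move=> h T hT; rewrite /cre sum_ffunE big1 // => z _; rewrite !ffunE; case: ifP => zT; last exact: mulr0.
have -> : p (T :\ (z, s)) = 0.
  by apply: h; move: hT; rewrite (cardsD1 (z, s) T) zT add1n eqSS.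
by rewrite mulr0; exact: mulr0.
Qed.

Lemma slater_electron K : n_electron (size K) (slater K).
Proof.
elim: K => [|k K ih]; last exact: cre_electron.
by move=> T; rewrite cards_eq0 ffunE => /negbTE ->.
Qed.

Lemma cre_anticomm f g s t p : cre f s (cre g t p) = - cre g t (cre f s p).
Proof.
rewrite {1}/cre (eq_bigr (fun z => \sum_w f z *: (g w *: cdag (z, s) (cdag (w, t) p)))); last first.
  by move=> z _; rewrite cdag_sum scaler_sumr; apply: eq_bigr => w _; rewrite cdagZ.
rewrite exchange_big -sumrN; apply: eq_bigr => z _.
rewrite cdag_sum scaler_sumr -sumrN; apply: eq_bigr => w _.
by rewrite cdagZ cdag_anticomm !scalerN !scalerA mulrC.
Qed.

Lemma hop_cre x y k p :
  hop mu x y (cre (plane k) true p) =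
  (L%:R^-1 * chi R k y) *: cre (orb_a mu x) true p + cre (plane k) true (hop mu x y p).
Proof.
rewrite /hop cre_sum !big_bool !ann_cre orb_plane /= mul1r mul0r scale0r.
rewrite !creB creZ cre_0 !(cre_anticomm (orb_a mu x) (plane k)).
exact: opp_opp_terms.
Qed.

Lemma sum_cre (c : site L -> C) k p : (forall x, c x = rC (band R k) * (L%:R^-1 * chi R k x)) ->
  \sum_x c x *: cre (orb_a mu x) true p = rC (band R k) *: cre (plane k) true p.
Proof.
move=> hc; rewrite /cre /plane scaler_sumr.
rewrite (eq_bigr (fun x => \sum_z (c x * orb_a mu x z) *: cdag (z, true) p)); last first.
  by move=> x _; rewrite scaler_sumr; apply: eq_bigr => z _; rewrite scalerA.
rewrite exchange_big; apply: eq_bigr => z _ /=.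
rewrite scalerA mulr_sumr scaler_suml; apply: eq_bigr => x _.
by rewrite hc !mulrA.
Qed.

(** The commutator of a one-body operator with the creator of one of its eigenmodes is the
    eigenvalue times that creator. *)
Lemma kin_cre k p : kin mu (cre (plane k) true p) =
  rC (band R k) *: cre (plane k) true p + cre (plane k) true (kin mu p).
Proof.
rewrite /kin cre_sum -(@sum_cre (fun x => \sum_(y | nbr x y) L%:R^-1 * chi R k y)).
  rewrite -big_split; apply: eq_bigr => x _ /=.
  rewrite cre_sum scaler_suml -big_split; apply: eq_bigr => y _.
  exact: hop_cre.
by move=> x; rewrite -mulr_sumr eigen_chi mulrCA.
Qed.

Lemma kin_slater K : kin mu (slater K) = rC (\sum_(k <- K) band R k) *: slater K.
Proof.
elim: K => [|k K ih].
  rewrite big_nil scale0r /kin big1 // => x _; rewrite big1 // => y _.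
  by rewrite /hop big1 // => s _; rewrite ann_vac cre_0.
rewrite [slater _]/= kin_cre ih creZ big_cons rCD.
by apply: esym; exact: scalerDl.
Qed.

Lemma trial (K : {set site L}) : exists chi : st,
  [/\ n_electron #|K| chi, fin mu chi, sqn chi = 1 & ev (kin mu) chi = \sum_(k in K) band R k].
Proof.
exists (slater (enum K)); have nrm := slater_norm (enum_uniq K).
split.
- by rewrite cardE; exact: slater_electron.
- exact: slater_fin.
- by rewrite /sqn nrm.
- by rewrite /ev kin_slater innerZr nrm mulr1 big_enum.
Qed.

End Slater.

(** * Connected components of the occupied set *)

Section Clusters.
Variable L : nat.
Hypothesis hL : (2 < L)%N.
Implicit Types (A G : {set site L}) (x y : site L).
Local Open Scope nat_scope.

Definition inside A x y := [&& nbr x y, x \in A & y \in A].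

(** These are the unions of connected components of [A]. *)
Definition isolated A G := (G \subset A) && [forall x in G, forall y in A :\: G, ~~ nbr x y].

Lemma isolated_sep A G : isolated A G -> separated G (A :\: G).
Proof.
move=> /andP[_ /forall_inP h] x y xG yA.
have /forall_inP := h x xG => /(_ y yA) -> /=.
by apply: contraTneq yA => <-; rewrite !inE xG.
Qed.

Lemma isolatedI A G G' : isolated A G -> isolated A G' -> isolated A (G :\: G').
Proof.
move=> /andP[GA /forall_inP h] /andP[GA' /forall_inP h']; apply/andP; split.
  by apply: fintype.subset_trans GA; exact: subsetDl.
apply/forall_inP => x; rewrite inE => /andP[xG' xG]; apply/forall_inP => y.
rewrite !inE negb_and negbK => /andP[/orP[yG'|yG] yA].
  rewrite nbr_sym; have /forall_inP := h' y yG'; apply.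
  by rewrite inE xG' (fintype.subsetP GA).
by have /forall_inP := h x xG; apply; rewrite inE yG.
Qed.

Definition component A x := [set y | connect (inside A) x y].

Lemma component_isolated A x : x \in A -> isolated A (component A x).
Proof.
move=> xA; have sub y : connect (inside A) x y -> y \in A.
  move/connectP => [p hp ->]; elim: p x xA hp => //= z p ih u uA /andP[/and3P[_ _ zA] hp].
  exact: (ih z).
apply/andP; split; first by apply/fintype.subsetP => y; rewrite inE; exact: sub.
apply/forall_inP => y; rewrite inE => xy; have yA := sub y xy; apply/forall_inP => z; rewrite !inE => /andP[nz zA].
apply: contra nz => yz; apply: connect_trans xy _; apply: connect1.
by rewrite /inside yz zA yA.
Qed.

(* A minimal isolated set with more than b elements is almost a single component. *)
Lemma large_component A b : 3 * b < #|A| ->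
  (forall G, isolated A G -> #|G| <= b \/ #|A :\: G| <= b) ->
  exists2 x, x \in A & #|A :\: component A x| <= b.
Proof.
move=> hb hiso.
have AA : isolated A A && (b < #|A|).
  apply/andP; split; last by lia.
  apply/andP; split=> //; apply/forall_inP => x _; apply/forall_inP => y.
  by rewrite inE => /andP[/negP h /h].
case: (@arg_minnP _ A (fun G => isolated A G && (b < #|G|)) (fun G : {set site L} => #|G|) AA) => G /andP[Giso Gb] Gmin.
have [x xG] : exists x, x \in G by apply/set0Pn; rewrite -card_gt0; apply: leq_ltn_trans Gb.
have xA : x \in A by case/andP: Giso => GA _; exact: (fintype.subsetP GA _ xG).
have Ciso := component_isolated xA.
exists x => //.
(* Were the component small, then so would be [A :\: G], as [G] is big, and [G] without the
   component, by minimality. These three sets cover [A], which has more than [3 b] elements. *)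
have [small|//] := hiso _ Ciso.
have Diso := isolatedI Giso Ciso.
have Gsmall : #|A :\: G| <= b by have [le|//] := hiso _ Giso; rewrite leqNgt Gb in le.
have Dsmall : #|G :\: component A x| <= b.
  rewrite leqNgt; apply/negP => big.
  have := Gmin (G :\: component A x); rewrite Diso big => /(_ isT).
  apply/negP; rewrite -ltnNge; apply: proper_card; apply/properP; split; first exact: subsetDl.
  by exists x => //; rewrite !inE connect0.
have c1 := cardsID G A; have c2 := cardsID (component A x) G.
have c3 : #|A :&: G| <= #|G| by apply: subset_leq_card; exact: subsetIr.
have c4 : #|G :&: component A x| <= #|component A x| by apply: subset_leq_card; exact: subsetIr.
exfalso; move: hb; apply/negP; rewrite -leqNgt -c1.
apply: leq_trans (leq_add c3 Gsmall) _; rewrite -c2.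
apply: leq_trans (leq_add (leq_add (leq_trans c4 small) Dsmall) (leqnn b)) _; lia.
Qed.
End Clusters.

(** * Exchange invariance along paths of occupied sites *)

Section SwapCluster.
Variables (R : realType) (L : nat) (B : rel (site L)) (mu : R).
Hypotheses (hL : (2 < L)%N) (hB : is_bond_set B) (hmu : 0 < mu).
Local Notation omode := (site L * bool)%type.
Variables (n : nat) (psi : state R B) (hf : fin mu psi) (f0 : {ffun 'I_n -> omode}).
Implicit Types (f : {ffun 'I_n -> omode}) (i j k : 'I_n).
Local Notation w := (@amp R L B mu n psi).
Let X i := (f0 i).1.
Hypothesis Xinj : injective X.
Let same f := [forall k, (f k).1 == (f0 k).1].
Let good i j := i = j \/ (forall f, same f -> w (swap_spin i j f) = w f).

(** Conjugating one transposition by another extends invariance from neighbours to any two electrons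
    of a connected cluster. *)
Lemma swap_spin_conj i j k f : i != j -> j != k -> i != k ->
  swap_spin i k f = swap_spin i j (swap_spin j k (swap_spin i j f)).
Proof.
move=> ij jk ik; apply/ffunP => l; rewrite !ffunE /=; congr (_, (f _).2).
have [ji kj ki] : [/\ j != i, k != j & k != i] by rewrite ![_ == i]eq_sym [k == j]eq_sym.
have [->|li] := eqVneq l i; first by rewrite !tpermL tpermD.
have [->|lj] := eqVneq l j.
  by rewrite tpermR [tperm i k j]tpermD // [tperm j k i]tpermD // tpermL.
have [->|lk] := eqVneq l k.
  by rewrite tpermR [tperm i j k]tpermD // tpermR tpermR.
by rewrite !tpermD // eq_sym.
Qed.

Lemma good_trans i j k : good i j -> good j k -> good i k.
Proof.
move=> [->//|gij] [<-|gjk]; first by right.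
have [->|ik] := eqVneq i k; first by left.
have [e|ij] := eqVneq i j; first by right; rewrite e.
have [e|jk] := eqVneq j k; first by right; rewrite -e.
right=> f sf; rewrite (swap_spin_conj f ij jk ik).
have st a c g : same g -> same (swap_spin a c g).
  by move=> /forallP sg; apply/forallP => l; rewrite ffunE; exact: sg.
have s1 := st i j _ sf; have s2 := st j k _ s1.
by rewrite (gij _ s2) (gjk _ s1) (gij _ sf).
Qed.

Lemma good_component i j : connect (inside [set X l | l : 'I_n]) (X i) (X j) -> good i j.
Proof.
move/connectP => [p]; elim: p i => [|y p ih] i /=.
  by move=> _ e; left; apply: Xinj.
move=> /andP[/and3P[xy _ /imsetP[k _ yk]] hp] hj; subst y.
apply: (@good_trans i k); last exact: ih.
right=> f /forallP sf; apply: (amp_swap hL hB hmu hf).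
  by apply: contraTneq xy => ->; rewrite nbr_irrefl.
by rewrite (eqP (sf i)) (eqP (sf k)).
Qed.
End SwapCluster.

(** * Fractional powers and the closing inequalities *)

Lemma powR_quarter (R : realType) (nu : R) : 0 < nu < 1 ->
  exists r : R, [/\ 0 < r, r < 1, r ^+ 2 = 1 - nu & ((1 - nu) `^ (4^-1)) ^+ 2 = r].
Proof.
move=> /andP[n0 n1]; have a0 : 0 < 1 - nu by rewrite subr_gt0.
pose q := (1 - nu) `^ (4^-1).
have q0 : 0 < q by exact: powR_gt0.
have q4 : q ^+ 4 = 1 - nu.
  by rewrite -powR_mulrn ?(ltW q0) // /q -powRrM mulVf ?powRr1 ?(ltW a0) // pnatr_eq0.
exists (q ^+ 2); split=> //; first exact: exprn_gt0.
- rewrite ltNge; apply/negP => h.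
  have : 1 <= (q ^+ 2) ^+ 2 by apply: exprn_ege1.
  by rewrite -exprM q4; lra.
- by rewrite -exprM q4.
Qed.

Lemma powR_three_quarters (R : realType) (m : nat) :
  (((m * m)%:R : R) `^ (3 / 4)) ^+ 2 = m%:R ^+ 3.
Proof.
pose b := ((m * m)%:R : R) `^ (3 / 4).
have b0 : 0 <= b by exact: powR_ge0.
have b4 : b ^+ 4 = (m%:R ^+ 3) ^+ 2.
  rewrite -powR_mulrn // /b -powRrM divfK ?pnatr_eq0 //.
  by rewrite powR_mulrn ?ler0n // natrM -expr2 -!exprM mulnC.
by apply/eqP; rewrite -/b -(eqrXn2 (n := 2)) ?exprn_ge0 ?ler0n // -exprM b4.
Qed.

(** With [k = N - m] the lower bound equals [N/2 (N/2 + 1) - 2 m N + m (m + 1)]. The loss [2 m N] is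
    below [(1 - nu) N^2 / 7], while [(1 - nu)(1 + nu) N^2 / 4] is available; [3/28 = 1/4 - 1/7]. *)
Lemma spin_contradiction (R : realFieldType) (N m k lam0 nu S : R) :
  0 < N -> 0 < nu < 1 -> 0 <= m -> k = N - m -> 14 * m < (1 - nu) * N ->
  3 / 4 * N - 3 / 4 * (N * (N - 1)) + k * (k - 1) <= lam0 ->
  0 <= S -> S <= nu * (N / 2) -> lam0 = S * (S + 1) -> False.
Proof.
move=> N0 /andP[n0 n1] m0 -> hm hl S0 hS lE.
have h1 : S * (S + 1) <= nu * (N / 2) * (nu * (N / 2) + 1) by apply: ler_pM; lra.
have h2 : 14 * m * N <= (1 - nu) * N * N by rewrite ler_pM2r // ltW.
have h3 : 0 < (1 - nu) * (N * N) * (nu / 4 + 3 / 28) by apply: mulr_gt0; [apply: mulr_gt0; [lra|exact: mulr_gt0]|lra].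
have h4 : 0 < (1 - nu) * N by apply: mulr_gt0; lra.
have h5 : 0 <= m * m + m by apply: addr_ge0 => //; exact: mulr_ge0.
rewrite lE in hl; nra.
Qed.

Lemma le_excess (R : realFieldType) (u v w s : R) :
  0 < s -> (u - 6 * v) * s <= (- 6 * v + w) * s -> u <= w.
Proof. by move=> s0; rewrite ler_pM2r // => h; lra. Qed.

Lemma hole_count_bound (R : realFieldType) (p q u v : R) :
  u - p / 5 * q <= v -> 5 * (u - v) <= p * q.
Proof. by rewrite mulrAC; move: (p * q) => z h; lra. Qed.

Lemma excess_contradiction (R : realFieldType) (u v x : R) :
  u <= v -> 0 < u -> v <= 11 / 5 * (192 / 17) * x -> 25 * x <= u -> False.
Proof. lra. Qed.

(** [16 m <= 4 a^2 < r^2 l^2], and at least [7/8] of the sites are occupied; [16 * 7/8 = 14]. *)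
Lemma defect_bound (R : realFieldType) (r : R) (h N l b a m : nat) :
  (h + N = l * l)%N -> (8 * h <= l * l)%N -> (4 * b <= a ^ 2)%N -> (m <= b)%N ->
  0 < r -> 2 * a%:R < r * l%:R -> 14 * m%:R < r ^+ 2 * N%:R.
Proof.
move=> hN h8 b4 mb r0 ha.
have m16 : 16 * m%:R < r ^+ 2 * l%:R ^+ 2 :> R.
  have : (16 * m <= 4 * a ^ 2)%N by move: (a ^ 2)%N b4 => A; lia.
  rewrite -(ler_nat R) !natrM => u; apply: le_lt_trans u _.
  have -> : 4 * (a%:R * a%:R) = (2 * a%:R) ^+ 2 :> R by ring.
  rewrite -exprMn ltr_pXn2r // nnegrE; first by rewrite mulr_ge0.
  by rewrite mulr_ge0 // ltW.
have N78 : 7 * l%:R ^+ 2 <= 8 * N%:R :> R.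
  have : (7 * (l * l) <= 8 * N)%N by move: (l * l)%N hN h8 => A; lia.
  by rewrite -(ler_nat R) !natrM -expr2.
have := ler_wpM2l (sqr_ge0 r) N78; move: m16.
have -> : r ^+ 2 * (7 * l%:R ^+ 2) = 7 * (r ^+ 2 * l%:R ^+ 2) by ring.
have -> : r ^+ 2 * (8 * N%:R) = 8 * (r ^+ 2 * N%:R) by ring.
by move: (r ^+ 2 * l%:R ^+ 2) (r ^+ 2 * N%:R) => u v; lra.
Qed.

(** * Energy comparison, compact configurations and the conclusion *)

Section Final.
Variables (R : realType) (n : nat).
Local Notation L := n.+3.
Variables (B : rel (site L)) (mu : R).
Hypotheses (hB : is_bond_set B) (hmu : 0 < mu).
Local Notation st := (state R B).
Let hL : (2 < L)%N := isT.

(** Fills the complement of the [h] momenta [Y]. As all bands sum to zero, the energy is minus the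
    sum of [band] over [Y], that is [- 6 h] plus the excess [dE]. *)
Lemma trial_energy h N : (h + N = L * L)%N -> exists (chi : st) (dE : R),
  [/\ n_electron N chi, fin mu chi, sqn chi = 1,
      ev (kin mu) chi = - 6 * h%:R + dE & L%:R ^+ 2 * dE <= 11 / 5 * (192 / 17) * h%:R ^+ 2].
Proof.
move=> hN; have [|Y Yh YE] := @low_momenta R n h; first by rewrite -hN leq_addr.
have [chi [c1 c2 c3 c4]] := trial mu hB (~: Y).
have cN : #|~: Y| = N by have := cardsC Y; rewrite Yh (card_site hL) -hN => /eqP; rewrite eqn_add2l => /eqP.
rewrite cN in c1.
exists chi, (\sum_(k in Y) (6 - band R k)); split=> //.
  rewrite c4 sumrB sumr_const Yh -[_ *+ h]mulr_natr.
  have := sum_band R n; rewrite (bigID (mem Y)) /=.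
  rewrite [X in _ + X](eq_bigl (mem (~: Y))); last by move=> k; rewrite !inE.
  move: (\sum_(k in Y) band R k) (\sum_(k in ~: Y) band R k) => u v; lra.
apply: le_trans YE _; apply: ler_wpM2r; first exact: sqr_ge0.
by apply: ler_wpM2l; [lra|exact: pi_sqr_le].
Qed.

Lemma compact_config N (phi1 : st) (r : R) h : (h + N = L * L)%N -> (0 < N)%N -> 0 < r -> r < 1 ->
  25 * h%:R ^+ 2 <= r * L%:R ^+ 3 -> 0 < sqn phi1 -> n_electron N phi1 -> fin mu phi1 ->
  (forall chi : st, n_electron N chi -> fin mu chi -> ev (kin mu) phi1 * sqn chi <= ev (kin mu) chi * sqn phi1) ->
  exists2 f : {ffun 'I_N -> site L * bool}, amp mu phi1 f != 0 & (adjacency (holes f))%:R < r * L%:R.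
Proof.
move=> hN; case: N hN => // N hN _ r0 r1 hH s0 ne hf hmin.
apply: contrapT => hno.
have all_f (f : {ffun 'I_N.+1 -> site L * bool}) : amp mu phi1 f != 0 -> r * L%:R <= (adjacency (holes f))%:R.
  by move=> wf; rewrite leNgt; apply/negP => lt; apply: hno; exists f.
(* [m] becomes the least integer above [r L], because adjacency counts are integers; [L] witnesses
   existence since [r < 1]. *)
have exm : exists m, r * L%:R <= m%:R by exists L; rewrite ler_piMl ?ler0n // ltW.
case: (ex_minnP exm) => m hm mmin.
have low := @kin_lower _ _ _ _ hL hB N phi1 m hf ne (fun f wf => mmin _ (all_f f wf)).
have [chi [dE [c1 c2 c3 c4 c5]]] := trial_energy hN.
have up := hmin _ c1 c2; rewrite c3 c4 mulr1 in up.
have hE : (L * L - N.+1)%N = h by rewrite -hN addnK.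
rewrite hE in low.
have mdE : m%:R <= dE := le_excess s0 (le_trans low up).
have L1 : 0 < L%:R :> R by rewrite ltr0n.
have k1 : r * L%:R ^+ 3 <= L%:R ^+ 2 * dE.
  have -> : r * L%:R ^+ 3 = L%:R ^+ 2 * (r * L%:R) by ring.
  by apply: ler_wpM2l; [exact: sqr_ge0|exact: le_trans hm mdE].
have k2 : 0 < r * L%:R ^+ 3 by rewrite mulr_gt0 ?exprn_gt0.
exact: (excess_contradiction k1 k2 c5 hH).
Qed.

Lemma connect_inside_sym (A : {set site L}) : connect_sym (inside A).
Proof. by apply: sym_connect_sym => x y; rewrite /inside nbr_sym [(x \in A) && _]andbC. Qed.

Lemma large_spin N (phi1 : st) (r lam0 : R) h f : (h + N = L * L)%N -> 0 < r -> r < 1 ->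
  25 * h%:R ^+ 2 <= r * L%:R ^+ 3 -> fin mu phi1 -> Stot_sq phi1 = rC lam0 *: phi1 ->
  amp mu phi1 (f : {ffun 'I_N -> site L * bool}) != 0 -> (adjacency (holes f))%:R < r * L%:R ->
  exists m k : nat, [/\ (k + m = N)%N, 14 * m%:R < r ^+ 2 * N%:R &
    3 / 4 * N%:R - 3 / 4 * (N%:R * (N%:R - 1)) + k%:R * (k%:R - 1) <= lam0].
Proof.
move=> hN r0 r1 hH hf hS wf hadj.
pose X i := (f i).1; pose D := holes f; pose A : {set site L} := [set X i | i : 'I_N].
have Xinj : injective X := amp_inj hL hB hf wf.
have DA : D = ~: A by [].
have AD : ~: D = A by rewrite DA setCK.
have cA : #|A| = N by rewrite card_imset // card_ord.
have cD : #|D| = h by rewrite (card_holes hL hB hf wf) -hN addnK.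
pose a := (ah D + av D + ad D)%N.
have adjE : adjacency D = (2 * a)%N by rewrite /adjacency card_adjacent.
have L1 : 0 < L%:R :> R by rewrite ltr0n.
have ha : 2 * a%:R < r * L%:R :> R by rewrite -natrM -adjE.
have haL : (2 * a < L)%N.
  by rewrite -(ltr_nat R) natrM; apply: lt_le_trans ha _; rewrite ler_piMl // ltW.
have h25 : (25 * #|D| ^ 2 <= L ^ 3)%N.
  rewrite cD -(ler_nat R) natrM !natrX; apply: le_trans hH _.
  by rewrite ler_piMl ?exprn_ge0 // ltW.
(* From [25 h^2 <= L^3] and [L >= 3] follows [75 h^2 <= L^4], more than the required
   [64 h^2 <= L^4]. *)
have h8 : (8 * h <= L * L)%N.
  have e : (25 * h ^ 2 <= L ^ 3)%N by rewrite -cD.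
  have : (64 * h ^ 2 <= L ^ 4)%N.
    have : (3 * L ^ 3 <= L ^ 4)%N by rewrite [X in (_ <= X)%N]expnS leq_mul2r; apply/orP; right.
    lia.
  move=> u; rewrite -(@leq_exp2r _ _ 2) //.
  have -> : ((8 * h) ^ 2 = 64 * h ^ 2)%N by rewrite expnMn.
  by have -> : ((L * L) ^ 2 = L ^ 4)%N by rewrite expnMn -expnD.
have h16 : (4 * a ^ 2 <= L * L)%N.
  have : ((2 * a) ^ 2 <= L ^ 2)%N by rewrite leq_exp2r // ltnW.
  by rewrite expnMn -mulnn.
pose b := (a ^ 2 %/ 4)%N.
have b4 : (4 * b <= a ^ 2)%N by rewrite mulnC leq_trunc_div.
have iso G : isolated A G -> (#|G| <= b)%N \/ (#|A :\: G| <= b)%N.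
  move=> hG; have GA : G \subset A by case/andP: hG.
  have U : ~: (G :|: (A :\: G)) = D.
    rewrite DA; congr (~: _); apply/setP => x; rewrite !inE.
    by case xG : (x \in G) => //=; rewrite (fintype.subsetP GA).
  have := isoperimetric hL (isolated_sep hG); rewrite U => /(_ h25 haL).
  by case=> u; [left|right]; rewrite leq_divRL // mulnC.
(* [b] is at most [L^2 / 16], while [A] has at least [7 L^2 / 8] elements. *)
have hb : (3 * b < #|A|)%N.
  have L9 : (9 <= L * L)%N by apply: (@leq_mul 3 3).
  by rewrite cA; lia.
have [x xA hx] := large_component hL hb iso.
have sub : component A x \subset A by case/andP: (component_isolated xA).
pose AI := [set i | X i \in component A x].
have cAI : #|AI| = #|component A x|.
  rewrite -(card_imset _ Xinj); congr #|pred_of_set _|; apply/setP => y; apply/imsetP/idP.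
    by move=> [i iA ->]; move: iA; rewrite inE.
  move=> yC; have /imsetP[i _ yE] := fintype.subsetP sub _ yC.
  by exists i; rewrite // inE -yE.
have split_card : (#|component A x| + #|A :\: component A x| = N)%N.
  by have := cardsID (component A x) A; rewrite (setIidPr sub) cA.
exists #|A :\: component A x|, #|AI|; split; first by rewrite cAI.
  exact: (defect_bound hN h8 b4 hx r0 ha).
apply: (spin_bound hS wf) => i j g; rewrite !inE => hi hj ij sg.
have hc : connect (inside A) (X i) (X j).
  by rewrite connect_inside_sym in hi; exact: connect_trans hi hj.
have [e|gd] := good_component hL hB hmu hf Xinj hc; first by rewrite e eqxx in ij.
exact: gd.
Qed.

Lemma main_case (t nu : R) (N : nat) (phi : st) :
  0 < t -> 0 < nu < 1 -> (N <= L * L)%N ->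
  (L * L)%:R - (1 - nu) `^ (4^-1) / 5 * (L * L)%:R `^ (3 / 4) <= N%:R ->
  ground_state mu t N phi -> total_spin_gt (nu * (N%:R / 2)) phi.
Proof.
move=> t0 hnu hNL hpow hg psi S S0 hS hpsi.
apply/eqP; apply/negPn/negP => hne.
have [r [r0 r1 r2 rq]] := powR_quarter hnu.
pose h := (L * L - N)%N.
have hN : (h + N = L * L)%N by rewrite subnK.
have hH : 25 * h%:R ^+ 2 <= r * L%:R ^+ 3.
  rewrite -rq -(powR_three_quarters R L) -exprMn.
  have -> : 25 * h%:R ^+ 2 = (5 * h%:R) ^+ 2 :> R by ring.
  have u0 : 0 <= (1 - nu) `^ 4^-1 * (L * L)%:R `^ (3 / 4) by rewrite mulr_ge0 ?powR_ge0.
  rewrite ler_sqr ?nnegrE // ?mulr_ge0 ?ler0n //.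
  have e : h%:R = (L * L)%:R - N%:R :> R by rewrite -hN natrD addrK.
  by rewrite e; exact: hole_count_bound hpow.
(* Without electrons [h = L^2], and the hole bound would give [25 L^4 <= L^3]. *)
have N0 : (0 < N)%N.
  rewrite lt0n; apply/eqP => N0; rewrite N0 addn0 in hN.
  have : 25 * (L * L)%:R ^+ 2 <= L%:R ^+ 3 :> R.
    rewrite -hN; apply: le_trans hH _; rewrite ler_piMl ?exprn_ge0 ?ler0n // ltW //.
  rewrite -!natrX -natrM ler_nat; apply/negP; rewrite -ltnNge.
  rewrite mulnn -expnM (_ : 2 * 2 = 4)%N // [(L ^ 4)%N]expnS mulnA ltn_Pmull ?expn_gt0 //.
have [phi1 [s1 n1 f1 S1 hmin]] := sector t0 hg hpsi hne.
have [f wf hadj] := compact_config hN N0 r0 r1 hH s1 n1 f1 hmin.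
have [m [k [km hm hl]]] := large_spin hN r0 r1 hH f1 S1 wf hadj.
rewrite r2 in hm.
apply: (@spin_contradiction R N%:R m%:R k%:R (S * (S + 1)) nu S) => //.
- by rewrite ltr0n.
- by rewrite -km natrD addrK.
Qed.

End Final.

Unset Implicit Arguments.
Theorem theorem6 (R : realType) (L : nat) (B : rel (site L))
  (mu t nu : R) (Ne : nat) (phi : state R B) :
  (2 < L)%N -> is_bond_set B ->
  0 < mu -> 0 < t -> 0 < nu < 1 ->
  (Ne <= #|{: site L}|)%N ->
  (#|{: site L}|%:R - (1 - nu) `^ (4^-1) / 5 * (#|{: site L}|%:R) `^ (3 / 4) <= Ne%:R :> R) ->
  ground_state mu t Ne phi ->
  total_spin_gt (nu * (Ne%:R / 2)) phi.
Proof.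
move=> hL; rewrite (card_site hL).
(* With [L = n.+3] the type ['Z_L] is definitionally ['I_L], the form in which the Fourier analysis
   is carried out. *)
case: L B phi hL => [|[|[|n]]] // B phi _ hB hmu t0 hnu hN hpow hg.
exact: (main_case hB hmu t0 hnu hN hpow hg).
Qed.
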